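(* Let $\Bbbk$ be an algebraically closed field, let $o=(1:0:\cdots:0)\in\mathbb{P}^n$, and let $\pi:\mathbb{P}^n\dashrightarrow\mathbb{P}^{n-1}$, $(x_0:x_1:\cdots:x_n)\mapsto(x_1:\cdots:x_n)$, be the projection from $o$. Put $$\mathrm{St}_o(\mathbb{P}^n)=\{f\in\mathrm{Bir}(\mathbb{P}^n):\exists\,\tau\in\mathrm{Bir}(\mathbb{P}^{n-1}),\ \pi f=\tau\pi\},\qquad \mathrm{Jon}_o(\mathbb{P}^n)=\{f\in\mathrm{Bir}(\mathbb{P}^n):\pi f=\pi\},$$ and let $\sigma:\mathrm{Bir}(\mathbb{P}^{n-1})\to\mathrm{Bir}(\mathbb{P}^n)$ be the injective homomorphism $(h_1:\cdots:h_n)\mapsto(x_0h_1:x_1h_1:\cdots:x_1h_n)$, where $h_1,\dots,h_n$ are homogeneous polynomials of the same degree in $x_1,\dots,x_n$. Then the subgroups $\mathrm{Jon}_o(\mathbb{P}^n)$ and $\mathrm{St}_o(\mathbb{P}^n)$ are closed in $\mathrm{Bir}(\mathbb{P}^n)$ and $\sigma(\mathrm{Bir}(\mathbb{P}^{n-1}))$ is closed in $\mathrm{Bir}(\mathbb{P}^n)$, for the Zariski topology. In particular, $\sigma$ is a closed immersion.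
   Context: For an irreducible variety $X$ over $\Bbbk$, $\mathrm{Bir}(X)$ is the group of birational maps $X\dashrightarrow X$. For a variety $T$, a pseudo-automorphism of $T\times X$ over $T$ is a birational map $\varphi:T\times X\dashrightarrow T\times X$ for which there is a dense open $U\subset T\times X$ such that: $\varphi$ is defined on $U$; $U_t:=U\cap(\{t\}\times X)$ is dense in $\{t\}\times X$ for all $t\in T$; and there is a morphism $f:U\to X$ with $\varphi|_U(t,x)=(t,f(t,x))$ and $\varphi|_{U_t}:U_t\to\{t\}\times X$ a birational morphism for every $t$. The induced map $T\to\mathrm{Bir}(X)$, $t\mapsto\varphi_t$ (also written $\varphi(t)$), is called a morphism from $T$ to $\mathrm{Bir}(X)$. Zariski topology on $\mathrm{Bir}(X)$: $\mathcal{F}\subset\mathrm{Bir}(X)$ is closed iff $\varphi^{-1}(\mathcal{F})$ is closed in $T$ for every variety $T$ and every morphism $\varphi:T\to\mathrm{Bir}(X)$ (it is equivalent to use only affine irreducible $T$). ''Closed immersion'' here is meant topologically: $\sigma$ is a homeomorphism onto its image, which is closed in $\mathrm{Bir}(\mathbb{P}^n)$. *)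

(* Defs.v *)
From HB Require Import structures.
From mathcomp Require Import all_boot all_order all_algebra.
From mathcomp Require Import mpoly.
From mathcomp Require Import boolp classical_sets topology.

Set Implicit Arguments.
Unset Strict Implicit.
Unset Printing Implicit Defensive.

Import GRing.Theory.

Local Open Scope classical_set_scope.
Local Open Scope ring_scope.
Local Open Scope quotient_scope.

(* A topological space with a sheaf of [k]-valued functions.  [regular U f]
   means that the restriction of [f] to [U] is a section over [U]; it is only
   meaningful for open [U], and the values of [f] outside [U] are junk.
   [regular_local] says at once that sections restrict, glue, and depend only
   on the values taken on [U]. *)
Record fspace (k : closedFieldType) := FSpace {
  fpoints :> topologicalType;
  regular : set fpoints -> (fpoints -> k) -> Prop;
  regular_local : forall (U : set fpoints) (f : fpoints -> k),
    (forall x, U x -> exists V g,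
       [/\ open V, V x, regular V g & forall y, V y -> U y -> f y = g y]) ->
    regular U f
}.
Arguments regular {k} _ _ _.

Section PartialMaps.
Variable k : closedFieldType.

(* A partial map is a total function together with the set on which its values
   are meaningful. *)
Record pmap (X Y : Type) := PMap { pdom : set X; pfun :> X -> Y }.

Definition pcomp (X Y Z : Type) (g : pmap Y Z) (f : pmap X Y) : pmap X Z :=
  PMap (pdom f `&` f @^-1` pdom g) (g \o f).

Definition pid (X : Type) : pmap X X := PMap setT id.

Definition is_morphism (X Y : fspace k) (f : pmap X Y) : Prop :=
  forall V : set Y, open V ->
    open (pdom f `&` f @^-1` V) /\
    forall h : Y -> k, regular Y V h ->
      regular X (pdom f `&` f @^-1` V) (h \o f).

Definition agree (X : topologicalType) (Y : Type) (f g : pmap X Y) : Prop :=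
  exists W : set X,
    [/\ open W, dense W, W `<=` pdom f `&` pdom g & forall x, W x -> f x = g x].

Definition is_ratmap (X Y : fspace k) (f : pmap X Y) : Prop :=
  [/\ open (pdom f), dense (pdom f) & is_morphism f].

(* [f] restricts to an isomorphism from the dense open [A] onto the dense open
   [pdom g], with inverse [g]. *)
Definition birational (X Y : fspace k) (f : pmap X Y) : Prop :=
  is_ratmap f /\
  exists (A : set X) (g : pmap Y X),
    [/\ [/\ open A, dense A & A `<=` pdom f], is_ratmap g,
        forall x, A x -> pdom g (f x) /\ g (f x) = x &
        forall y, pdom g y -> A (g y) /\ f (g y) = y].

End PartialMaps.

Section AffineSets.
Variables (k : closedFieldType) (m : nat) (I : set {mpoly k[m]}).

Definition affine_set : Type :=
  {x : 'rV[k]_m | `[< forall p : {mpoly k[m]}, I p -> p.@[x 0] = 0 >]}.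

HB.instance Definition _ := Choice.on affine_set.

Definition aeval (p : {mpoly k[m]}) (x : affine_set) : k := p.@[sval x 0].

Definition affine_basic : set (set affine_set) :=
  [set D | exists p : {mpoly k[m]}, D = [set x | aeval p x != 0]].

HB.instance Definition _ :=
  @isSubBaseTopological.Build affine_set (set affine_set) affine_basic id.

Definition affine_regular (U : set affine_set) (f : affine_set -> k) : Prop :=
  forall x, U x -> exists (N : set affine_set) (p q : {mpoly k[m]}),
    [/\ open N, N x &
     forall y, N y -> U y ->
       aeval q y != 0 /\ f y = aeval p y / aeval q y].

Lemma affine_regular_local (U : set affine_set) (f : affine_set -> k) :
  (forall x, U x -> exists V g,
     [/\ open V, V x, affine_regular V g &
         forall y, V y -> U y -> f y = g y]) ->
  affine_regular U f.
Proof.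
move=> H x /H [V [g [oV Vx /(_ x Vx) [N [p [q [oN Nx Npq]]]] fg]]].
exists (V `&` N), p, q; split; [exact: openI|by []|].
by move=> y [Vy Ny] Uy; rewrite fg //; exact: Npq.
Qed.

Definition affine_fspace : fspace k := FSpace affine_regular_local.

End AffineSets.

Section Product.
Variables (k : closedFieldType) (X Y : fspace k).

(* The product of spaces with functions.  This is an alias of [X * Y] because
   the product carries its Zariski topology, not the product topology. *)
Definition prod_points : Type := (X * Y)%type.

HB.instance Definition _ := Choice.copy prod_points (X * Y)%type.

(* The functions on [U * V] coming from the tensor product of the algebras of
   regular functions on [U] and on [V]. *)
Definition tensor (U : set X) (V : set Y) : set (prod_points -> k) :=
  [set F | exists (r : nat) (f : 'I_r -> X -> k) (g : 'I_r -> Y -> k),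
    [/\ forall i, regular X U (f i), forall i, regular Y V (g i) &
        forall z, F z = \sum_(i < r) f i z.1 * g i z.2]].

Definition prod_basic : set (set prod_points) :=
  [set D | exists (U : set X) (V : set Y) (F : prod_points -> k),
    [/\ open U, open V, tensor U V F &
        D = [set z | [/\ U z.1, V z.2 & F z != 0]]]].

HB.instance Definition _ :=
  @isSubBaseTopological.Build prod_points (set prod_points) prod_basic id.

Definition prod_regular (W : set prod_points) (h : prod_points -> k) : Prop :=
  forall z, W z -> exists (N : set prod_points) (U : set X) (V : set Y) F G,
    [/\ open N /\ N z, open U /\ open V, tensor U V F, tensor U V G &
     forall w, N w -> W w ->
       [/\ U w.1, V w.2, G w != 0 & h w = F w / G w]].

Lemma prod_regular_local (W : set prod_points) (h : prod_points -> k) :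
  (forall x, W x -> exists V g,
     [/\ open V, V x, prod_regular V g &
         forall y, V y -> W y -> h y = g y]) ->
  prod_regular W h.
Proof.
move=> H x /H [V [g [oV Vx /(_ x Vx) rg hg]]].
have [N [A [B [F [G [[oN Nx] oAB tF tG NFG]]]]]] := rg.
exists (V `&` N), A, B, F, G; split => //; first by split; [exact: openI|].
by move=> y [Vy Ny] Wy; rewrite hg //; exact: NFG.
Qed.

Definition prod_fspace : fspace k := FSpace prod_regular_local.

End Product.

(* [V] is an open subset isomorphic to an affine algebraic set. *)
Definition affine_open (k : closedFieldType) (X : fspace k) (V : set X)
    : Prop :=
  open V /\
  exists (m : nat) (I : set {mpoly k[m]})
    (a : X -> affine_fspace I) (b : affine_fspace I -> X),
    [/\ is_morphism (PMap V a), is_morphism (PMap setT b),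
        forall x, V x -> b (a x) = x & forall z, V (b z) /\ a (b z) = z].

(* Varieties are reduced and separated, but possibly reducible. *)
Record variety (k : closedFieldType) := Variety {
  vspace_of :> fspace k;
  variety_affine : exists (r : nat) (V : 'I_r -> set vspace_of),
    (forall i, affine_open (V i)) /\ \bigcup_i V i = setT;
  variety_separated :
    closed ([set z | z.1 = z.2] : set (prod_fspace vspace_of vspace_of))
}.

Section Bir.
Variables (k : closedFieldType) (X : fspace k).

Lemma is_morphism_sub (Y Z : fspace k) (A : set Y) (f : pmap Y Z) :
  open A -> A `<=` pdom f -> is_morphism f -> is_morphism (PMap A f).
Proof.
move=> oA sA mf V oV; have [oU rU] := mf V oV; split => /=.
  have -> : A `&` f @^-1` V = A `&` (pdom f `&` f @^-1` V).
    apply/seteqP; split=> x /= [? ]; last by case.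
    by split=> //; split=> //; exact: sA.
  exact: openI.
move=> h rh; apply: regular_local => x [Ax Vx].
exists (pdom f `&` f @^-1` V), (h \o f); split=> //; last exact: rU.
by split=> //; exact: sA.
Qed.

Lemma is_morphism_comp (Y Z T : fspace k) (g : pmap Z T) (f : pmap Y Z) :
  is_morphism g -> is_morphism f -> is_morphism (pcomp g f).
Proof.
move=> mg mf V oV; have [oU rU] := mg V oV; have [oW rW] := mf _ oU.
rewrite /= -setIA; split=> // h /rU; exact: rW.
Qed.

Lemma birational_preim (Y Z : fspace k) (f : pmap Y Z) (D : set Z) :
  birational f -> open D -> dense D ->
  open (pdom f `&` f @^-1` D) /\ dense (pdom f `&` f @^-1` D).
Proof.
move=> [[_ _ mf] [A [g [[oA dA sA] [_ _ mg] fK gK]]]] oD dD.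
split=> [|O O0 oO]; first by have [] := mf _ oD.
have [x [Ox Ax]] := dA O O0 oO.
have [oG _] := mg (O `&` A) (openI oO oA).
have [|y [[gy [Oy Ay]] Dy]] := dD _ _ oG.
  by exists (f x); have [? fx] := fK _ Ax; split => //=; rewrite fx.
exists (g y); split=> //; split; first exact: sA.
by rewrite /= (gK _ gy).2.
Qed.

Lemma birational_inv_ex (Y Z : fspace k) (f : pmap Y Z) : birational f ->
  exists g : pmap Z Y, birational g /\
    exists A : set Y, [/\ open A, dense A, A `<=` pdom f,
      forall x, A x -> pdom g (f x) /\ g (f x) = x &
      forall y, pdom g y -> A (g y) /\ f (g y) = y].
Proof.
move=> [[_ _ mf] [A [g [[oA dA sA] rg fK gK]]]].
exists g; split; last by exists A.
have [og dg mg] := rg.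
split=> //; exists (pdom g), (PMap A f); split.
- by split.
- by split=> //; exact: is_morphism_sub.
- by move=> y gy; exact: gK.
- by move=> x Ax; exact: fK.
Qed.

Lemma birational_comp (Y Z T : fspace k) (g : pmap Z T) (f : pmap Y Z) :
  birational g -> birational f -> birational (pcomp g f).
Proof.
move=> bg bf; have [[og dg mg] _] := bg; have [[of_ df mf] _] := bf.
have [oc dc] := birational_preim bf og dg.
split; first by split=> //; exact: is_morphism_comp.
have [g' [bg' [A [oA dA sA gK g'K]]]] := birational_inv_ex bg.
have [f' [bf' [B [oB dB sB fK f'K]]]] := birational_inv_ex bf.
have [[og' dg' mg'] _] := bg'; have [[of' df' mf'] _] := bf'.
have [oAA dAA] := birational_preim bf oA dA.
exists (B `&` (pdom f `&` f @^-1` A)), (pcomp f' g'); split.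
- split; [exact: openI|exact: denseI|].
  by move=> x [Bx [fx Ax]]; split=> //; exact: sA.
- have [] := birational_preim bg' of' df'.
  by split=> //; exact: is_morphism_comp.
- move=> x [Bx [fx Ax]] /=; have [p1 p2] := gK _ Ax; have [q1 q2] := fK _ Bx.
  by split; [split=> //=; rewrite p2|rewrite p2].
- move=> y [/= gy fy]; have [p1 p2] := g'K _ gy; have [q1 q2] := f'K _ fy.
  rewrite /= q2; split=> //; split=> //.
  by split; first exact: sB.
Qed.

Lemma agree_sym (Y : topologicalType) (Z : Type) (f g : pmap Y Z) :
  agree f g -> agree g f.
Proof.
by move=> [W [oW dW sW fg]]; exists W; split=> // x Wx;
  [have [] := sW x Wx|rewrite fg].
Qed.

Lemma agree_trans (Y : topologicalType) (Z : Type) (f g h : pmap Y Z) :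
  agree f g -> agree g h -> agree f h.
Proof.
move=> [W [oW dW sW fg]] [V [oV dV sV gh]]; exists (W `&` V); split.
- exact: openI.
- exact: denseI.
- by move=> x [/sW[? _] /sV[_ ?]].
- by move=> x [Wx Vx]; rewrite fg // gh.
Qed.

Lemma agree_comp (Y Z T : fspace k) (g g' : pmap Z T) (f f' : pmap Y Z) :
  birational f -> agree g g' -> agree f f' ->
  agree (pcomp g f) (pcomp g' f').
Proof.
move=> bf [W [oW dW sW gg]] [V [oV dV sV ff]].
have [oU dU] := birational_preim bf oW dW.
exists (V `&` (pdom f `&` f @^-1` W)); split.
- exact: openI.
- exact: denseI.
- move=> x [Vx [fx Wx]]; have [v1 v2] := sV _ Vx; have [w1 w2] := sW _ Wx.
  by split; split=> //=; rewrite -ff.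
- by move=> x [Vx [fx Wx]] /=; rewrite -ff // gg.
Qed.

Record birat := Birat { birat_map :> pmap X X; biratP : birational birat_map }.

HB.instance Definition _ := gen_eqMixin birat.
HB.instance Definition _ := gen_choiceMixin birat.

Definition birat_eq : rel birat := fun f g => `[< agree f g >].

Lemma birat_eq_equiv : equiv_class_of birat_eq.
Proof.
split.
- move=> f; apply/asboolP; have [[of_ df _] _] := biratP f.
  by exists (pdom f); split.
- by move=> f g; apply/asboolP/asboolP; exact: agree_sym.
- move=> g f h /asboolP fg /asboolP gh; apply/asboolP; exact: agree_trans gh.
Qed.

Canonical birat_equiv := EquivRelPack birat_eq_equiv.

Definition Bir : Type := {eq_quot birat_equiv}.

HB.instance Definition _ := Choice.copy Bir {eq_quot birat_equiv}.

Definition bir_class (f : birat) : Bir := \pi_{eq_quot birat_equiv} f.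
Definition bir_repr (phi : Bir) : birat :=
  repr (phi : {eq_quot birat_equiv}).

Definition represents (phi : Bir) (u : pmap X X) : Prop :=
  agree (bir_repr phi) u.

Lemma bir_classP (f g : birat) : agree f g <-> bir_class f = bir_class g.
Proof.
split=> [H|/eqquotP/asboolP //]; apply/eqquotP; exact/asboolP.
Qed.

Lemma bir_reprK (phi : Bir) : bir_class (bir_repr phi) = phi.
Proof. exact: reprK. Qed.

Lemma bir_class_repr (f : birat) : agree (bir_repr (bir_class f)) f.
Proof. by apply/bir_classP; rewrite bir_reprK. Qed.

Lemma birational_id : birational (pid X).
Proof.
have rid : is_ratmap (pid X).
  split=> /=; [exact: openT| by move=> O O0 _; rewrite setIT|].
  by move=> V oV /=; rewrite setTI.
split=> //; exists setT, (pid X); split=> //.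
by split=> //; [exact: openT| move=> O O0 _; rewrite setIT].
Qed.

Definition birat_comp (g f : birat) : birat :=
  Birat (birational_comp (biratP g) (biratP f)).

Definition birat_inv (f : birat) : birat :=
  Birat (projT2 (cid (birational_inv_ex (biratP f)))).1.

Lemma birat_invP (f : birat) : exists A : set X,
  [/\ open A, dense A, A `<=` pdom f,
      forall x, A x -> pdom (birat_inv f) (f x) /\ birat_inv f (f x) = x &
      forall y, pdom (birat_inv f) y ->
        A (birat_inv f y) /\ f (birat_inv f y) = y].
Proof. exact: (projT2 (cid (birational_inv_ex (biratP f)))).2. Qed.

Lemma agree_invl (f : birat) : agree (birat_comp (birat_inv f) f) (pid X).
Proof.
have [A [oA dA sA fK _]] := birat_invP f.
exists A; split=> // x Ax; have [? ?] := fK _ Ax => //.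
by split=> //; split=> //; exact: sA.
Qed.

Lemma agree_invr (f : birat) : agree (birat_comp f (birat_inv f)) (pid X).
Proof.
have [A [oA dA sA _ gK]] := birat_invP f.
have [[og dg _] _] := biratP (birat_inv f).
exists (pdom (birat_inv f)); split=> // x gx; have [? ?] := gK _ gx => //.
by split=> //; split=> //; exact: sA.
Qed.

Definition bir_one : Bir := bir_class (Birat birational_id).
Definition bir_mul (psi phi : Bir) : Bir :=
  bir_class (birat_comp (bir_repr psi) (bir_repr phi)).
Definition bir_inv (phi : Bir) : Bir := bir_class (birat_inv (bir_repr phi)).

Lemma agree_refl (f : birat) : agree f f.
Proof. by apply/bir_classP. Qed.

Lemma bir_mulE (g f : birat) :
  bir_mul (bir_class g) (bir_class f) = bir_class (birat_comp g f).
Proof.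
by apply/bir_classP/agree_comp; [exact: biratP|exact: bir_class_repr..].
Qed.

Lemma bir_mulA : associative bir_mul.
Proof.
move=> a b c; rewrite -[a]bir_reprK -[b]bir_reprK -[c]bir_reprK !bir_mulE.
apply/bir_classP; set h := birat_comp _ _.
have [[oh dh _] _] := biratP h; exists (pdom h); split=> // x hx.
by split=> //; move: hx => /= [[? ?] ?].
Qed.

Lemma bir_mul1g : left_id bir_one bir_mul.
Proof.
move=> a; rewrite -[a]bir_reprK bir_mulE; apply/bir_classP.
have [[oh dh _] _] := biratP (bir_repr a).
by exists (pdom (bir_repr a)); split=> // x hx; split.
Qed.

Lemma bir_mulg1 : right_id bir_one bir_mul.
Proof.
move=> a; rewrite -[a]bir_reprK bir_mulE; apply/bir_classP.
have [[oh dh _] _] := biratP (bir_repr a).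
by exists (pdom (bir_repr a)); split=> // x hx; split.
Qed.

Lemma bir_mulVg : left_inverse bir_one bir_inv bir_mul.
Proof.
by move=> a; rewrite -{2}[a]bir_reprK bir_mulE; apply/bir_classP/agree_invl.
Qed.

Lemma bir_mulgV : right_inverse bir_one bir_inv bir_mul.
Proof.
by move=> a; rewrite -{1}[a]bir_reprK bir_mulE; apply/bir_classP/agree_invr.
Qed.

HB.instance Definition _ := isGroup.Build Bir
  bir_mulA bir_mul1g bir_mulg1 bir_mulVg bir_mulgV.

(* The pseudo-automorphism [(t, x) |-> (t, f (t, x))] of [T * X] over [T],
   with the open set [U] witnessing it; the fibre over [t] is identified with
   [X]. *)
Definition pseudo_aut (T : variety k) (U : set (prod_fspace T X))
    (f : prod_fspace T X -> X) : Prop :=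
  [/\ birational (PMap U (fun z => (z.1, f z) : prod_fspace T X)),
      is_morphism (PMap U f),
      forall t, dense [set x | U (t, x)] &
      forall t, birational (PMap [set x | U (t, x)] (fun x => f (t, x)))].

Definition bir_morphism (T : variety k) (phi : T -> Bir) : Prop :=
  exists (U : set (prod_fspace T X)) (f : prod_fspace T X -> X),
    pseudo_aut U f /\
    forall t, represents (phi t) (PMap [set x | U (t, x)] (fun x => f (t, x))).

Definition bir_open (O : set Bir) : Prop :=
  forall (T : variety k) (phi : T -> Bir), bir_morphism phi ->
    open (phi @^-1` O).

Lemma bir_openT : bir_open setT.
Proof. by move=> T phi _; rewrite preimage_setT; exact: openT. Qed.

Lemma bir_openI : setI_closed bir_open.
Proof.
by move=> A B oA oB T phi mphi; rewrite preimage_setI; apply: openI;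
  [exact: oA|exact: oB].
Qed.

Lemma bir_open_bigU (I : Type) (F : I -> set Bir) :
  (forall i, bir_open (F i)) -> bir_open (\bigcup_i F i).
Proof.
move=> oF T phi mphi; rewrite preimage_bigcup; apply: bigcup_open => i _.
exact: oF.
Qed.

HB.instance Definition _ :=
  isOpenTopological.Build Bir bir_openT bir_openI bir_open_bigU.

Lemma bir_closedP (F : set Bir) :
  closed F <-> forall (T : variety k) (phi : T -> Bir), bir_morphism phi ->
                 closed (phi @^-1` F).
Proof.
rewrite -openC -[open _]/(bir_open (~` F)); split=> H T phi mphi.
  by rewrite -openC preimage_setC; exact: H.
by rewrite -preimage_setC openC; exact: H.
Qed.

End Bir.

Section ProjectiveSpace.
Variables (k : closedFieldType) (n : nat).

(* Points are the lines through the origin of [k^(n+1)]. *)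
Definition proj_points : Type := {L : {vspace 'rV[k]_n.+1} | \dim L == 1%N}.

HB.instance Definition _ := Choice.on proj_points.

(* The value of [p] at some homogeneous coordinates of [L].  Only used for the
   vanishing of homogeneous [p], and for quotients of two homogeneous
   polynomials of the same degree, so the choice of coordinates is
   immaterial. *)
Definition coords (L : proj_points) : 'rV[k]_n.+1 := vpick (val L).
Definition peval (p : {mpoly k[n.+1]}) (L : proj_points) : k :=
  p.@[coords L 0].

Definition proj_basic : set (set proj_points) :=
  [set D | exists d, exists2 p : {mpoly k[n.+1]},
    p \is d.-homog & D = [set L | peval p L != 0]].

HB.instance Definition _ :=
  @isSubBaseTopological.Build proj_points (set proj_points) proj_basic id.

Definition proj_regular (U : set proj_points) (f : proj_points -> k) : Prop :=
  forall x, U x -> exists (N : set proj_points) d (p q : {mpoly k[n.+1]}),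
    [/\ open N /\ N x, p \is d.-homog, q \is d.-homog &
     forall y, N y -> U y -> peval q y != 0 /\ f y = peval p y / peval q y].

Lemma proj_regular_local (U : set proj_points) (f : proj_points -> k) :
  (forall x, U x -> exists V g,
     [/\ open V, V x, proj_regular V g & forall y, V y -> U y -> f y = g y]) ->
  proj_regular U f.
Proof.
move=> H x /H [V [g [oV Vx /(_ x Vx) [N [d [p [q [[oN Nx] hp hq Npq]]]]] fg]]].
exists (V `&` N), d, p, q; split=> //; first by split; [exact: openI|].
by move=> y [Vy Ny] Uy; rewrite fg //; exact: Npq.
Qed.

Definition proj_space : fspace k := FSpace proj_regular_local.

Lemma proj_point_subproof : \dim <[delta_mx ord0 ord0 : 'rV[k]_n.+1]>%VS == 1%N.
Proof.
rewrite dim_vline eqb1; apply/eqP => /matrixP/(_ 0 0).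
by rewrite !mxE !eqxx => /eqP; rewrite oner_eq0.
Qed.

(* The point with homogeneous coordinates [v], for nonzero [v]. *)
Definition point_of (v : 'rV[k]_n.+1) : proj_space :=
  insubd (Sub <[delta_mx ord0 ord0]>%VS proj_point_subproof : proj_points)
    <[v]>%VS.

End ProjectiveSpace.

(* The rational map [x |-> (h_0(x) : ... : h_m(x))]. *)
Definition poly_map (k : closedFieldType) (n m : nat)
    (h : 'I_m.+1 -> {mpoly k[n.+1]}) : pmap (proj_space k n) (proj_space k m) :=
  PMap [set x | exists i, peval (h i) x != 0]
       (fun x => point_of (\row_i peval (h i) x)).

Definition same_degree (k : closedFieldType) (n m : nat)
    (h : 'I_m.+1 -> {mpoly k[n.+1]}) : Prop :=
  exists d, forall i, h i \is d.-homog.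

(* The projective spaces of dimensions [n+1] and [n] are the usual P^n and
   P^(n-1); every n >= 1 of the usual notation is covered. *)

Section Jonquieres.
Variables (k : closedFieldType) (n : nat).

Definition o_point : proj_space k n.+1 := point_of (delta_mx ord0 ord0).

Definition proj_o : pmap (proj_space k n.+1) (proj_space k n) :=
  PMap [set x | x <> o_point]
       (fun x => point_of (\row_j coords x 0 (lift ord0 j))).

Definition St_o : set (Bir (proj_space k n.+1)) :=
  [set f | exists tau : Bir (proj_space k n),
     agree (pcomp proj_o (bir_repr f)) (pcomp (bir_repr tau) proj_o)].

Definition Jon_o : set (Bir (proj_space k n.+1)) :=
  [set f | agree (pcomp proj_o (bir_repr f)) proj_o].

(* [h_j(x_1, ..., x_(n+1))] as a polynomial in [x_0, ..., x_(n+1)]. *)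
Definition shift_vars (p : {mpoly k[n.+1]}) : {mpoly k[n.+2]} :=
  p \mPo [tuple 'X_(lift ord0 j) | j < n.+1].

(* (x_0 h_1 : x_1 h_1 : ... : x_1 h_(n+1)), where [h_(j+1)] is [h j]. *)
Definition sigma_formula (h : 'I_n.+1 -> {mpoly k[n.+1]}) (i : 'I_n.+2) :
    {mpoly k[n.+2]} :=
  if unlift ord0 i is Some j then 'X_(lift ord0 ord0) * shift_vars (h j)
  else 'X_ord0 * shift_vars (h ord0).

(* [xget] selects the unique map given by the formula for some (equivalently,
   any) homogeneous polynomials representing [tau]. *)
Definition sigma (tau : Bir (proj_space k n)) : Bir (proj_space k n.+1) :=
  xget 1%g [set g | exists h : 'I_n.+1 -> {mpoly k[n.+1]},
    [/\ same_degree h, represents tau (poly_map h) &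
        represents g (poly_map (sigma_formula h))]].

End Jonquieres.

Definition is_subgroup (G : groupType) (H : set G) : Prop :=
  [/\ H 1%g, forall x y, H x -> H y -> H (x * y)%g &
      forall x, H x -> H (x^-1)%g].

Definition closed_immersion (X Y : topologicalType) (f : X -> Y) : Prop :=
  [/\ injective f, continuous f,
      forall U : set X, open U ->
        exists2 V : set Y, open V & f @` U = range f `&` V &
      closed (range f)].

(* Main.v *)
Require Import Defs.
From HB Require Import structures.
From mathcomp Require Import all_boot all_order all_algebra.
From mathcomp Require Import mpoly ring zify.
From mathcomp Require Import boolp classical_sets topology.

Set Implicit Arguments.
Unset Strict Implicit.
Unset Printing Implicit Defensive.

(* Closedness in [Bir(P^n)] can be tested on tuples of forms whose coefficients
   are polynomials in parameters [t].  Locally on [T] a morphism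
   [T -> Bir(P^n)] is such a family.  Conversely, the inverse of a birational
   map of degree [d] is given by forms of degree bounded in terms of [d] and
   [n], so the coefficients of an inverse solve a linear system with
   coefficients polynomial in [t]; solving it over a set of parameters with
   [t0] in its closure, and localizing, gives a morphism to [Bir(P^n)] from an
   affine variety through [t0].
   For such families the conditions at hand are identities of polynomials in
   [t].  The map [f = (h_0 : ... : h_n)] is in [Jon_o] iff [(h_1, ..., h_n)] is
   proportional to [(x_1, ..., x_n)].  If the restriction [w(x_1, ..., x_n)] of
   [(h_1, ..., h_n)] to a hyperplane [x_0 = b x_1] is not zero, then [f] is in
   [St_o] iff [(h_1, ..., h_n)] is proportional to [w]: in that case [f] maps
   lines through [o] to lines through [o], hence so does its inverse, and [w] is
   birational.  Finally [f] is in the image of [sigma] iff moreover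
   [x_1 h_0 = x_0 h_1], and then [w] represents its preimage; so [sigma] is also
   a closed map. *)

(* The section confines [GRing.Theory], which shadows [monoid_morphism]. *)
Section ClosedSubgroups.
Import Order.TTheory GRing.Theory.
Local Open Scope ring_scope.
Local Open Scope classical_set_scope.
Local Notation pmap := Defs.pmap.
Local Notation pcomp := Defs.pcomp.

(** * Substitution in homogeneous polynomials *)

(** What has to be built from a polynomial family is a pseudo-automorphism of [T * X], and two
    obstacles shape the construction. The condition that [g o h] be proportional to the identity is
    linear in [g], but it also holds when [g o h = 0]. This is excluded by asking that [P o h] be
    nonzero for every nonzero form [P] of one fixed degree: an open condition on the parameter,
    satisfied at [t0] because [phi0] is birational. Moreover the polynomial solution [g] may vanish
    at [t0] and then does not invert the member there. The total map is birational all the same,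
    since this involves only a dense set of parameters, while the fibre over each parameter gets an
    inverse of its own: solvability of the linear system is a rank condition, so it passes to the
    closure.

    The degree bound comes from a dimension count and the normality of polynomial rings, so it makes
    no assumption on the characteristic. *)

Lemma mpoly_rmorph_eq (n : nat) (R : comNzRingType) (S : comNzRingType)
    (f g : {rmorphism {mpoly R[n]} -> S}) :
  (forall c, f c%:MP = g c%:MP) -> (forall i, f 'X_i = g 'X_i) -> f =1 g.
Proof.
move=> fgC fgX; elim/mpolyind => [|c m p _ _ IH]; first by rewrite !rmorph0.
rewrite !rmorphD IH -mul_mpolyC !rmorphM fgC mpolyXE_id !rmorph_prod.
by congr (_ * _ + _); apply: eq_bigr => i _; rewrite !rmorphXn fgX.
Qed.

Lemma meval_map_mpoly (n : nat) (R S : comNzRingType) (f : {rmorphism R -> S})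
    (v : 'I_n -> S) (p : {mpoly R[n]}) :
  (map_mpoly f p).@[v] = mmap f v p.
Proof.
rewrite -[LHS]/((meval v \o map_mpoly f) p).
apply: mpoly_rmorph_eq => [c|i] /=.
  by rewrite map_mpolyC mevalC mmapC.
by rewrite map_mpolyX mevalXU mmapX mmap1U.
Qed.

Lemma mmap_comp (n m : nat) (R S : comNzRingType) (f : {rmorphism R -> S})
    (v : 'I_n -> S) (h : 'I_m -> {mpoly R[n]}) (p : {mpoly R[m]}) :
  mmap f v (p \mPo [tuple h i | i < m]) = mmap f (fun i => mmap f v (h i)) p.
Proof.
rewrite -[LHS]/((mmap f v \o comp_mpoly [tuple h i | i < m]) p).
apply: mpoly_rmorph_eq => [c|i] /=; first by rewrite comp_mpolyC !mmapC.
by rewrite comp_mpolyXU -tnth_nth tnth_mktuple mmapX mmap1U.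
Qed.

Lemma meval_comp (n m : nat) (R : comNzRingType) (v : 'I_n -> R)
    (h : 'I_m -> {mpoly R[n]}) (p : {mpoly R[m]}) :
  (p \mPo [tuple h i | i < m]).@[v] = p.@[fun i => (h i).@[v]].
Proof. by rewrite comp_mpoly_meval; apply: meval_eq => i; rewrite tnth_mktuple. Qed.

Lemma map_mpoly_subst (n m : nat) (R S : comNzRingType) (f : {rmorphism R -> S})
    (h : 'I_m -> {mpoly R[n]}) (p : {mpoly R[m]}) :
  map_mpoly f (p \mPo [tuple h i | i < m]) =
  map_mpoly f p \mPo [tuple map_mpoly f (h i) | i < m].
Proof.
rewrite -[LHS]/((map_mpoly f \o comp_mpoly [tuple h i | i < m]) p).
rewrite -[RHS]/((comp_mpoly [tuple map_mpoly f (h i) | i < m] \o map_mpoly f) p).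
apply: mpoly_rmorph_eq => [c|i] /=.
  by rewrite comp_mpolyC !map_mpolyC comp_mpolyC.
by rewrite comp_mpolyXU map_mpolyX comp_mpolyXU -!tnth_nth !tnth_mktuple.
Qed.

Lemma dhomog_subst (n m : nat) (R : comNzRingType) (d e : nat)
    (h : 'I_m -> {mpoly R[n]}) (p : {mpoly R[m]}) :
  p \is d.-homog -> (forall i, h i \is e.-homog) ->
  p \mPo [tuple h i | i < m] \is (d * e).-homog.
Proof.
move=> /dhomogP hp hh; rewrite comp_mpolyEX big_seq; apply: rpred_sum => mm /hp hm.
apply: dhomogZ; rewrite comp_mpolyX -(hm) /= mdegE big_distrl /=.
elim/big_ind2: _ => [|? ? ? ?|i _]; [exact: dhomog1|exact: dhomogM|].
by rewrite tnth_mktuple mulnC; exact: dhomogMn.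
Qed.

Lemma map_mpoly_dhomog (n : nat) (R S : comNzRingType) (f : {rmorphism R -> S}) d
    (p : {mpoly R[n]}) :
  p \is d.-homog -> map_mpoly f p \is d.-homog.
Proof.
move=> /dhomogP hp; apply/dhomogP => m; rewrite mcoeff_msupp mcoeff_map_mpoly => fm.
by apply: hp; rewrite mcoeff_msupp; apply: contraNneq fm => ->; rewrite raddf0.
Qed.

Lemma mmap_homogZ (n : nat) (R S : comNzRingType) (f : {rmorphism R -> S}) d
    (v : 'I_n -> S) (a : S) (p : {mpoly R[n]}) :
  p \is d.-homog -> mmap f (fun i => a * v i) p = a ^+ d * mmap f v p.
Proof.
move=> /dhomogP hp; rewrite /mmap mulr_sumr big_seq [RHS]big_seq.
apply: eq_bigr => m /hp hm; rewrite mulrCA; congr (_ * _).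
rewrite /mmap1 -(hm) /= mdegE -prodrXr -big_split /=.
by apply: eq_bigr => i _; rewrite exprMn.
Qed.

Lemma dhomogU (n : nat) (R : nzRingType) (i : 'I_n) :
  'X_i \is [in R[n], 1.-homog].
Proof. by rewrite dhomogX /= mdeg1. Qed.

Lemma mpolyX_neq0 (n : nat) (R : nzRingType) (i : 'I_n) : 'X_i != 0 :> {mpoly R[n]}.
Proof. by rewrite -mleadc_eq0 mleadXm mcoeffX eqxx oner_eq0. Qed.

Lemma comp_tupleE (n m : nat) (R : nzRingType) (h : 'I_m -> {mpoly R[n]})
    (p : {mpoly R[m]}) :
  p \mPo [tuple h i | i < m] = mmap (@mpolyC n R) h p.
Proof.
by rewrite /comp_mpoly; congr mmap; apply: funext => i; rewrite tnth_mktuple.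
Qed.

Lemma comp_tupleA (n m l : nat) (R : comNzRingType) (h : 'I_m -> {mpoly R[n]})
    (g : 'I_l -> {mpoly R[m]}) (p : {mpoly R[l]}) :
  (p \mPo [tuple g i | i < l]) \mPo [tuple h i | i < m] =
  p \mPo [tuple g i \mPo [tuple h j | j < m] | i < l].
Proof.
have E : (fun i => mmap (@mpolyC n R) h (g i)) = (fun i => g i \mPo [tuple h j | j < m]).
  by apply: funext => i; rewrite comp_tupleE.
apply: etrans (comp_tupleE h _) (etrans (mmap_comp (@mpolyC n R) h g p) _).
by rewrite E -comp_tupleE.
Qed.

Lemma comp_homogZ (n m : nat) (R : comNzRingType) d (h : 'I_m -> {mpoly R[n]})
    (a : {mpoly R[n]}) (p : {mpoly R[m]}) : p \is d.-homog ->
  p \mPo [tuple a * h i | i < m] = a ^+ d * (p \mPo [tuple h i | i < m]).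
Proof. by move=> hp; rewrite !comp_tupleE; exact: (mmap_homogZ (@mpolyC n R) h a hp). Qed.

Lemma comp_tupleXU (n m : nat) (R : nzRingType) (h : 'I_m -> {mpoly R[n]}) (i : 'I_m) :
  'X_i \mPo [tuple h i | i < m] = h i.
Proof. by rewrite comp_mpolyXU -tnth_nth tnth_mktuple. Qed.

Lemma meval_homogZ (n : nat) (R : comNzRingType) d (v : 'I_n -> R) (a : R)
    (p : {mpoly R[n]}) :
  p \is d.-homog -> p.@[fun i => a * v i] = a ^+ d * p.@[v].
Proof. exact: (mmap_homogZ idfun). Qed.

(** * Degree bound for inverses *)

Section MultivariateDivisibility.
Variables (k : fieldType) (n : nat).
Implicit Types a b c : {mpoly k[n]}.

Definition divides b a := exists q, a = q * b.

Lemma divides_sum (I : Type) (r : seq I) (F : I -> {mpoly k[n]}) b :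
  (forall i, divides b (F i)) -> divides b (\sum_(i <- r) F i).
Proof.
move=> H; elim/big_ind: _ => // [|x y [q ->] [q' ->]].
  by exists 0; rewrite mul0r.
by exists (q + q'); rewrite mulrDl.
Qed.

(* The leading monomial of [b] divides that of [a], so [a] can be reduced
   modulo [b] without losing the hypothesis. *)
Lemma completely_integrally_closed b c : b != 0 -> c != 0 ->
  forall a, (forall N, divides (b ^+ N) (c * a ^+ N)) -> divides b a.
Proof.
move=> b0 c0; elim/mleadrect => a IH H.
have [->|a0] := eqVneq a 0; first by exists 0; rewrite mul0r.
have le_ba : (mlead b <= mlead a)%MM.
  apply/mnm_lepP => i; rewrite leqNgt; apply/negP => lt_ab.
  (* If [x_i] had a smaller exponent in the leading monomial of [a] than in that of [b], then
     [c * a ^ N] would be short of [N] powers of [x_i] that only [c] could supply; this [N] exceeds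
     what [c] has. *)
  have [q E] := H (mlead c i).+1.
  have [q0|q0] := eqVneq q 0.
    by have := mulf_neq0 c0 (expf_neq0 (mlead c i).+1 a0); rewrite E q0 mul0r eqxx.
  move/(congr1 (@mlead _ _)): E.
  rewrite !mleadM ?mleadX ?expf_neq0 // => /mnmP/(_ i).
  rewrite !mnmDE !mulmnE.
  move: (mlead a i) (mlead b i) (mlead c i) (mlead q i) lt_ab => x y z w lt_xy.
  have : (z.+1 * x.+1 <= z.+1 * y)%N by rewrite leq_mul2l lt_xy orbT.
  by lia.
pose t := (mleadc a / mleadc b) *: 'X_[(mlead a - mlead b)] : {mpoly k[n]}.
have lcb : mleadc b != 0 by rewrite mleadc_eq0.
have lca : mleadc a != 0 by rewrite mleadc_eq0.
have t0 : t != 0.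
  rewrite -mleadc_eq0 /t mleadZ ?mulf_neq0 ?invr_eq0 // mleadXm mcoeffZ mcoeffX.
  by rewrite eqxx mulr1 mulf_neq0 ?invr_eq0.
suff [q] : divides b (a - t * b).
  by move/(canRL (subrK _)) => ->; exists (q + t); rewrite mulrDl.
have [->|a'0] := eqVneq (a - t * b) 0; first by exists 0; rewrite mul0r.
apply: IH.
  have lt_b : mlead (t * b) = mlead a.
    by rewrite mleadM // /t mleadZ ?mulf_neq0 ?invr_eq0 // mleadXm submK.
  rewrite lt_neqAle; apply/andP; split; last first.
    by have := mleadB_le a (t * b); rewrite lt_b joinxx.
  apply: contraNneq a'0 => E; rewrite -mleadc_eq0 E mcoeffB /t -scalerAl mcoeffZ.
  by rewrite -{3}(submK le_ba) mulrC [_ * b]mulrC mcoeffMX mulrC divfK // subrr.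
(* The hypothesis passes to [a - t * b]: in each term of the binomial expansion, [c * a ^ (N - i)]
   supplies [b ^ (N - i)] and [(t * b) ^ i] supplies [b ^ i]. *)
move=> N; rewrite exprBn mulr_sumr; apply: divides_sum => i.
have [q Hq] := H (N - i)%N.
exists ((-1) ^+ i * q * t ^+ i *+ 'C(N, i)).
rewrite mulrnAl mulrnAr; congr (_ *+ _).
rewrite [c * _](_ : _ = (-1) ^+ i * (c * a ^+ (N - i)) * (t * b) ^+ i); last by ring.
have -> : b ^+ N = b ^+ (N - i) * b ^+ i by rewrite -exprD subnK // -ltnS.
by rewrite Hq exprMn; ring.
Qed.

(** Multiplied by a power of [P J], the relation becomes monic in [P J * a / b], which is thus
    integral. All powers of this quotient then have the common denominator [b ^ J], and complete
    integral closedness applies. *)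
Lemma integral_quotient (J : nat) (P : nat -> {mpoly k[n]}) a b :
  b != 0 -> P J != 0 -> \sum_(j < J.+1) P j * a ^+ j * b ^+ (J - j) = 0 ->
  divides b (P J * a).
Proof.
move=> b0 PJ0; case: J PJ0 => [|J] PJ0.
  by rewrite big_ord1 expr0 subnn !mulr1 => /eqP; rewrite (negbTE PJ0).
rewrite big_ord_recr /= subnn mulr1 => /eqP; rewrite addrC addr_eq0 => /eqP rel.
set u := P J.+1 * a; apply: (@completely_integrally_closed _ (b ^+ J.+1)) => //.
  exact: expf_neq0.
elim/ltn_ind => N IH; have [leN|ltN] := leqP N J.+1.
  exists (b ^+ (J.+1 - N) * u ^+ N).
  have -> : b ^+ J.+1 = b ^+ (J.+1 - N) * b ^+ N by rewrite -exprD subnK.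
  by ring.
have -> : b ^+ J.+1 * u ^+ N = - \sum_(j < J.+1)
    P J.+1 ^+ (J - j) * P j * b ^+ (J.+1 - j) * (b ^+ J.+1 * u ^+ (N - J.+1 + j)).
  have -> : u ^+ N = u ^+ (N - J.+1) * u ^+ J.+1 by rewrite -exprD subnK // ltnW.
  rewrite [u ^+ J.+1]exprMn [P J.+1 ^+ J.+1]exprS.
  rewrite (_ : b ^+ J.+1 * _ = b ^+ J.+1 * u ^+ (N - J.+1) * P J.+1 ^+ J *
    (P J.+1 * a ^+ J.+1)); last by ring.
  rewrite rel mulrN mulr_sumr; congr (- _); apply: eq_bigr => j _.
  rewrite exprD [u ^+ j]exprMn.
  have -> : P J.+1 ^+ J = P J.+1 ^+ (J - j) * P J.+1 ^+ j.
    by rewrite -exprD subnK // -ltnS.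
  by ring.
rewrite -sumrN; apply: divides_sum => j.
have [|q ->] := IH (N - J.+1 + j)%N; first by have := ltn_ord j; lia.
exists (- (P J.+1 ^+ (J - j) * P j * q)).
have -> : b ^+ N = b ^+ (N - J.+1 + j) * b ^+ (J.+1 - j).
  by rewrite -exprD; congr (_ ^+ _); have := ltn_ord j; lia.
by ring.
Qed.

(** Let [r] be [w] minus its part of degree [d]. As [r * b] is homogeneous of degree [d + e], a
    nonzero [r] would have a leading monomial of degree [d], but [r] has no monomial of that
    degree. *)
Lemma dhomog_divides d e b w : b != 0 -> b \is e.-homog ->
  w * b \is (d + e).-homog -> w \is d.-homog.
Proof.
move=> b0 hb hwb; pose r := w - pihomog mdeg d w.
suff r0 : r = 0 by move/eqP: r0; rewrite subr_eq0 => /eqP ->; exact: pihomogP.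
apply/eqP; apply: contraT => r0.
have hrb : r * b \is (d + e).-homog.
  by rewrite mulrBl; apply: rpredB => //; apply: dhomogM => //; exact: pihomogP.
have : mdeg (mlead (r * b)) = (d + e)%N.
  by apply: (dhomog_mf hrb); apply: mlead_supp; rewrite mulf_neq0.
rewrite mleadM // mdegD (dhomog_mf hb (mlead_supp b0)) => /addIn dr.
have := mlead_supp r0; rewrite mcoeff_msupp mcoeffB.
suff -> : (pihomog mdeg d w)@_(mlead r) = w@_(mlead r) by rewrite subrr eqxx.
rewrite pihomogE raddf_sum /= -[RHS]mulr1.
have [wr|wr] := boolP (mlead r \in msupp w); last first.
  rewrite (memN_msupp_eq0 wr) mul0r big_seq_cond big1 // => m /andP[mw _].
  rewrite mcoeffZ mcoeffX; case: eqP => [E|]; last by rewrite mulr0.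
  by rewrite -E mw in wr.
rewrite (big_rem _ wr) /= dr eqxx mcoeffZ mcoeffX eqxx.
rewrite big_seq_cond big1 ?addr0 // => m /andP[]; rewrite mem_rem_uniq ?msupp_uniq //.
by rewrite inE => /andP[/= /negbTE mr _] _; rewrite mcoeffZ mcoeffX mr mulr0.
Qed.

End MultivariateDivisibility.

(** ['C(s + n, n)] counts the monomials of degree [s] in [n + 1] variables: multiplying the degree
    by [c + 1] multiplies their number by at most [(c + 1) ^ n]. *)
Lemma binomial_scale_bound (c s n : nat) :
  ('C(c.+1 * s + n, n) <= c.+1 ^ n * 'C(s + n, n))%N.
Proof.
elim: n => [|n IH]; first by rewrite !bin0.
rewrite -(leq_pmul2l (ltn0Sn n)) [leqRHS]mulnCA !addnS -!mul_bin_diag /= expnS.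
have -> : (c.+1 * c.+1 ^ n * ((s + n).+1 * 'C(s + n, n)) =
  (c.+1 * (s + n).+1) * (c.+1 ^ n * 'C(s + n, n)))%N by lia.
by apply: leq_mul => //; nia.
Qed.

Lemma linear_kernel_neq0 (k : fieldType) (V W : vectType k) (f : {linear V -> W}) :
  (dim W < dim V)%N -> exists2 v, v != 0 & f v = 0.
Proof.
move=> ltd; pose F := linfun f.
have : (\dim (lker F) != 0)%N.
  have := limg_ker_dim F fullv; rewrite capfv dimvf => E.
  have : (\dim (limg F) <= dim W)%N by rewrite -dimvf dimvS // subvf.
  by apply: contraTneq => E0; move: E; rewrite E0 add0n => ->; rewrite -ltnNge.
rewrite dimv_eq0 => H; exists (vpick (lker F)); first by rewrite vpick0.
by have := memv_pick (lker F); rewrite memv_ker lfunE => /eqP.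
Qed.

Section Degree.
Variables (k : fieldType) (n : nat).

(* Dimension count: [s + 1] forms of degree [s] have more coefficients than a
   form of degree [s * d + s]. *)
Lemma algebraic_relation (d : nat) (h : 'I_n.+1 -> {mpoly k[n.+1]}) (s := (d.+1 ^ n)%N)
    (x y : {mpoly k[n.+1]}) :
  (forall i, h i \is d.-homog) -> x \is 1.-homog -> y \is 1.-homog ->
  exists P : 'I_s.+1 -> {mpoly k[n.+1]},
    [/\ forall j, P j \is s.-homog, exists j, P j != 0 &
        \sum_j (P j \mPo [tuple h i | i < n.+1]) * x ^+ j * y ^+ (s - j) = 0].
Proof.
move=> hh hx hy.
pose F (P : {ffun 'I_s.+1 -> dhomog n.+1 k s}) : {mpoly k[n.+1]} :=
  \sum_j (val (P j) \mPo [tuple h i | i < n.+1]) * x ^+ j * y ^+ (s - j).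
have hF P : F P \is (s * d + s).-homog.
  apply: rpred_sum => j _; have -> : (s * d + s = s * d + 1 * j + 1 * (s - j))%N.
    by rewrite !mul1n -addnA subnKC // -ltnS.
  apply: dhomogM; [apply: dhomogM|].
  - by apply: dhomog_subst => //; exact: dhomog_is_dhomog.
  - exact: dhomogMn hx.
  - exact: dhomogMn hy.
pose G P : dhomog n.+1 k (s * d + s) := DHomog (hF P).
have linG : linear G.
  move=> a P Q; apply: val_inj => /=; rewrite /F scaler_sumr -big_split /=.
  apply: eq_bigr => j _; rewrite !ffunE /= linearP /= !mulrDl -!scalerAl.
  by [].
pose GL := GRing.isLinear.Build _ _ _ _ G linG.
pose Gl : {linear {ffun 'I_s.+1 -> dhomog n.+1 k s} -> dhomog n.+1 k (s * d + s)} :=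
  HB.pack G GL.
have [|P P0 GP] := @linear_kernel_neq0 _ _ _ Gl.
  have E : dim {ffun 'I_s.+1 -> dhomog n.+1 k s} = (s.+1 * 'C(s + n, s))%N.
    by rewrite /dim /= card_ord.
  have E2 : dim (dhomog n.+1 k (s * d + s)) = 'C(s * d + s + n, s * d + s) by [].
  rewrite E E2 -[in X in ('C(X, _) < _)%N]/(_ + n)%N.
  rewrite -(bin_sub (leq_addr n _)) -(bin_sub (leq_addr n s)) !addKn.
  have -> : (s * d + s = d.+1 * s)%N by rewrite mulSn mulnC addnC.
  (* The choice [s = d.+1 ^ n] enters here: the target has at most [s] times the dimension of the
     forms of degree [s], the source [s + 1] times. *)
  apply: leq_ltn_trans (binomial_scale_bound d s n) _.
  by rewrite ltn_mul2r ltnSn andbT bin_gt0 leq_addl.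
exists (fun j => val (P j)); split.
- by move=> j; exact: dhomog_is_dhomog.
- apply: contrapT => H; move/eqP: P0; apply; apply/ffunP => j; rewrite ffunE.
  apply: val_inj => /=; apply: contrapT => /eqP Pj; apply: H; exists j; exact: Pj.
- by have /(congr1 val) := GP.
Qed.

(* Pulling the relation between the [h_i], [x_i] and [x_0] back along [g'] gives
   an algebraic relation for [g'_i / g'_0] whose coefficients have degree
   [d.+1 ^ n]; its leading coefficient is then a denominator of that quotient. *)
Lemma bounded_degree_inverse (d e : nat) (h g' : 'I_n.+1 -> {mpoly k[n.+1]})
    (p q c c' : {mpoly k[n.+1]}) :
  (forall i, h i \is d.-homog) -> (forall i, g' i \is e.-homog) ->
  p != 0 -> q != 0 -> c != 0 -> c' != 0 ->
  (forall i, (g' i \mPo [tuple h i | i < n.+1]) * c = p * 'X_i) ->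
  (forall i, (h i \mPo [tuple g' i | i < n.+1]) * c' = q * 'X_i) ->
  exists g : 'I_n.+1 -> {mpoly k[n.+1]},
    [/\ forall i, g i \is (n.+1 * d.+1 ^ n).-homog, exists i, g i != 0 &
        forall i j, (g i \mPo [tuple h i | i < n.+1]) * 'X_j =
                    (g j \mPo [tuple h i | i < n.+1]) * 'X_i].
Proof.
move=> hh hg p0 q0 c0 c'0 gh hg'; set s := (d.+1 ^ n)%N.
have b0 i : g' i != 0.
  apply: contraTneq (mulf_neq0 p0 (mpolyX_neq0 k i)) => gi.
  by rewrite -gh gi comp_mpoly0 mul0r eqxx.
have /choice[vw hvw] : forall i, exists vw : {mpoly k[n.+1]} * {mpoly k[n.+1]},
    [/\ vw.1 != 0, vw.1 \is s.-homog, vw.2 \is s.-homog &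
        vw.1 * g' i = vw.2 * g' ord0].
  move=> i.
  have [P [hP P0 rel]] := algebraic_relation hh (dhomogU k i) (dhomogU k ord0).
  pose J := [arg max_(j > xchoose P0 | P j != 0) (j : nat)].
  have [PJ0 PJmax] : P J != 0 /\ forall j, P j != 0 -> (j <= J)%N.
    by rewrite /J; case: arg_maxnP => [|j Pj H]; [exact: (xchooseP P0)|].
  have [||w Hw] := @integral_quotient k n.+1 J (fun j => P (inord j)) (g' i) (g' ord0)
    (b0 ord0).
    by rewrite inord_val.
    have E : (q ^+ s * \sum_(j < s.+1) P j * g' i ^+ j * g' ord0 ^+ (s - j)) = 0.
      (* All the [P j] are homogeneous of degree [s]: after multiplication by [c' ^ s], substituting
         [h o g'] amounts to substituting [q * x], and a common factor [q ^ s] comes out. *)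
      have := congr1 (comp_mpoly [tuple g' i | i < n.+1]) rel.
      rewrite rmorph0 raddf_sum /= => /(congr1 ( *%R (c' ^+ s))); rewrite mulr0 => rel0.
      rewrite -[RHS]rel0 !mulr_sumr; apply: eq_bigr => j _.
      rewrite !rmorphM !rmorphXn /= !comp_mpolyXU -!tnth_nth !tnth_mktuple !mulrA.
      congr (_ * _ * _).
      rewrite comp_tupleA -[P j in LHS]comp_mpoly_id -!(comp_homogZ _ _ (hP j)).
      congr comp_mpoly; apply: eq_from_tnth => l; rewrite !tnth_mktuple.
      by rewrite [RHS]mulrC hg'.
    move/eqP: E; rewrite mulf_eq0 expf_eq0 (negbTE q0) andbF /=.
    have sJ : s.+1 = (J.+1 + (s - J))%N by rewrite addSn subnKC // -ltnS.
    rewrite -(big_mkord xpredT (fun j => P (inord j) * g' i ^+ j * g' ord0 ^+ (J - j))).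
    have -> : \sum_(j < s.+1) P j * g' i ^+ j * g' ord0 ^+ (s - j) =
      \sum_(0 <= j < s.+1) P (inord j) * g' i ^+ j * g' ord0 ^+ (s - j).
      by rewrite big_mkord; apply: eq_bigr => j _; rewrite inord_val.
    rewrite (@big_cat_nat _ _ _ J.+1) //= [X in _ + X]big_nat [X in _ + X]big1; last first.
      move=> j /andP[ltJ ltj]; have [->|/PJmax] := eqVneq (P (inord j)) 0.
        by rewrite !mul0r.
      by rewrite inordK // leqNgt ltJ.
    rewrite addr0.
    have -> : \sum_(0 <= j < J.+1) P (inord j) * g' i ^+ j * g' ord0 ^+ (s - j) =
      (\sum_(0 <= j < J.+1) P (inord j) * g' i ^+ j * g' ord0 ^+ (J - j)) * g' ord0 ^+ (s - J).
      rewrite mulr_suml big_nat [RHS]big_nat; apply: eq_bigr => j /andP[_ ltj].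
      rewrite -!mulrA -exprD; do 2!congr (_ * _); congr (_ ^+ _).
      by have := ltn_ord J; lia.
    by rewrite mulf_eq0 expf_eq0 (negbTE (b0 _)) andbF orbF => /eqP.
  rewrite inord_val in Hw; exists (P J, w); split=> //=.
  apply: (dhomog_divides (b0 ord0) (hg ord0)).
  by rewrite -Hw; apply: dhomogM.
(* Since [g'_i / g'_0 = (vw i).2 / (vw i).1], multiplying by all [n + 1] denominators, each of
   degree [s], gives forms of degree [n.+1 * s]. *)
pose g i := (vw i).2 * \prod_(l | l != i) (vw l).1.
pose V := \prod_l (vw l).1.
have V0 : V != 0 by apply/prodf_neq0 => l _; have [] := hvw l.
have gE i : g i * g' ord0 = g' i * V.
  have -> : V = (vw i).1 * \prod_(l | l != i) (vw l).1 by rewrite /V (bigD1 i).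
  by rewrite /g mulrAC; have [_ _ _ <-] := hvw i; rewrite mulrA [g' i * _]mulrC.
exists g; split.
- move=> i; have -> : (n.+1 * s = s + n * s)%N by rewrite mulSn.
  apply: dhomogM; first by have [] := hvw i.
  have -> : (n * s = \sum_(l < n.+1 | l != i) s)%N.
    by rewrite sum_nat_const cardC1 card_ord.
  elim/big_ind2: _ => [|? ? ? ?|l _]; [exact: dhomog1|exact: dhomogM|].
  by have [] := hvw l.
- exists ord0; apply: contraTneq (mulf_neq0 (b0 ord0) V0) => g0.
  by rewrite -gE g0 mul0r eqxx.
- move=> i j.
  have E : g i * g' j = g j * g' i.
    apply: (mulIf (b0 ord0)); rewrite mulrAC gE [RHS]mulrAC gE; ring.
  move: (g i) (g j) E => gi gj E.
  have := congr1 (comp_mpoly [tuple h i | i < n.+1]) E.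
  rewrite !rmorphM /= => /(congr1 (fun x => x * c)).
  rewrite -!mulrA !gh => E2; apply: (mulfI p0).
  by rewrite mulrCA E2 mulrCA.
Qed.

End Degree.

(** * Nonvanishing of polynomials over an algebraically closed field *)

Section LastVariable.
Variables (R : comNzRingType) (n : nat).

Definition split_last (p : {mpoly R[n.+1]}) : {poly {mpoly R[n]}} :=
  mmap (polyC \o @mpolyC n R)
    (fun i => if unlift ord_max i is Some j then ('X_j)%:P else 'X) p.

Lemma split_last_inj : injective split_last.
Proof.
pose W := horner_eval 'X_ord_max \o
  map_poly (comp_mpoly [tuple 'X_(lift ord_max j) | j < n] : _ -> {mpoly R[n.+1]}).
apply: (@can_inj _ _ _ W) => p.
rewrite -[LHS]/((W \o mmap (polyC \o @mpolyC n R) _) p) -[RHS]/(idfun p).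
apply: mpoly_rmorph_eq => [c|i] /=.
  by rewrite mmapC /= map_polyC /horner_eval hornerC /= comp_mpolyC.
rewrite mmapX mmap1U; case: unliftP => [j|] ->.
  by rewrite map_polyC /horner_eval hornerC /= comp_mpolyXU -tnth_nth tnth_mktuple.
by rewrite map_polyX /horner_eval hornerX.
Qed.

Lemma meval_split_last (v : 'I_n.+1 -> R) p :
  p.@[v] = (map_poly (meval (fun j => v (lift ord_max j))) (split_last p)).[v ord_max].
Proof.
rewrite -[RHS]/((horner_eval (v ord_max) \o map_poly (meval (fun j => v (lift ord_max j)))
  \o mmap (polyC \o @mpolyC n R) _) p).
apply: mpoly_rmorph_eq => [c|i] /=.
  by rewrite mmapC /= map_polyC /horner_eval hornerC /= !mevalC.
rewrite mmapX mmap1U; case: unliftP => [j|] ->.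
  by rewrite map_polyC /horner_eval hornerC /= !mevalXU.
by rewrite map_polyX /horner_eval hornerX mevalXU.
Qed.

End LastVariable.

Lemma mpoly_nonvanishing (k : closedFieldType) (n : nat) (p : {mpoly k[n]}) :
  p != 0 -> exists v, p.@[v] != 0.
Proof.
elim: n p => [|n IH] p p0.
  exists (fun=> 0); move: p0; rewrite [p]nvar0_mpolyC mevalC.
  by apply: contraNneq => ->; rewrite mpolyC0.
have : split_last p != 0.
  by apply: contraNneq p0 => E; apply/eqP/split_last_inj; rewrite E /split_last mmap0.
rewrite -lead_coef_eq0 => /IH[v vP].
have /closed_nonrootP[x] : map_poly (meval v) (split_last p) != 0.
  apply: contraNneq vP => E; rewrite lead_coefE -coef_map E coef0.
  by [].
rewrite /root => xP.
exists (fun i => if unlift ord_max i is Some j then v j else x).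
rewrite meval_split_last unlift_none; congr (_.[_] != 0): xP.
by apply: eq_map_poly => q; apply: meval_eq => j; rewrite liftK.
Qed.

(** * Linear dependence with polynomial coefficients *)

Section ZariskiClosure.
Variables (k : fieldType) (m : nat).
Implicit Types (S : set ('I_m -> k)) (t : 'I_m -> k) (Q : {mpoly k[m]}).

Definition zclosure S : set ('I_m -> k) :=
  [set t | forall Q, (forall s, S s -> Q.@[s] = 0) -> Q.@[t] = 0].

Lemma zclosureS S S' : S `<=` S' -> zclosure S `<=` zclosure S'.
Proof. by move=> SS' t H Q HQ; apply: H => s /SS'; exact: HQ. Qed.

Lemma zclosure0 t : ~ zclosure set0 t.
Proof.
move=> H; have /eqP : (1 : {mpoly k[m]}).@[t] = 0 by apply: H.
by rewrite meval1 oner_eq0.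
Qed.

Lemma zclosureU S S' t : zclosure (S `|` S') t -> zclosure S t \/ zclosure S' t.
Proof.
move=> H; apply: contrapT => /not_orP[].
move=> /existsNP[Q /not_implyP[QS /eqP Qt]] /existsNP[Q' /not_implyP[QS' /eqP Qt']].
have /eqP : (Q * Q').@[t] = 0; last by rewrite mevalM mulf_eq0 (negbTE Qt) (negbTE Qt').
by apply: H => s [/QS|/QS'] E; rewrite mevalM E ?mul0r ?mulr0.
Qed.

Lemma zclosure_bigU (J : finType) (F : J -> set ('I_m -> k)) t :
  zclosure [set s | exists j, F j s] t -> exists j, zclosure (F j) t.
Proof.
move=> H; apply: contrapT => /forallNP N.
have /choice[Q HQ] : forall j, exists Q, (forall s, F j s -> Q.@[s] = 0) /\ Q.@[t] != 0.
  by move=> j; have /existsNP[Q /not_implyP[? /eqP ?]] := N j; exists Q.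
have /eqP : (\prod_j Q j).@[t] = 0.
  apply: H => s [j Fs]; rewrite rmorph_prod /= (bigD1 j) //=.
  by rewrite (HQ j).1 // mul0r.
rewrite rmorph_prod /= => /prodf_eq0[j _]; exact/negP/(HQ j).2.
Qed.

(** A polynomial vanishing on the smaller set vanishes on all of [S] once multiplied by [Q]. Sets of
    parameters can thus be restricted to a principal open neighbourhood of [t]. *)
Lemma zclosure_neq0 S Q t : zclosure S t -> Q.@[t] != 0 ->
  zclosure (S `&` [set s | Q.@[s] != 0]) t.
Proof.
move=> H Qt Q' HQ'; apply: (mulfI Qt); rewrite mulr0 -mevalM; apply: H => s Ss.
rewrite mevalM; have [->|Qs] := eqVneq Q.@[s] 0; first by rewrite mul0r.
by rewrite HQ' // mulr0.
Qed.

End ZariskiClosure.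

Section Dependence.
Variables (k : fieldType) (m : nat) (J : finType).

Definition dependent (p : nat) (A : 'I_p -> J -> {mpoly k[m]}) (t : 'I_m -> k) :=
  exists e : 'I_p -> k, (exists a, e a != 0) /\
    forall j, \sum_a e a * (A a j).@[t] = 0.

(** Elimination without division, with pivot [A ord0 j0], so that the entries stay polynomial in the
    parameters. *)
Definition eliminate (p : nat) (A : 'I_p.+1 -> J -> {mpoly k[m]}) (j0 : J)
    (a : 'I_p) (j : J) : {mpoly k[m]} :=
  A ord0 j0 * A (lift ord0 a) j - A (lift ord0 a) j0 * A ord0 j.

Lemma dependent_eliminate p (A : 'I_p.+1 -> J -> {mpoly k[m]}) j0 t :
  (A ord0 j0).@[t] != 0 -> dependent A t -> dependent (eliminate A j0) t.
Proof.
move=> A0 [e [[a ea] He]]; exists (fun a => e (lift ord0 a)); split.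
  apply: contrapT => /forallNP N.
  have e1 b : e (lift ord0 b) = 0 by apply/eqP/negPn/negP; exact: N.
  have := He j0; rewrite big_ord_recl big1 ?addr0; last by move=> b _; rewrite e1 mul0r.
  move/eqP; rewrite mulf_eq0 (negbTE A0) orbF => /eqP e0.
  by move: ea; case: (unliftP ord0 a) => [b|] ->; rewrite ?e1 ?e0 eqxx.
move=> j; have := He j; have := He j0; rewrite !big_ord_recl.
move=> /eqP; rewrite addrC addr_eq0 => /eqP E0 /eqP; rewrite addrC addr_eq0 => /eqP E.
have -> : \sum_a e (lift ord0 a) * (eliminate A j0 a j).@[t] =
  (A ord0 j0).@[t] * (\sum_a e (lift ord0 a) * (A (lift ord0 a) j).@[t]) -
  (\sum_a e (lift ord0 a) * (A (lift ord0 a) j0).@[t]) * (A ord0 j).@[t].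
  rewrite mulr_sumr mulr_suml -sumrB; apply: eq_bigr => b _.
  by rewrite /eliminate mevalB !mevalM; ring.
by rewrite E0 E; ring.
Qed.

Lemma sum_eliminate p (A : 'I_p.+1 -> J -> {mpoly k[m]}) j0 t (e : 'I_p -> k) j :
  \sum_a e a * (eliminate A j0 a j).@[t] = \sum_a
    (if unlift ord0 a is Some b then (A ord0 j0).@[t] * e b
     else - \sum_b e b * (A (lift ord0 b) j0).@[t]) * (A a j).@[t].
Proof.
rewrite big_ord_recl unlift_none mulNr mulr_suml -sumrN -big_split /=.
apply: eq_bigr => b _; rewrite liftK /eliminate mevalB !mevalM; ring.
Qed.

Lemma eliminate_dependent p (A : 'I_p.+1 -> J -> {mpoly k[m]}) j0 t :
  (A ord0 j0).@[t] != 0 -> dependent (eliminate A j0) t -> dependent A t.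
Proof.
move=> A0 [e [[a ea] He]].
exists (fun a => if unlift ord0 a is Some b then (A ord0 j0).@[t] * e b
     else - \sum_b e b * (A (lift ord0 b) j0).@[t]); split.
  by exists (lift ord0 a); rewrite liftK mulf_neq0.
by move=> j; rewrite -sum_eliminate.
Qed.

(** [d] is the product of the pivots met when eliminating at [t0]; where all of them are nonzero,
    the same elimination shows independence. *)
Lemma independent_open p (A : 'I_p -> J -> {mpoly k[m]}) t0 :
  ~ dependent A t0 -> exists2 d : {mpoly k[m]}, d.@[t0] != 0 &
    forall t, d.@[t] != 0 -> ~ dependent A t.
Proof.
elim: p A => [|p IH] A.
  by move=> _; exists 1; [rewrite meval1 oner_eq0|move=> t _ [e [[[]]]]].
move=> nA; have [j0 A0] : exists j0, (A ord0 j0).@[t0] != 0.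
  apply: contrapT => /forallNP N; apply: nA.
  exists (fun a => (a == ord0)%:R); split; first by exists ord0; rewrite eqxx oner_eq0.
  move=> j; rewrite big_ord_recl big1 ?addr0; last first.
    by move=> b _; rewrite mul0r.
  by have /negP/negPn/eqP -> := N j; rewrite mulr0.
have [|d dt H] := IH (eliminate A j0); first by move/(eliminate_dependent A0).
exists (A ord0 j0 * d); first by rewrite mevalM mulf_neq0.
move=> t; rewrite mevalM mulf_eq0 negb_or => /andP[At dtt].
by move/(dependent_eliminate At); exact: H.
Qed.

Lemma dependent_closed p (A : 'I_p -> J -> {mpoly k[m]}) S t0 :
  zclosure S t0 -> (forall t, S t -> dependent A t) -> dependent A t0.
Proof.
move=> St0 H; apply: contrapT => /independent_open[d dt nd].
have /eqP : d.@[t0] = 0; last by rewrite (negbTE dt).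
by apply: St0 => s /H ds; apply: contrapT => /eqP /nd.
Qed.

(* Gaussian elimination with parameters: [S] is cut into finitely many pieces
   according to the pivot, and one of the pieces has [t0] in its closure. *)
Lemma dependent_section p (A : 'I_p -> J -> {mpoly k[m]}) S t0 :
  zclosure S t0 -> (forall t, S t -> dependent A t) ->
  exists S' (E : 'I_p -> {mpoly k[m]}),
    [/\ S' `<=` S, zclosure S' t0, forall t, S' t -> exists a, (E a).@[t] != 0 &
        forall t, S' t -> forall j, \sum_a (E a).@[t] * (A a j).@[t] = 0].
Proof.
elim: p A S => [|p IH] A S St0 H.
  case: (@zclosure0 _ _ t0); apply: zclosureS St0 => t /H [e [[[]]]]; by [].
pose S0 := S `&` [set t | forall j, (A ord0 j).@[t] = 0].
pose S1 j := S `&` [set t | (A ord0 j).@[t] != 0].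
have : zclosure (S0 `|` [set t | exists j, S1 j t]) t0.
  apply: zclosureS St0 => t St; have [N|/existsNP[j /eqP Nj]] :=
    EM (forall j, (A ord0 j).@[t] = 0); first by left.
  by right; exists j.
case/zclosureU => [S0t|/zclosure_bigU[j0 S1t]].
  exists S0, (fun a => (a == ord0)%:R); split => //.
  - by move=> t [].
  - by move=> t _; exists ord0; rewrite eqxx meval1 oner_eq0.
  - move=> t [_ At] j; rewrite big_ord_recl At mulr0 add0r big1 // => b _.
    by rewrite meval0 mul0r.
have [|S' [E [SS S't E0 EA]]] := IH (eliminate A j0) _ S1t.
  by move=> t [/H dA At]; exact: dependent_eliminate.
exists S', (fun a => if unlift ord0 a is Some b then A ord0 j0 * E b
     else - \sum_b E b * A (lift ord0 b) j0); split => //.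
- by move=> t /SS [].
- move=> t S't'; have [b Eb] := E0 _ S't'; exists (lift ord0 b).
  by rewrite liftK mevalM mulf_neq0 //; have [] := SS _ S't'.
- move=> t S't' j; rewrite -[RHS](EA _ S't' j) sum_eliminate; apply: eq_bigr => a _.
  case: unliftP => [b|] _; first by rewrite mevalM.
  congr (_ * _); rewrite mevalN (raddf_sum (meval t)); congr (- _).
  by apply: eq_bigr => b _; exact: mevalM.
Qed.

End Dependence.

(** * Rational maps between projective spaces *)

(** Common skeleton of [proj_nbhs], [affine_nbhs] and [prod_nbhs], where the topology is given by a
    subbase: there [G] says that a set contains a neighbourhood of [x] cut out by the nonvanishing
    of one polynomial. *)
Lemma subbase_open_ind (T : choiceType) (D : set (set T)) (x : T) (G : set T -> Prop) :
  G setT -> (forall A B, G A -> G B -> G (A `&` B)) ->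
  (forall A B, A `<=` B -> G A -> G B) -> (forall A, D A -> A x -> G A) ->
  forall O, (exists2 D' : set (set T), D' `<=` finI_from D id & \bigcup_(A in D') A = O) ->
  O x -> G O.
Proof.
move=> GT GI GS GD O [D' D'D <-] [A D'A Ax].
apply: (GS A); first by move=> y Ay; exists A.
have [F FD AE] := D'D _ D'A; rewrite -AE in Ax *.
have {}Ax : forall i, i \in finmap.enum_fset F -> i x by move=> i iF; exact: Ax.
have {}FD : forall i, i \in finmap.enum_fset F -> D i.
  by move=> i iF; have := FD i iF; rewrite inE.
suff: forall s : seq (set T), (forall i, i \in s -> D i /\ i x) ->
    G (\bigcap_(i in [set` s]) i).
  by move=> /(_ (finmap.enum_fset F)); apply => i iF; split; [exact: FD|exact: Ax].
elim=> [|B s IH] H; first by apply: GS GT => y _ i.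
apply: (GS (B `&` \bigcap_(i in [set` s]) i)).
  by move=> y [By sy] i /=; rewrite inE => /orP[/eqP ->|/sy].
apply: GI; first by have [DB Bx] := H B (mem_head _ _); exact: GD.
by apply: IH => i is_; apply: H; rewrite inE is_ orbT.
Qed.

Section Coordinates.
Variables (k : closedFieldType) (n : nat).
Implicit Types (L : proj_space k n) (u v : 'I_n.+1 -> k).

Definition crd L : 'I_n.+1 -> k := coords L 0.
Definition pt u : proj_space k n := point_of (\row_i u i).

Lemma crd_neq0 L : exists i, crd L i != 0.
Proof.
apply: contrapT => /forallNP N.
have : coords L != 0.
  rewrite /coords vpick0 -dimv_eq0; case: L {N} => L /=.
  by move=> /eqP ->.
by apply/negP/negPn/eqP/rowP => i; rewrite mxE; apply/eqP/negPn/negP; exact: N.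
Qed.

Lemma crd_pt u : (exists i, u i != 0) ->
  exists2 a, a != 0 & crd (pt u) = (fun i => a * u i).
Proof.
move=> [i ui]; have u0 : \row_i u i != 0.
  by apply: contraNneq ui => /rowP/(_ i); rewrite !mxE => ->.
have D : \dim <[\row_i u i]>%VS == 1%N by rewrite dim_vline u0.
have E : val (pt u) = <[\row_i u i]>%VS by rewrite /pt /point_of insubdK.
have : coords (pt u) \in <[\row_i u i]>%VS by rewrite -E /coords memv_pick.
move=> /vlineP[a Ea]; exists a; last first.
  by apply: funext => j; rewrite /crd Ea !mxE.
have [j] := crd_neq0 (pt u); rewrite /crd Ea !mxE.
by apply: contraNneq => ->; rewrite mul0r.
Qed.

Lemma ptK L : pt (crd L) = L.
Proof.
apply: val_inj; rewrite /pt.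
have -> : \row_i crd L i = coords L by apply/rowP => i; rewrite mxE.
have c0 : coords L != 0.
  by have [i] := crd_neq0 L; apply: contraNneq; rewrite /crd => ->; rewrite mxE.
have D : \dim <[coords L]>%VS == 1%N by rewrite dim_vline c0.
rewrite /point_of insubdK //.
apply/eqP; rewrite eqEdim -memvE {1}/coords memv_pick dim_vline c0 /=.
by have /eqP -> := valP L.
Qed.

Lemma pt_scale a u : a != 0 -> pt (fun i => a * u i) = pt u.
Proof.
move=> a0; rewrite /pt.
have -> : \row_i (a * u i) = a *: \row_i u i by apply/rowP => i; rewrite !mxE.
rewrite /point_of; congr insubd; apply/eqP; rewrite eqEsubv -!memvE.
rewrite memvZ ?memv_line //=; apply/vlineP; exists a^-1.
by rewrite scalerA mulVf // scale1r.
Qed.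

End Coordinates.

(** Vanishing of the 2 by 2 minors rather than equality up to a factor: a polynomial identity, which
    passes to closures of parameter sets. The zero tuple is proportional to every tuple, whence the
    nonvanishing conditions that accompany this notion. *)
Definition proportional (R : nzRingType) (m : nat) (u v : 'I_m -> R) :=
  forall i j, u i * v j = u j * v i.

Section Proportional.
Variables (R : idomainType) (m : nat).
Implicit Types u v w : 'I_m -> R.

Lemma proportional_refl u : proportional u u.
Proof. by move=> i j; rewrite mulrC. Qed.

Lemma proportional_sym u v : proportional u v -> proportional v u.
Proof. by move=> H i j; rewrite mulrC -H mulrC. Qed.

Lemma proportional_trans v u w : (exists i, v i != 0) ->
  proportional u v -> proportional v w -> proportional u w.
Proof.
move=> [l vl] uv vw i j; apply: (mulIf vl).
by rewrite mulrAC uv -mulrA vw mulrA -uv mulrAC.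
Qed.

End Proportional.

Lemma proportionalP (k : fieldType) (m : nat) (u v : 'I_m -> k) :
  (exists i, u i != 0) -> (exists i, v i != 0) -> proportional u v ->
  exists2 a, a != 0 & u = (fun i => a * v i).
Proof.
move=> [i ui] [j vj] H.
have vi : v i != 0.
  by apply: contraNneq (mulf_neq0 ui vj) => vi; rewrite H vi mulr0.
exists (u i / v i); first by rewrite mulf_neq0 ?invr_eq0.
apply: funext => l; rewrite mulrAC H mulfK //.
Qed.

Section CoordinatesEq.
Variables (k : closedFieldType) (n : nat).
Implicit Types (L : proj_space k n) (u v : 'I_n.+1 -> k).

Lemma pt_eqP u v : (exists i, u i != 0) -> (exists i, v i != 0) ->
  pt u = pt v <-> proportional u v.
Proof.
move=> u0 v0; split=> [E|/(proportionalP u0 v0)[a a0 ->]]; last exact: pt_scale.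
have [a a0 Ea] := crd_pt u0; have [b b0 Eb] := crd_pt v0.
move=> i j; apply: (mulfI a0); rewrite !mulrA; apply: (mulfI b0).
have Ei l : a * u l = b * v l.
  by rewrite -[LHS]/((fun l => a * u l) l) -Ea E Eb.
by rewrite !Ei !mulrA; ring.
Qed.

Lemma meval_crd_pt d (p : {mpoly k[n.+1]}) u : p \is d.-homog ->
  (exists i, u i != 0) -> exists2 a, a != 0 & p.@[crd (pt u)] = a * p.@[u].
Proof.
move=> hp /crd_pt[a a0 ->]; exists (a ^+ d); first exact: expf_neq0.
exact: (mmap_homogZ idfun).
Qed.

Lemma meval_crd_pt_neq0 d (p : {mpoly k[n.+1]}) u : p \is d.-homog ->
  (exists i, u i != 0) -> (p.@[crd (pt u)] != 0) = (p.@[u] != 0).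
Proof.
by move=> hp /(meval_crd_pt hp)[a a0 ->]; rewrite mulf_eq0 (negbTE a0).
Qed.

Lemma proj_basic_open d (p : {mpoly k[n.+1]}) : p \is d.-homog ->
  open [set L : proj_space k n | p.@[crd L] != 0].
Proof.
move=> hp; exists [set [set L : proj_space k n | p.@[crd L] != 0]]; last first.
  by rewrite bigcup_set1.
by move=> _ ->; apply: (@finI_from1 _ _ _ id); exists d, p.
Qed.

Lemma proj_nbhs (O : set (proj_space k n)) x : open O -> O x ->
  exists d (p : {mpoly k[n.+1]}), [/\ p \is d.-homog, p.@[crd x] != 0 &
    forall y, p.@[crd y] != 0 -> O y].
Proof.
move=> oO Ox.
pose G (A : set (proj_space k n)) := exists d (p : {mpoly k[n.+1]}),
  [/\ p \is d.-homog, p.@[crd x] != 0 & forall y, p.@[crd y] != 0 -> A y].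
apply: (@subbase_open_ind _ (@proj_basic k n) x G) => //.
- by exists 0%N, 1; split; [exact: dhomog1|rewrite meval1 oner_eq0|].
- move=> A B [d [p [hp px pA]]] [e [q [hq qx qB]]]; exists (d + e)%N, (p * q).
  split; [exact: dhomogM|by rewrite mevalM mulf_neq0|].
  by move=> y; rewrite mevalM mulf_eq0 negb_or => /andP[/pA ? /qB].
- by move=> A B AB [d [p [hp px pA]]]; exists d, p; split => // y /pA /AB.
- by move=> A [d [p hp ->]] px; exists d, p.
Qed.

Lemma homog_nonvanishing d (p : {mpoly k[n.+1]}) : p \is d.-homog -> p != 0 ->
  exists x : proj_space k n, p.@[crd x] != 0.
Proof.
move=> hp p0; have [v] := mpoly_nonvanishing (mulf_neq0 (mpolyX_neq0 k ord0) p0).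
rewrite mevalM mevalXU mulf_eq0 negb_or => /andP[v0 pv].
by exists (pt v); rewrite (meval_crd_pt_neq0 hp) //; exists ord0.
Qed.

(** Irreducibility of the projective space: a product of two nonzero forms is nonzero, hence does
    not vanish at some point. *)
Lemma proj_dense (O : set (proj_space k n)) : open O -> O !=set0 -> dense O.
Proof.
move=> oO [x Ox] A [y Ay] oA.
have [d [p [hp px pO]]] := proj_nbhs oO Ox.
have [e [q [hq qy qA]]] := proj_nbhs oA Ay.
have [|z] := homog_nonvanishing (dhomogM hp hq).
  by rewrite mulf_neq0 //; [apply: contraNneq px|apply: contraNneq qy] => ->; rewrite meval0.
by rewrite mevalM mulf_eq0 negb_or => /andP[/pO ? /qA ?]; exists z.
Qed.

Lemma homog_vanish_open d (p : {mpoly k[n.+1]}) (O : set (proj_space k n)) :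
  p \is d.-homog -> open O -> O !=set0 -> (forall x, O x -> p.@[crd x] = 0) -> p = 0.
Proof.
move=> hp oO O0 H; apply/eqP; apply: contraT => p0.
have [x [/= px Ox]] := proj_dense oO O0 (homog_nonvanishing hp p0) (proj_basic_open hp).
by rewrite H // eqxx in px.
Qed.

End CoordinatesEq.

Notation "p \mPov h" := (p \mPo [tuple h i | i < _]) (at level 25, left associativity).

Lemma open_local (T : topologicalType) (A : set T) :
  (forall x, A x -> exists B, [/\ open B, B x & B `<=` A]) -> open A.
Proof.
move=> H; rewrite openE => x /H[B [oB Bx BA]].
by apply: (filterS BA); apply: open_nbhs_nbhs; split.
Qed.

Lemma agree_ext (X : topologicalType) (Y : Type) (f g g' : pmap X Y) :
  (forall x, pdom g x -> pdom g' x /\ g x = g' x) -> agree f g -> agree f g'.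
Proof.
move=> H [W [oW dW sW fg]]; exists W; split => //.
  by move=> x Wx; have [fx /H[]] := sW _ Wx.
by move=> x Wx; have [_ /H[_ <-]] := sW _ Wx; exact: fg.
Qed.

Lemma dhomog_bigprod (n : nat) (R : comNzRingType) (J : finType) (A : pred J)
    (e : J -> nat) (Q : J -> {mpoly R[n]}) :
  (forall j, Q j \is (e j).-homog) ->
  \prod_(l | A l) Q l \is (\sum_(l | A l) e l).-homog.
Proof. by move=> hQ; elim/big_rec2: _ => [|j *]; [exact: dhomog1|exact: dhomogM]. Qed.

(** [D] is the product of the [Q j]. The evaluation [ev] is left arbitrary in order to cover both
    [meval] at a point and [ev2] at a pair of a parameter and a point. *)
Lemma common_denominator (n : nat) (R : comNzRingType) (J : finType)
    (e : J -> nat) (P Q : J -> {mpoly R[n]}) :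
  (forall j, P j \is (e j).-homog) -> (forall j, Q j \is (e j).-homog) ->
  exists (C : J -> {mpoly R[n]}) D,
    [/\ forall j, C j \is (\sum_l e l).-homog, D \is (\sum_l e l).-homog &
     forall (K : fieldType) (ev : {rmorphism {mpoly R[n]} -> K}),
       (ev D != 0 <-> forall j, ev (Q j) != 0) /\
       (ev D != 0 -> forall j, ev (C j) = ev D * (ev (P j) / ev (Q j)))].
Proof.
move=> hP hQ; exists (fun j => P j * \prod_(l | l != j) Q l), (\prod_l Q l); split.
- move=> j; have -> : (\sum_l e l = e j + \sum_(l | l != j) e l)%N by rewrite (bigD1 j).
  by apply: dhomogM => //; exact: dhomog_bigprod.
- exact: dhomog_bigprod.
move=> K ev; have D0 : ev (\prod_l Q l) != 0 <-> forall j, ev (Q j) != 0.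
  rewrite rmorph_prod; split=> [/prodf_neq0 H j|H]; first exact: H.
  by apply/prodf_neq0 => j _; exact: H.
split => // /D0 Q0 j; rewrite (bigD1 j (P := xpredT)) //= !rmorphM.
have := Q0 j; move: (ev (Q j)) (ev (P j)) (ev _) => q p r q0.
by field.
Qed.

(** Numerator and denominator are multiplied by a form that is nonzero at [x] and vanishes outside
    the neighbourhood given by regularity; nonvanishing of the new denominator then replaces
    membership in that neighbourhood. *)
Lemma proj_regular_frac (k : closedFieldType) (n : nat) (O : set (proj_space k n)) f x :
  regular _ O f -> O x ->
  exists d (p q : {mpoly k[n.+1]}), [/\ p \is d.-homog, q \is d.-homog,
    q.@[crd x] != 0 & forall y, q.@[crd y] != 0 -> O y -> f y = p.@[crd y] / q.@[crd y]].
Proof.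
move=> rf Ox; have [N [d [p [q [[oN Nx] hp hq H]]]]] := rf x Ox.
have [e [r [hr rx rN]]] := proj_nbhs oN Nx; exists (d + e)%N, (p * r), (q * r); split.
- exact: dhomogM.
- exact: dhomogM.
- by rewrite mevalM mulf_neq0 //; have [] := H _ Nx Ox.
move=> y; rewrite !mevalM mulf_eq0 negb_or => /andP[qy ry] Oy.
have [_ E] := H _ (rN _ ry) Oy; rewrite E.
by rewrite -mulf_div divff ?mulr1.
Qed.

Section PolynomialMaps.
Variables (k : closedFieldType) (n m : nat).
Implicit Types (h g : 'I_m.+1 -> {mpoly k[n.+1]}) (x : proj_space k n).

Lemma poly_mapE h x : poly_map h x = pt (fun i => (h i).@[crd x]).
Proof. by []. Qed.

Lemma poly_map_dom_open h d : (forall i, h i \is d.-homog) -> open (pdom (poly_map h)).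
Proof.
move=> hh; apply: open_local => x [i hx].
exists [set y | (h i).@[crd y] != 0]; split => //; last by move=> y ?; exists i.
exact: proj_basic_open (hh i).
Qed.

Lemma poly_map_morphism h d : (forall i, h i \is d.-homog) -> is_morphism (poly_map h).
Proof.
move=> hh V oV.
have oW : open (pdom (poly_map h) `&` poly_map h @^-1` V).
  apply: open_local => x [[i hx] Vx].
  have [e [q [hq qx qV]]] := proj_nbhs oV Vx.
  exists [set y | (h i * (q \mPov h)).@[crd y] != 0]; split.
  - exact: proj_basic_open (dhomogM (hh i) (dhomog_subst hq hh)).
  - rewrite /= mevalM mulf_neq0 // meval_comp -(meval_crd_pt_neq0 hq) //.
    by exists i.
  - move=> y; rewrite /= mevalM mulf_eq0 negb_or meval_comp => /andP[hy qy].
    by split; [exists i|apply: qV; rewrite (meval_crd_pt_neq0 hq) //; exists i].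
split=> // f rf x [hx Vx]; have [N [d' [p [q [[oN Nx] hp hq H]]]]] := rf _ Vx.
have oN' : open (pdom (poly_map h) `&` poly_map h @^-1` N).
  apply: open_local => y [[i hy] Ny].
  have [e [r [hr ry rN]]] := proj_nbhs oN Ny.
  exists [set y | (h i * (r \mPov h)).@[crd y] != 0]; split.
  - exact: proj_basic_open (dhomogM (hh i) (dhomog_subst hr hh)).
  - rewrite /= mevalM mulf_neq0 // meval_comp -(meval_crd_pt_neq0 hr) //.
    by exists i.
  - move=> z; rewrite /= mevalM mulf_eq0 negb_or meval_comp => /andP[hz rz].
    by split; [exists i|apply: rN; rewrite (meval_crd_pt_neq0 hr) //; exists i].
exists (pdom (poly_map h) `&` poly_map h @^-1` N), (d' * d)%N, (p \mPov h), (q \mPov h).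
split; [by split|exact: dhomog_subst hp hh|exact: dhomog_subst hq hh|].
move=> y [hy Ny] [_ Vy]; have [q0 fE] := H _ Ny Vy.
rewrite /peval !meval_comp; have [a a0 E] := crd_pt hy.
have {}q0 : q.@[crd (pt (fun i => (h i).@[crd y]))] != 0 := q0.
have {}fE : f (poly_map h y) = p.@[crd (pt (fun i => (h i).@[crd y]))] /
   q.@[crd (pt (fun i => (h i).@[crd y]))] := fE.
move: q0 fE; rewrite E (meval_homogZ _ _ hq) (meval_homogZ _ _ hp).
rewrite mulf_eq0 negb_or => /andP[ad q0] fE; split => //=.
by rewrite fE -mulf_div divff // mul1r.
Qed.

Lemma poly_map_ratmap h d : (forall i, h i \is d.-homog) -> (exists i, h i != 0) ->
  is_ratmap (poly_map h).
Proof.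
move=> hh [i hi]; split; [exact: poly_map_dom_open hh| |exact: poly_map_morphism hh].
apply: proj_dense (poly_map_dom_open hh) _.
by have [x hx] := homog_nonvanishing (hh i) hi; exists x, i.
Qed.

(** In the chart where coordinate [i0] of the image is nonzero, the quotients of coordinates are
    regular functions. Their pullbacks are fractions of forms, and the numerators over a common
    denominator are homogeneous coordinates of [f]. *)
Lemma morphism_locally_poly (f : pmap (proj_space k n) (proj_space k m)) x :
  is_morphism f -> pdom f x ->
  exists h d p e, [/\ forall i, h i \is d.-homog, p \is e.-homog, p.@[crd x] != 0 &
    forall y, p.@[crd y] != 0 -> [/\ pdom f y, pdom (poly_map h) y & f y = poly_map h y]].
Proof.
move=> mf fx; have [i0 y0] := crd_neq0 (f x).
pose V := [set y : proj_space k m | ('X_i0 : {mpoly k[m.+1]}).@[crd y] != 0].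
have oV : open V by exact: proj_basic_open (dhomogU k i0).
have Vx : V (f x) by rewrite /V /= mevalXU.
have [oW rW] := mf V oV; set W := pdom f `&` _ in oW rW.
have Wx : W x by [].
have rj j : regular (proj_space k m) V (fun y => crd y j / crd y i0).
  move=> y Vy; exists setT, 1%N, 'X_j, 'X_i0; split => //; try exact: dhomogU.
    by split => //; exact: openT.
  by move=> z _ Vz; rewrite /peval !mevalXU; split => //; move: Vz; rewrite /V /= mevalXU.
have /choice[N HN] : forall j, exists N : nat * ({mpoly k[n.+1]} * {mpoly k[n.+1]}),
    [/\ N.2.1 \is N.1.-homog, N.2.2 \is N.1.-homog, N.2.2.@[crd x] != 0 &
    forall y, N.2.2.@[crd y] != 0 -> W y ->
      crd (f y) j / crd (f y) i0 = N.2.1.@[crd y] / N.2.2.@[crd y]].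
  move=> j; have [d [p [q H]]] := proj_regular_frac (rW _ (rj j)) Wx.
  by exists (d, (p, q)).
have [e [r [hr rx rW']]] := proj_nbhs oW Wx.
have [||C [D [hC hD CD]]] := @common_denominator _ _ _ (fun j => (N j).1)
  (fun j => (N j).2.1) (fun j => (N j).2.2).
- by move=> j; have [] := HN j.
- by move=> j; have [] := HN j.
exists C, (\sum_l (N l).1)%N, (r * D), (e + \sum_l (N l).1)%N; split => //.
- exact: dhomogM.
- rewrite mevalM mulf_neq0 //; apply/(CD _ (meval (crd x))).1 => j.
  by have [] := HN j.
move=> y; rewrite mevalM mulf_eq0 negb_or => /andP[/rW' Wy Dy].
have [/(_ Dy) Q0 /(_ Dy) CE] : (D.@[crd y] != 0 -> forall j, (N j).2.2.@[crd y] != 0) /\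
   (D.@[crd y] != 0 -> forall j, (C j).@[crd y] =
      D.@[crd y] * ((N j).2.1.@[crd y] / (N j).2.2.@[crd y])).
  by have [[] ] := CD _ (meval (crd y)).
have fy0 : crd (f y) i0 != 0 by have [_ ] := Wy; rewrite /V /= mevalXU.
have E : (fun j => (C j).@[crd y]) = (fun j => D.@[crd y] / crd (f y) i0 * crd (f y) j).
  apply: funext => j; have [_ _ _ H] := HN j.
  by rewrite CE -H // mulrA mulrAC.
have c0 : D.@[crd y] / crd (f y) i0 != 0 by rewrite mulf_neq0 ?invr_eq0.
have [fy _] := Wy; split => //.
  exists i0; rewrite -[peval _ _]/((fun j => (C j).@[crd y]) i0) E.
  by rewrite mulf_neq0.
by rewrite poly_mapE E pt_scale // ptK.
Qed.

Lemma agree_poly_map h g d e :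
  (forall i, h i \is d.-homog) -> (forall i, g i \is e.-homog) ->
  agree (poly_map h) (poly_map g) -> proportional h g.
Proof.
move=> hh hg [W [oW dW sW E]] i j; apply/eqP; rewrite -subr_eq0; apply/eqP.
have [x [_ Wx]] : setT `&` W !=set0.
  apply: dW openT; exists (pt (fun=> 1)); by [].
apply: (@homog_vanish_open _ _ (d + e) _ W) => //; last 2 first.
- by exists x.
- move=> y Wy; have [hy gy] := sW _ Wy.
  have := E _ Wy; rewrite !poly_mapE => /(pt_eqP hy gy) H.
  by rewrite mevalB !mevalM H subrr.
by apply: rpredB; apply: dhomogM.
Qed.

Lemma proportional_agree h g d e :
  (forall i, h i \is d.-homog) -> (forall i, g i \is e.-homog) ->
  (exists i, h i != 0) -> (exists i, g i != 0) ->
  proportional h g -> agree (poly_map h) (poly_map g).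
Proof.
move=> hh hg h0 g0 H; exists (pdom (poly_map h) `&` pdom (poly_map g)).
have [oh dh _] := poly_map_ratmap hh h0; have [og dg _] := poly_map_ratmap hg g0.
split => //; [exact: openI|exact: denseI|].
move=> x [hx gx]; rewrite !poly_mapE; apply/pt_eqP => // i j.
by rewrite -!mevalM H.
Qed.

End PolynomialMaps.

(** * Birational maps given by polynomials *)

Lemma pcomp_poly_map (k : closedFieldType) (n m l e : nat)
    (h : 'I_m.+1 -> {mpoly k[n.+1]}) (g : 'I_l.+1 -> {mpoly k[m.+1]}) x :
  (forall i, g i \is e.-homog) -> pdom (pcomp (poly_map g) (poly_map h)) x ->
  pdom (poly_map (fun i => g i \mPov h)) x /\
  pcomp (poly_map g) (poly_map h) x = poly_map (fun i => g i \mPov h) x.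
Proof.
move=> hg [hx [i gx]].
have gx' : (g i).@[crd (pt (fun i => (h i).@[crd x]))] != 0 := gx.
rewrite (meval_crd_pt_neq0 (hg i)) // in gx'; split.
  by exists i; rewrite /peval meval_comp.
rewrite poly_mapE /= -[RHS]/(pt (fun i => (g i \mPov h).@[crd x])).
have [a a0 E] := crd_pt hx.
rewrite -[LHS]/(pt (fun i => (g i).@[crd (pt (fun i => (h i).@[crd x]))])) E.
under [X in pt X]funext do rewrite (meval_homogZ _ _ (hg _)).
rewrite pt_scale ?expf_neq0 //; congr pt; apply: funext => j.
by rewrite meval_comp.
Qed.

Section BirationalPolynomials.
Variables (k : closedFieldType) (n : nat).
Implicit Types (h g : 'I_n.+1 -> {mpoly k[n.+1]}) (phi psi : Bir (proj_space k n)).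

Local Notation X := (fun i : 'I_n.+1 => 'X_i : {mpoly k[n.+1]}).

Lemma proportional_X_neq0 (u : 'I_n.+1 -> {mpoly k[n.+1]}) :
  proportional u X -> (exists i, u i != 0) -> forall i, u i != 0.
Proof.
move=> H [j uj] i; apply: contraNneq (mulf_neq0 uj (mpolyX_neq0 k i)) => ui.
by rewrite H ui mul0r.
Qed.

Lemma represents_poly phi : exists d h,
  (forall i, h i \is d.-homog) /\ represents phi (poly_map h).
Proof.
have [[oU dU mU] _] := biratP (bir_repr phi).
have [x [_ Ux]] : setT `&` pdom (bir_repr phi) !=set0.
  by apply: dU openT; exists (pt (fun=> 1)).
have [h [d [p [e [hh hp px H]]]]] := morphism_locally_poly mU Ux.
exists d, h; split => //; exists [set y | p.@[crd y] != 0]; split.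
- exact: proj_basic_open hp.
- by apply: proj_dense (proj_basic_open hp) _; exists x.
- by move=> y /H[].
- by move=> y /H[].
Qed.

Lemma represents_neq0 phi h : represents phi (poly_map h) -> exists i, h i != 0.
Proof.
move=> [W [oW dW sW _]]; have [x [_ /sW[_ [i hx]]]] : setT `&` W !=set0.
  by apply: dW openT; exists (pt (fun=> 1)).
by exists i; apply: contraNneq hx => ->; rewrite /peval meval0.
Qed.

Lemma represents_proportional phi h g d e :
  (forall i, h i \is d.-homog) -> (forall i, g i \is e.-homog) ->
  represents phi (poly_map h) -> represents phi (poly_map g) -> proportional h g.
Proof.
move=> hh hg H1 H2; apply: agree_poly_map hh hg _.
exact: agree_trans (agree_sym H1) H2.
Qed.

Lemma proportional_represents phi h g d e :
  (forall i, h i \is d.-homog) -> (forall i, g i \is e.-homog) ->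
  represents phi (poly_map h) -> (exists i, g i != 0) -> proportional h g ->
  represents phi (poly_map g).
Proof.
move=> hh hg H1 g0 hg'; apply: agree_trans (H1) _.
apply: proportional_agree hh hg _ g0 hg'; exact: represents_neq0 H1.
Qed.

Lemma represents_inj (Y : fspace k) (phi psi : Bir Y) u :
  represents phi u -> represents psi u -> phi = psi.
Proof.
move=> H1 H2; rewrite -[phi]bir_reprK -[psi]bir_reprK; apply/bir_classP.
exact: agree_trans H1 (agree_sym H2).
Qed.

Lemma represents_class (Y : fspace k) (u : pmap Y Y) (b : birational u) :
  represents (bir_class (Birat b)) u.
Proof. exact: bir_class_repr. Qed.

Lemma represents_mul phi psi h g d e :
  (forall i, h i \is d.-homog) -> (forall i, g i \is e.-homog) ->
  represents phi (poly_map h) -> represents psi (poly_map g) ->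
  represents (psi * phi)%g (poly_map (fun i => g i \mPov h)).
Proof.
move=> hh hg H1 H2; apply: agree_trans (bir_class_repr _) _.
apply: agree_ext (agree_comp (biratP _) H2 H1) => x; exact: pcomp_poly_map.
Qed.

Lemma represents_1 : represents (1%g : Bir (proj_space k n)) (poly_map X).
Proof.
apply: agree_trans (bir_class_repr _) _; exists setT; split.
- exact: openT.
- by move=> O O0 _; rewrite setIT.
- by move=> x _; split => //; have [i] := crd_neq0 x; exists i; rewrite /peval mevalXU.
- move=> x _; rewrite /= -[RHS]/(pt (fun i => ('X_i : {mpoly k[n.+1]}).@[crd x])).
  by under [X in pt X]funext do rewrite mevalXU; rewrite ptK.
Qed.

Definition inverse_polys h g :=
  [/\ proportional (fun i => g i \mPov h) X, exists i, g i \mPov h != 0,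
      proportional (fun i => h i \mPov g) X & exists i, h i \mPov g != 0].

Lemma inverse_polysE h g : inverse_polys h g ->
  [/\ forall i, g i \mPov h != 0,
      forall i, (g i \mPov h) * 'X_ord0 = (g ord0 \mPov h) * 'X_i,
      forall i, h i \mPov g != 0 &
      forall i, (h i \mPov g) * 'X_ord0 = (h ord0 \mPov g) * 'X_i].
Proof.
move=> [gh gh0 hg hg0]; split; first exact: proportional_X_neq0 gh gh0.
- by move=> i; rewrite gh.
- exact: proportional_X_neq0 hg hg0.
- by move=> i; rewrite hg.
Qed.

Lemma meval_cancel h g d e x :
  (forall i, h i \is d.-homog) -> (forall i, g i \is e.-homog) ->
  proportional (fun i => g i \mPov h) X ->
  pdom (poly_map h) x -> (exists i, (g i \mPov h).@[crd x] != 0) ->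
  exists2 b, b != 0 & (fun i => (g i).@[crd (poly_map h x)]) = (fun i => b * crd x i).
Proof.
move=> hh hg gh hx ghx.
have [a a0 E] : exists2 a, a != 0 &
    (fun i => (g i \mPov h).@[crd x]) = (fun i => a * crd x i).
  apply: proportionalP => //; first exact: crd_neq0.
  by move=> i j; have /(congr1 (meval (crd x))) := gh i j; rewrite !mevalM !mevalXU.
have [b b0 Eb] := crd_pt hx.
exists (b ^+ e * a); first by rewrite mulf_neq0 ?expf_neq0.
apply: funext => i; rewrite poly_mapE Eb (meval_homogZ _ _ (hg i)) -mulrA.
by congr (_ * _); rewrite -meval_comp -[RHS]/((fun i => a * crd x i) i) -E.
Qed.

Lemma poly_map_cancel h g d e x :
  (forall i, h i \is d.-homog) -> (forall i, g i \is e.-homog) ->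
  proportional (fun i => g i \mPov h) X ->
  pdom (poly_map h) x -> (exists i, (g i \mPov h).@[crd x] != 0) ->
  [/\ pdom (poly_map g) (poly_map h x), poly_map g (poly_map h x) = x &
      exists i, (h i \mPov g).@[crd (poly_map h x)] != 0].
Proof.
move=> hh hg gh hx ghx; have [b b0 Eb] := meval_cancel hh hg gh hx ghx; split.
- have [i xi] := crd_neq0 x; exists i.
  by rewrite -[peval _ _]/((fun i => (g i).@[crd (poly_map h x)]) i) Eb mulf_neq0.
- by rewrite poly_mapE Eb pt_scale // ptK.
- have [i hi] := hx; exists i.
  by rewrite meval_comp Eb (meval_homogZ _ _ (hh i)) mulf_neq0 // expf_neq0.
Qed.

Lemma birational_poly_map h g d e :
  (forall i, h i \is d.-homog) -> (forall i, g i \is e.-homog) ->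
  inverse_polys h g -> birational (poly_map h).
Proof.
move=> hh hg [gh [i0 gh0] hg' [j0 hg'0]].
have nz (p : {mpoly k[n.+1]}) (v : 'I_n.+1 -> {mpoly k[n.+1]}) : p \mPov v != 0 -> p != 0.
  by apply: contraNneq => ->; rewrite comp_mpoly0.
have h0 : exists i, h i != 0 by exists j0; apply: nz hg'0.
have g0 : exists i, g i != 0 by exists i0; apply: nz gh0.
have [oh dh mh] := poly_map_ratmap hh h0.
have [og dg mg] := poly_map_ratmap hg g0.
have homgh i : g i \mPov h \is (e * d).-homog by exact: dhomog_subst.
have homhg i : h i \mPov g \is (d * e).-homog by exact: dhomog_subst.
have [oA dA _] := poly_map_ratmap homgh (ex_intro _ i0 gh0).
have [oB dB _] := poly_map_ratmap homhg (ex_intro _ j0 hg'0).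
split; first by split.
exists (pdom (poly_map h) `&` pdom (poly_map (fun i => g i \mPov h))).
exists (PMap (pdom (poly_map g) `&` pdom (poly_map (fun i => h i \mPov g))) (poly_map g)).
split.
- split; [exact: openI|exact: denseI|by move=> x []].
- split; [exact: openI|exact: denseI|].
  by apply: is_morphism_sub mg; [exact: openI|move=> x []].
- by move=> x [hx ghx]; have [] := poly_map_cancel hh hg gh hx ghx.
- by move=> y [gy hgy]; have [] := poly_map_cancel hg hh hg' gy hgy.
Qed.

Lemma represents_inverse phi h g d e :
  (forall i, h i \is d.-homog) -> (forall i, g i \is e.-homog) ->
  represents phi (poly_map h) -> represents phi^-1%g (poly_map g) -> inverse_polys h g.
Proof.
move=> hh hg H1 H2.
have := represents_mul hh hg H1 H2; rewrite mulVg => R1.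
have := represents_mul hg hh H2 H1; rewrite mulgV => R2.
split.
- apply: (represents_proportional (phi := 1%g) (d := e * d) (e := 1)) R1 represents_1.
    by move=> i; apply: dhomog_subst.
  by move=> i; exact: dhomogU.
- exact: represents_neq0 R1.
- apply: (represents_proportional (phi := 1%g) (d := d * e) (e := 1)) R2 represents_1.
    by move=> i; apply: dhomog_subst.
  by move=> i; exact: dhomogU.
- exact: represents_neq0 R2.
Qed.

(** Up to nonzero factors, [P] is [P o h o g]. *)
Lemma inverse_polys_dominant h g (P : {mpoly k[n.+1]}) c : P \is c.-homog ->
  inverse_polys h g -> P \mPov h = 0 -> P = 0.
Proof.
move=> hP /inverse_polysE[_ _ hg0 hgE] Ph.
have : (h ord0 \mPov g) ^+ c * P = 0.
  have {1}-> : P = P \mPov X by rewrite comp_mpoly_id.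
  rewrite -(comp_homogZ _ _ hP).
  have -> : [tuple (h ord0 \mPov g) * 'X_i | i < n.+1] =
            [tuple 'X_ord0 * (h i \mPov g) | i < n.+1].
    by apply: eq_from_tnth => i; rewrite !tnth_mktuple -hgE mulrC.
  by rewrite (comp_homogZ _ _ hP) -comp_tupleA Ph comp_mpoly0 mulr0.
by move/eqP; rewrite mulf_eq0 expf_eq0 (negbTE (hg0 ord0)) andbF => /eqP.
Qed.

Lemma represents_dominant phi h d (P : {mpoly k[n.+1]}) c :
  (forall i, h i \is d.-homog) -> represents phi (poly_map h) ->
  P \is c.-homog -> P != 0 -> P \mPov h != 0.
Proof.
move=> hh H1 hP; have [e [g [hg H2]]] := represents_poly phi^-1%g.
apply: contraNneq => Ph; apply/eqP.
exact: inverse_polys_dominant hP (represents_inverse hh hg H1 H2) Ph.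
Qed.

(** The degree obtained in [bounded_degree_inverse]. It is attained exactly, so the coefficients of
    an inverse form one list of unknowns for all members of a family. *)
Definition inverse_degree d := (n.+1 * d.+1 ^ n)%N.

Lemma represents_bounded_inverse phi h d :
  (forall i, h i \is d.-homog) -> represents phi (poly_map h) ->
  exists g, [/\ forall i, g i \is (inverse_degree d).-homog, exists i, g i != 0 &
    proportional (fun i => g i \mPov h) X].
Proof.
move=> hh H1; have [e [g [hg H2]]] := represents_poly phi^-1%g.
have /inverse_polysE[gh0 ghE hg0 hgE] := represents_inverse hh hg H1 H2.
have [g' [hg' g'0 Hg']] := bounded_degree_inverse hh hg (gh0 ord0) (hg0 ord0)
  (mpolyX_neq0 k ord0) (mpolyX_neq0 k ord0) ghE hgE.
by exists g'; split.
Qed.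

(* Degree in which [g] and the forms [(h_i o g) x_j - (h_j o g) x_i] have
   multiples, when [h] has degree [d] and [g] has degree [e]. *)
Definition dominance_degree d e := (e * d + e).+1.

(** Multiplication by powers of [x_0] extends the dominance hypothesis to all smaller degrees. It
    then shows that [g o h] is nonzero, and that the minors of [h o g] against the coordinates
    vanish, because they do after composition with [h]: there [h o g o h] is proportional to [h]. *)
Lemma left_inverse_polys h g d e :
  (forall i, h i \is d.-homog) -> (forall i, g i \is e.-homog) ->
  (exists i, g i != 0) -> proportional (fun i => g i \mPov h) X ->
  (forall P, P \is (dominance_degree d e).-homog -> P \mPov h = 0 -> P = 0) ->
  inverse_polys h g.
Proof.
move=> hh hg [i0 g0] gh dom.
have hX0 (c : nat) : 'X_ord0 ^+ c \is [in k[n.+1], c.-homog].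
  by rewrite -[X in X.-homog]mul1n; apply: dhomogMn; exact: dhomogU.
have X0 (c : nat) : 'X_ord0 ^+ c != 0 :> {mpoly k[n.+1]}.
  by rewrite expf_neq0 // mpolyX_neq0.
have dom' P c : (c <= dominance_degree d e)%N -> P \is c.-homog -> P \mPov h = 0 -> P = 0.
  move=> lec hP Ph.
  have : P * 'X_ord0 ^+ (dominance_degree d e - c) = 0.
    apply: dom; last by rewrite rmorphM /= Ph mul0r.
    by rewrite -[X in X.-homog](subnKC lec); apply: dhomogM.
  by move/eqP; rewrite mulf_eq0 (negbTE (X0 _)) orbF => /eqP.
have gh0 : exists i, g i \mPov h != 0.
  exists i0; apply: contraNneq g0 => /(dom' _ e) -> //.
  by rewrite /dominance_degree; lia.
have gh0' := proportional_X_neq0 gh gh0.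
pose c := g ord0 \mPov h.
have hgh p b : p \is b.-homog ->
    'X_ord0 ^+ b * (p \mPov (fun i => g i \mPov h)) = c ^+ b * p.
  move=> hp; rewrite -(comp_homogZ _ _ hp) -[p in RHS]comp_mpoly_id -(comp_homogZ _ _ hp).
  congr comp_mpoly; apply: eq_from_tnth => i; rewrite !tnth_mktuple mulrC.
  exact: gh.
split; [exact: gh|exact: gh0| |].
  move=> i j; apply/eqP; rewrite -subr_eq0; apply/eqP; apply: (dom' _ (d * e + 1)%N).
  - by rewrite /dominance_degree; nia.
  - by apply: rpredB; apply: dhomogM (dhomogU _ _); exact: dhomog_subst.
  - rewrite rmorphB !rmorphM /= !comp_tupleXU !comp_tupleA.
    apply: (mulfI (X0 d)); rewrite mulr0 mulrBr !mulrA (hgh _ _ (hh i)) (hgh _ _ (hh j)).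
    ring.
apply: contrapT => /forallNP N.
have h0 i : h i = 0.
  have /eqP := hgh _ _ (hh i); rewrite -comp_tupleA.
  have /negP/negPn/eqP -> := N i; rewrite comp_mpoly0 mulr0 eq_sym mulf_eq0.
  by rewrite expf_eq0 (negbTE (gh0' ord0)) andbF => /eqP.
have /eqP : 'X_ord0 ^+ dominance_degree d e = 0 :> {mpoly k[n.+1]}; last first.
  by rewrite (negbTE (X0 _)).
(* The successor in [dominance_degree] ensures that this power of zero is zero. *)
by apply: dom; [exact: hX0|rewrite rmorphXn /= comp_tupleXU h0 expr0n].
Qed.

End BirationalPolynomials.

(** * Closedness tested on polynomial families *)

Section Specialization.
Variables (k : closedFieldType) (m n : nat).
Implicit Types (P Q : {mpoly {mpoly k[m]}[n.+1]}) (t : 'I_m -> k).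

(* Polynomials over [{mpoly k[m]}] encode families of polynomials over [k]
   parametrized by [k^m]. *)
Definition specialize t P : {mpoly k[n.+1]} := map_mpoly (meval t) P.

Definition ev2 t (v : 'I_n.+1 -> k) : {mpoly {mpoly k[m]}[n.+1]} -> k := mmap (meval t) v.

HB.instance Definition _ t v := GRing.RMorphism.copy (ev2 t v) (mmap (meval t) v).

Lemma ev2M t v : {morph ev2 t v : P Q / P * Q}.
Proof. exact: rmorphM. Qed.

Lemma meval_specialize t v P : (specialize t P).@[v] = ev2 t v P.
Proof. exact: meval_map_mpoly. Qed.

Lemma ev2_const t v (P : {mpoly k[n.+1]}) : ev2 t v (map_mpoly (@mpolyC m k) P) = P.@[v].
Proof.
rewrite -[LHS]/((ev2 t v \o map_mpoly (@mpolyC m k)) P).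
apply: mpoly_rmorph_eq => [c|i] /=; first by rewrite map_mpolyC /ev2 mmapC /= !mevalC.
by rewrite map_mpolyX /ev2 mmapX mmap1U mevalXU.
Qed.

Lemma ev2C t v (p : {mpoly k[m]}) : ev2 t v p%:MP = p.@[t].
Proof. exact: mmapC. Qed.

Lemma separated_poly d (p : {mpoly k[m]}) (P : {mpoly k[n.+1]}) : P \is d.-homog ->
  exists2 Q, Q \is d.-homog & forall t v, ev2 t v Q = p.@[t] * P.@[v].
Proof.
move=> hP; exists (p%:MP * map_mpoly (@mpolyC m k) P).
  by rewrite mul_mpolyC; apply: dhomogZ; exact: map_mpoly_dhomog.
by move=> t v; rewrite ev2M (ev2C _ _ p) ev2_const.
Qed.

(** With [v] fixed, this exhibits a polynomial in [t], and so turns nonvanishing at a given point of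
    the fibre into an open condition on the parameter. *)
Lemma ev2_swap t v P : ev2 t v P = (P.@[fun i => (v i)%:MP]).@[t].
Proof.
rewrite -[RHS]/((meval t \o meval (fun i => (v i)%:MP)) P).
apply: mpoly_rmorph_eq => [c|i] /=; first by rewrite ev2C mevalC.
by rewrite /ev2 mmapX mmap1U mevalXU mevalC.
Qed.

Lemma specialize_dhomog t P d : P \is d.-homog -> specialize t P \is d.-homog.
Proof. exact: map_mpoly_dhomog. Qed.

End Specialization.

Section AffineNeighbourhoods.
Variables (k : closedFieldType) (m : nat) (I : set {mpoly k[m]}).
Implicit Types (s : affine_fspace I).

Definition acrd s : 'I_m -> k := sval s 0.

Lemma affine_basic_open (p : {mpoly k[m]}) : open [set s : affine_fspace I | p.@[acrd s] != 0].
Proof.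
exists [set [set s : affine_fspace I | p.@[acrd s] != 0]]; last by rewrite bigcup_set1.
by move=> _ ->; apply: (@finI_from1 _ _ _ id); exists p.
Qed.

Lemma affine_nbhs (O : set (affine_fspace I)) s : open O -> O s ->
  exists p : {mpoly k[m]}, p.@[acrd s] != 0 /\ forall s', p.@[acrd s'] != 0 -> O s'.
Proof.
move=> oO Os.
pose G (A : set (affine_fspace I)) := exists p : {mpoly k[m]},
  p.@[acrd s] != 0 /\ forall s', p.@[acrd s'] != 0 -> A s'.
apply: (@subbase_open_ind _ (@affine_basic k m I) s G) => //.
- by exists 1; split; [rewrite meval1 oner_eq0|].
- move=> A B [p [ps pA]] [q [qs qB]]; exists (p * q).
  split; first by rewrite mevalM mulf_neq0.
  by move=> y; rewrite mevalM mulf_eq0 negb_or => /andP[/pA ? /qB].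
- by move=> A B AB [p [ps pA]]; exists p; split => // y /pA /AB.
- by move=> A [p ->] ps; exists p.
Qed.

Lemma affine_regular_frac (O : set (affine_fspace I)) f s : regular _ O f -> O s ->
  exists p q : {mpoly k[m]}, q.@[acrd s] != 0 /\
    forall s', q.@[acrd s'] != 0 -> O s' -> f s' = p.@[acrd s'] / q.@[acrd s'].
Proof.
move=> rf Os; have [N [p [q [oN Ns H]]]] := rf s Os.
have [r [rs rN]] := affine_nbhs oN Ns; exists (p * r), (q * r); split.
  by rewrite mevalM mulf_neq0 //; have [] := H _ Ns Os.
move=> s'; rewrite !mevalM mulf_eq0 negb_or => /andP[qs' rs'] Os'.
have [_ ->] := H _ (rN _ rs') Os'.
by rewrite -mulf_div divff ?mulr1.
Qed.

End AffineNeighbourhoods.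

Section ProductNeighbourhoods.
Variables (k : closedFieldType) (m n : nat) (I : set {mpoly k[m]}) (T : fspace k).
Variable b : affine_fspace I -> T.
Hypothesis mb : is_morphism (PMap setT b).
Implicit Types (P Q : {mpoly {mpoly k[m]}[n.+1]}) (s : affine_fspace I).

Local Notation X := (proj_space k n).

Lemma open_preimage (O : set T) : open O -> open (b @^-1` O).
Proof. by move=> /mb[]; rewrite setTI. Qed.

(** Here [b] is an affine chart of [T], or the identity when [T] is itself affine. Pulled back along
    it, the functions defining the topology and the sheaf of the product become fractions of
    polynomials in parameter and point, homogeneous in the point. *)
Lemma tensor_frac (U : set T) (V : set X) F s0 x0 :
  open U -> open V -> tensor U V F -> U (b s0) -> V x0 ->
  exists e P Q, [/\ P \is e.-homog, Q \is e.-homog, ev2 (acrd s0) (crd x0) Q != 0 &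
    forall s x, ev2 (acrd s) (crd x) Q != 0 ->
      [/\ U (b s), V x & F (b s, x) = ev2 (acrd s) (crd x) P / ev2 (acrd s) (crd x) Q]].
Proof.
move=> oU oV [r [f [g [rf rg FE]]]] Us Vx.
have [u [us uU]] := affine_nbhs (open_preimage oU) Us.
have [c [v [hv vx vV]]] := proj_nbhs oV Vx.
have /choice[N HN] : forall i, exists N : nat *
    ({mpoly {mpoly k[m]}[n.+1]} * {mpoly {mpoly k[m]}[n.+1]}),
    [/\ N.2.1 \is N.1.-homog, N.2.2 \is N.1.-homog, ev2 (acrd s0) (crd x0) N.2.2 != 0 &
    forall s x, ev2 (acrd s) (crd x) N.2.2 != 0 -> U (b s) -> V x ->
      f i (b s) * g i x = ev2 (acrd s) (crd x) N.2.1 / ev2 (acrd s) (crd x) N.2.2].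
  move=> i.
  have [_ /(_ _ (rf i)) rfb] := mb oU; rewrite setTI in rfb.
  have [p [q [qs Hf]]] := affine_regular_frac rfb Us.
  have [d [p' [q' [hp' hq' qx Hg]]]] := proj_regular_frac (rg i) Vx.
  have [P hP PE] := separated_poly p hp'; have [Q hQ QE] := separated_poly q hq'.
  exists (d, (P, Q)); split => //=; first by rewrite QE mulf_neq0.
  move=> s x; rewrite QE PE mulf_eq0 negb_or => /andP[qs' qx'] Us' Vx'.
  by rewrite -mulf_div -Hf // -Hg.
have [W hW WE] := separated_poly u hv.
have [||C [D [hC hD CD]]] := @common_denominator _ _ _ (fun j => (N j).1)
  (fun j => (N j).2.1) (fun j => (N j).2.2).
- by move=> j; have [] := HN j.
- by move=> j; have [] := HN j.
exists (c + \sum_i (N i).1)%N, (W * \sum_i C i), (W * D); split.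
- by apply: dhomogM hW _; apply: rpred_sum => i _; exact: hC.
- exact: dhomogM.
- rewrite ev2M WE !mulf_neq0 //; apply/(CD _ (ev2 _ _)).1 => j.
  by have [] := HN j.
move=> s x; rewrite !ev2M WE mulf_eq0 negb_or mulf_eq0 negb_or.
move=> /andP[/andP[us' vx'] D0]; have Us' := uU _ us'; have Vx' := vV _ vx'.
split => //; rewrite -mulf_div divff ?mulf_neq0 // mul1r FE.
rewrite (raddf_sum (ev2 (acrd s) (crd x))) mulr_suml.
have [[/(_ D0) Q0 _] /(_ D0) CE] := CD _ (ev2 (acrd s) (crd x)).
apply: eq_bigr => i _; have [_ _ _ H] := HN i.
rewrite [LHS](H _ _ (Q0 i) Us' Vx') [X in _ = X / _]CE mulrAC divff //.
by rewrite mul1r.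
Qed.

Lemma prod_nbhs (O : set (prod_fspace T X)) s0 x0 : open O -> O (b s0, x0) ->
  exists e Q, [/\ Q \is e.-homog, ev2 (acrd s0) (crd x0) Q != 0 &
    forall s x, ev2 (acrd s) (crd x) Q != 0 -> O (b s, x)].
Proof.
move=> oO Os.
pose G (A : set (prod_fspace T X)) := exists e Q,
  [/\ Q \is e.-homog, ev2 (acrd s0) (crd x0) Q != 0 &
    forall s x, ev2 (acrd s) (crd x) Q != 0 -> A (b s, x)].
apply: (@subbase_open_ind _ (@prod_basic k T X) (b s0, x0) G) => //.
- by exists 0%N, 1; split; [exact: dhomog1|rewrite rmorph1 oner_eq0|].
- move=> A B [d [p [hp px pA]]] [e [q [hq qx qB]]]; exists (d + e)%N, (p * q).
  split; [exact: dhomogM|by rewrite ev2M mulf_neq0|].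
  by move=> s x; rewrite ev2M mulf_eq0 negb_or => /andP[/pA ? /qB].
- by move=> A B AB [d [p [hp px pA]]]; exists d, p; split => // s x /pA /AB.
- move=> A [U [V [F [oU oV tF ->]]]] [/= Us Vx F0].
  have [e [P [Q [hP hQ Q0 H]]]] := tensor_frac oU oV tF Us Vx.
  have [_ _ E] := H _ _ Q0; rewrite E mulf_eq0 negb_or in F0; case/andP: F0 => P0 _.
  exists (e + e)%N, (P * Q); split; [exact: dhomogM|by rewrite ev2M mulf_neq0|].
  move=> s x; rewrite ev2M mulf_eq0 negb_or => /andP[Ps Qs].
  have [? ? E'] := H _ _ Qs; split => //=.
  by rewrite E' mulf_neq0 // invr_eq0.
Qed.

Lemma prod_regular_frac (W : set (prod_fspace T X)) f s0 x0 :
  regular _ W f -> W (b s0, x0) ->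
  exists e P Q, [/\ P \is e.-homog, Q \is e.-homog, ev2 (acrd s0) (crd x0) Q != 0 &
    forall s x, ev2 (acrd s) (crd x) Q != 0 -> W (b s, x) ->
      f (b s, x) = ev2 (acrd s) (crd x) P / ev2 (acrd s) (crd x) Q].
Proof.
move=> rf W0; have [N [U [V [F [G [[oN N0] [oU oV] tF tG H]]]]]] := rf _ W0.
have [/= U0 V0 G0 _] := H _ N0 W0.
have [d [p [hp px pN]]] := prod_nbhs oN N0.
have [e1 [P1 [Q1 [hP1 hQ1 Q10 H1]]]] := tensor_frac oU oV tF U0 V0.
have [e2 [P2 [Q2 [hP2 hQ2 Q20 H2]]]] := tensor_frac oU oV tG U0 V0.
have P20 : ev2 (acrd s0) (crd x0) P2 != 0.
  have [_ _ E] := H2 _ _ Q20; move: G0; rewrite E mulf_eq0 negb_or => /andP[]//.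
have mul4 (A B C : {mpoly {mpoly k[m]}[n.+1]}) : A \is e1.-homog ->
    B \is e2.-homog -> C \is e2.-homog ->
    exists2 M, M \is (d + (e1 + (e2 + e2))).-homog & forall t v,
      ev2 t v M = ev2 t v p * (ev2 t v A * (ev2 t v B * ev2 t v C)).
  move=> hA hB hC; exists (p * (A * (B * C))); last by move=> t v; rewrite !ev2M.
  exact: dhomogM hp (dhomogM hA (dhomogM hB hC)).
have [P hP PE] := mul4 _ _ _ hP1 hQ2 hQ2; have [Q hQ QE] := mul4 _ _ _ hQ1 hP2 hQ2.
exists (d + (e1 + (e2 + e2)))%N, P, Q; split => //; first by rewrite QE !mulf_neq0.
move=> s x; rewrite PE QE !mulf_eq0 !negb_or => /and3P[ps Q1s /andP[P2s Q2s]] Ws.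
have [_ _ _ ->] := H _ (pN _ _ ps) Ws.
have [_ _ ->] := H1 _ _ Q1s; have [_ _ ->] := H2 _ _ Q2s.
move: (ev2 _ _ p) (ev2 _ _ P1) (ev2 _ _ Q1) (ev2 _ _ P2) (ev2 _ _ Q2) ps Q1s P2s Q2s.
by move=> w1 w2 w3 w4 w5 *; field; apply/and4P.
Qed.

(** The argument of [morphism_locally_poly], with coefficients that are polynomials in the
    coordinates of the chart [b]. *)
Lemma family_locally_poly (f : pmap (prod_fspace T X) X) s0 x0 :
  is_morphism f -> pdom f (b s0, x0) ->
  exists (h : 'I_n.+1 -> {mpoly {mpoly k[m]}[n.+1]}) d p e,
  [/\ forall i, h i \is d.-homog, p \is e.-homog, ev2 (acrd s0) (crd x0) p != 0 &
    forall s x, ev2 (acrd s) (crd x) p != 0 ->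
    [/\ pdom f (b s, x), pdom (poly_map (fun i => specialize (acrd s) (h i))) x &
        f (b s, x) = poly_map (fun i => specialize (acrd s) (h i)) x]].
Proof.
move=> mf f0; have [i0 y0] := crd_neq0 (f (b s0, x0)).
pose V := [set y : X | ('X_i0 : {mpoly k[n.+1]}).@[crd y] != 0].
have oV : open V by exact: proj_basic_open (dhomogU k i0).
have V0 : V (f (b s0, x0)) by rewrite /V /= mevalXU.
have [oW rW] := mf V oV; set W := pdom f `&` _ in oW rW.
have W0 : W (b s0, x0) by [].
have rj j : regular X V (fun y => crd y j / crd y i0).
  move=> y Vy; exists setT, 1%N, 'X_j, 'X_i0; split => //; try exact: dhomogU.
    by split => //; exact: openT.
  by move=> z _ Vz; rewrite /peval !mevalXU; split => //; move: Vz; rewrite /V /= mevalXU.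
have /choice[N HN] : forall j, exists N : nat *
    ({mpoly {mpoly k[m]}[n.+1]} * {mpoly {mpoly k[m]}[n.+1]}),
    [/\ N.2.1 \is N.1.-homog, N.2.2 \is N.1.-homog, ev2 (acrd s0) (crd x0) N.2.2 != 0 &
    forall s x, ev2 (acrd s) (crd x) N.2.2 != 0 -> W (b s, x) ->
      crd (f (b s, x)) j / crd (f (b s, x)) i0 =
      ev2 (acrd s) (crd x) N.2.1 / ev2 (acrd s) (crd x) N.2.2].
  move=> j; have [e [P [Q H]]] := prod_regular_frac (rW _ (rj j)) W0.
  by exists (e, (P, Q)).
have [e [r [hr rx rW']]] := prod_nbhs oW W0.
have [||C [D [hC hD CD]]] := @common_denominator _ _ _ (fun j => (N j).1)
  (fun j => (N j).2.1) (fun j => (N j).2.2).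
- by move=> j; have [] := HN j.
- by move=> j; have [] := HN j.
exists C, (\sum_l (N l).1)%N, (r * D), (e + \sum_l (N l).1)%N; split => //.
- exact: dhomogM.
- rewrite ev2M mulf_neq0 //; apply/(CD _ (ev2 _ _)).1 => j.
  by have [] := HN j.
move=> s x; rewrite ev2M mulf_eq0 negb_or => /andP[/rW' Wy Dy].
have [[/(_ Dy) Q0 _] /(_ Dy) CE] := CD _ (ev2 (acrd s) (crd x)).
have fy0 : crd (f (b s, x)) i0 != 0 by have [_ ] := Wy; rewrite /V /= mevalXU.
have E : (fun j => (specialize (acrd s) (C j)).@[crd x]) =
    (fun j => ev2 (acrd s) (crd x) D / crd (f (b s, x)) i0 * crd (f (b s, x)) j).
  apply: funext => j; have [_ _ _ H] := HN j.
  by rewrite meval_specialize [LHS]CE -(H _ _ (Q0 j) Wy) mulrA mulrAC.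
have c0 : ev2 (acrd s) (crd x) D / crd (f (b s, x)) i0 != 0.
  by rewrite mulf_neq0 ?invr_eq0.
have [fy _] := Wy; split => //.
  exists i0; rewrite -[peval _ _]/((fun j => (specialize (acrd s) (C j)).@[crd x]) i0).
  by rewrite E mulf_neq0.
by rewrite poly_mapE E pt_scale // ptK.
Qed.

End ProductNeighbourhoods.

Section PolyClosed.
Variables (k : closedFieldType) (n : nat).

(* Closedness tested on families whose coefficients are polynomials in
   finitely many parameters. *)
Definition poly_closed (F : set (Bir (proj_space k n))) :=
  forall m d (h : 'I_n.+1 -> {mpoly {mpoly k[m]}[n.+1]}) (t0 : 'I_m -> k) phi0,
  (forall i, h i \is d.-homog) ->
  represents phi0 (poly_map (fun i => specialize t0 (h i))) ->
  zclosure [set t | exists2 phi, F phi &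
    represents phi (poly_map (fun i => specialize t (h i)))] t0 ->
  F phi0.

(** Near a point [t0] outside the preimage of [F], the morphism is a polynomial family in the
    coordinates of an affine chart. As its member at [t0] is not in [F], some polynomial [Q] is
    nonzero at [t0] and vanishes at all parameters whose member is in [F]. *)
Lemma poly_closed_closed F : poly_closed F -> closed F.
Proof.
move=> pF; apply/bir_closedP => T phi [U [f [[bU mf dU bt] rphi]]].
rewrite -openC; apply: open_local => t0 /= nF.
have [r [V [aV coverV]]] := variety_affine T.
have [i _ Vt0] : (\bigcup_i V i) t0 by rewrite coverV.
have [oV [m [I [a [b [ma mb ba ab]]]]]] := aV i.
have [x0 [_ Ux0]] : setT `&` [set x | U (t0, x)] !=set0.
  by apply: dU openT; exists (pt (fun=> 1)).
pose s0 := a t0; have bs0 : b s0 = t0 by exact: ba.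
have U0 : pdom (PMap U f) (b s0, x0) by rewrite bs0.
have [h [d [p [e [hh hp p0 H]]]]] := family_locally_poly mb mf U0.
have rep s : ev2 (acrd s) (crd x0) p != 0 ->
    represents (phi (b s)) (poly_map (fun i => specialize (acrd s) (h i))).
  move=> ps; apply: agree_trans (rphi (b s)) _.
  have hps := specialize_dhomog (acrd s) hp.
  exists [set x | (specialize (acrd s) p).@[crd x] != 0]; split.
  - exact: proj_basic_open hps.
  - apply: proj_dense (proj_basic_open hps) _.
    by exists x0; rewrite /= meval_specialize.
  - by move=> x; rewrite /= meval_specialize => /H[].
  - by move=> x; rewrite /= meval_specialize => /H[].
have [Q QS Qs0] : exists2 Q : {mpoly k[m]}, (forall t, (exists2 phi, F phi &
    represents phi (poly_map (fun i => specialize t (h i)))) -> Q.@[t] = 0) &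
    Q.@[acrd s0] != 0.
  apply: contrapT => N; apply: nF; rewrite -bs0; apply: (pF _ _ _ _ _ hh (rep _ p0)).
  move=> Q HQ; apply: contrapT => /eqP Qs0; apply: N; exists Q => //.
(* Where [px] is nonzero, the form [p] specializes to a nonzero form, so the open set on which the
   polynomials describe the fibre is dense in it. *)
pose px : {mpoly k[m]} := p.@[fun i => (crd x0 i)%:MP].
have [oB _] := ma _ (@affine_basic_open k m I (Q * px)).
exists (V i `&` a @^-1` [set s | (Q * px).@[acrd s] != 0]); split => //.
  by split => //=; rewrite mevalM -ev2_swap mulf_neq0.
move=> t [Vt /=]; rewrite mevalM -ev2_swap mulf_eq0 negb_or => /andP[Qt pt] Ft.
move/eqP: Qt; apply; apply: QS; exists (phi t) => //.
by rewrite -{1}(ba t Vt); exact: rep.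
Qed.

End PolyClosed.

(** * Affine parameter varieties and their products with projective space *)

Section AffineVariety.
Variables (k : closedFieldType) (m : nat) (I : set {mpoly k[m]}).

Local Notation T := (affine_fspace I).

Lemma affine_poly_regular (p : {mpoly k[m]}) (O : set T) :
  regular T O (fun s => p.@[acrd s]).
Proof.
move=> s Os; exists setT, p, 1; split => //; first exact: openT.
by move=> y _ _; rewrite /aeval meval1 oner_eq0 divr1.
Qed.

Lemma is_morphism_id (Y : fspace k) : is_morphism (PMap setT (@id Y)).
Proof.
by move=> V oV; rewrite /= setTI.
Qed.

Lemma affine_space_separated : closed ([set z | z.1 = z.2] : set (prod_fspace T T)).
Proof.
rewrite -openC; apply: open_local => z /= zz.
have [j nj] : exists j, acrd z.1 j != acrd z.2 j.
  apply: contrapT => /forallNP N; apply: zz; apply: val_inj; apply/rowP => j.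
  by have /negP/negPn/eqP := N j.
pose F (w : prod_fspace T T) : k := acrd w.1 j - acrd w.2 j.
have tF : tensor setT setT F.
  exists 2%N, (fun i w => if i == ord0 then acrd w j else -1),
     (fun i w => if i == ord0 then 1 else acrd w j); split.
  - move=> i; case: eqP => _.
      have := @affine_poly_regular 'X_j setT; congr (regular _ _ _).
      by apply: funext => w; rewrite mevalXU.
    have := @affine_poly_regular (-1)%:MP setT; congr (regular _ _ _).
    by apply: funext => w; rewrite mevalC.
  - move=> i; case: eqP => _.
      have := @affine_poly_regular 1 setT; congr (regular _ _ _).
      by apply: funext => w; rewrite meval1.
    have := @affine_poly_regular 'X_j setT; congr (regular _ _ _).
    by apply: funext => w; rewrite mevalXU.
  - by move=> w; rewrite big_ord_recl big_ord1 /= mulr1 mulN1r.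
exists [set w | [/\ setT w.1, setT w.2 & F w != 0]]; split.
- exists [set [set w : prod_fspace T T | [/\ setT w.1, setT w.2 & F w != 0]]]; last first.
    by rewrite bigcup_set1.
  move=> _ ->; apply: (@finI_from1 _ _ _ id).
  by exists setT, setT, F; split => //; exact: openT.
- by split => //; rewrite /F subr_eq0.
- by move=> w [_ _ Fw] /= E; move: Fw; rewrite /F E subrr eqxx.
Qed.

Lemma affine_space_affine : exists (r : nat) (V : 'I_r -> set T),
  (forall i, affine_open (V i)) /\ \bigcup_i V i = setT.
Proof.
exists 1%N, (fun=> setT); split; last first.
  by apply/seteqP; split => // x _; exists ord0.
move=> _; split; first exact: openT.
by exists m, I, id, id; split => //; exact: is_morphism_id.
Qed.

Definition affine_variety : variety k := Variety affine_space_affine affine_space_separated.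

End AffineVariety.

Section ProductTopology.
Variables (k : closedFieldType) (m n : nat) (I : set {mpoly k[m]}).
Implicit Types (P Q : {mpoly {mpoly k[m]}[n.+1]}).

Local Notation T := (affine_fspace I).
Local Notation X := (proj_space k n).
Local Notation TX := (prod_fspace T X).
Local Notation ev z := (ev2 (acrd z.1) (crd z.2)).

(** Expansion into monomials: the coefficients are regular in the parameter, and the monomials
    divided by [x_i0 ^ e] are regular where [x_i0] is nonzero. *)
Lemma homog_tensor e P i0 : P \is e.-homog ->
  tensor (setT : set T) [set x : X | crd x i0 != 0]
    (fun z : TX => ev z P / crd z.2 i0 ^+ e).
Proof.
move=> hP; pose s := msupp P.
exists (size s), (fun i t => (P@_(nth 0%MM s i)).@[acrd t]),
  (fun i x => ('X_[nth 0%MM s i] : {mpoly k[n.+1]}).@[crd x] / crd x i0 ^+ e); split.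
- by move=> i; exact: affine_poly_regular.
- move=> i x Vx; exists setT, e, 'X_[nth 0%MM s i], ('X_i0 ^+ e); split.
  + by split => //; exact: openT.
  + rewrite dhomogX; apply/eqP; apply: (dhomog_mf hP); exact: mem_nth.
  + by rewrite -[X in X.-homog]mul1n; apply: dhomogMn; exact: dhomogU.
  + move=> y _ Vy; rewrite /peval !rmorphXn /= !mevalXU.
    by split => //; rewrite expf_neq0.
- move=> z; rewrite /ev2 /mmap (big_nth 0%MM) big_mkord mulr_suml.
  by apply: eq_bigr => i _; rewrite mulrA mevalX.
Qed.

Lemma prod_basic_open e Q : Q \is e.-homog -> open [set z : TX | ev z Q != 0].
Proof.
move=> hQ; apply: open_local => z /= Qz; have [i0 zi] := crd_neq0 z.2.
pose V := [set x : X | crd x i0 != 0].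
have oV : open V.
  have := proj_basic_open (dhomogU k i0); congr open.
  by apply/seteqP; split => x /=; rewrite mevalXU.
pose F (z : TX) : k := ev z Q / crd z.2 i0 ^+ e.
exists [set w | [/\ setT w.1, V w.2 & F w != 0]]; split.
- exists [set [set w : TX | [/\ setT w.1, V w.2 & F w != 0]]]; last first.
    by rewrite bigcup_set1.
  move=> _ ->; apply: (@finI_from1 _ _ _ id).
  exists setT, V, F; split => //; [exact: openT|exact: homog_tensor].
- by split => //; rewrite /F mulf_neq0 // invr_eq0 expf_neq0.
- by move=> w [_ _]; rewrite /F mulf_eq0 negb_or => /andP[].
Qed.

Lemma frac_prod_regular (W : set TX) (f : TX -> k) :
  (forall z, W z -> exists e P Q, [/\ P \is e.-homog, Q \is e.-homog, ev z Q != 0 &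
     forall w, W w -> ev w Q != 0 -> f w = ev w P / ev w Q]) ->
  regular TX W f.
Proof.
move=> H z Wz; have [e [P [Q [hP hQ Qz fE]]]] := H z Wz.
have [i0 zi] := crd_neq0 z.2; pose V := [set x : X | crd x i0 != 0].
have oV : open V.
  have := proj_basic_open (dhomogU k i0); congr open.
  by apply/seteqP; split => x /=; rewrite mevalXU.
have [R hR RE] := separated_poly (1 : {mpoly k[m]}) (dhomogU k i0).
exists ([set w | ev w Q != 0] `&` [set w | ev w R != 0]), setT, V,
  (fun z : TX => ev z P / crd z.2 i0 ^+ e), (fun z : TX => ev z Q / crd z.2 i0 ^+ e).
split; [| |exact: (homog_tensor i0 hP)|exact: (homog_tensor i0 hQ)|].
- split; first by apply: openI; [exact: prod_basic_open hQ|exact: prod_basic_open hR].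
  by split => //=; rewrite RE mevalXU meval1 mul1r.
- by split => //; exact: openT.
- move=> w [/= Qw]; rewrite RE mevalXU meval1 mul1r => wi Ww; split => //.
    by rewrite mulf_neq0 // invr_eq0 expf_neq0.
  rewrite fE //; have := expf_neq0 e wi; move: (_ ^+ e) (ev w Q) Qw (ev w P).
  by move=> a q q0 p a0; field; rewrite q0 a0.
Qed.

Lemma proj2_morphism : is_morphism (PMap setT (fun z : TX => z.2 : X)).
Proof.
move=> V oV; rewrite setTI.
have oV' : open ((fun z : TX => z.2 : X) @^-1` V).
  apply: open_local => z /= Vz; have [e [q [hq qz qV]]] := proj_nbhs oV Vz.
  have [R hR RE] := separated_poly (1 : {mpoly k[m]}) hq.
  exists [set w | ev w R != 0]; split; first exact: prod_basic_open hR.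
    by rewrite /= RE meval1 mul1r.
  by move=> w /=; rewrite RE meval1 mul1r => /qV.
split => // f rf; apply: frac_prod_regular => z Vz.
have [e [p [q [hp hq qz H]]]] := proj_regular_frac rf Vz.
have [P hP PE] := separated_poly (1 : {mpoly k[m]}) hp.
have [Q hQ QE] := separated_poly (1 : {mpoly k[m]}) hq.
exists e, P, Q; split => //; first by rewrite QE meval1 mul1r.
by move=> w Vw; rewrite QE PE meval1 !mul1r => /H; exact.
Qed.

Variables (d : nat) (u : 'I_n.+1 -> {mpoly {mpoly k[m]}[n.+1]}).
Hypothesis hu : forall i, u i \is d.-homog.

Definition fibre_map (t : T) : pmap X X := poly_map (fun i => specialize (acrd t) (u i)).

Definition family_dom : set TX := [set z | pdom (fibre_map z.1) z.2].

Lemma family_domP z : family_dom z <-> exists i, ev z (u i) != 0.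
Proof.
by split=> -[i]; exists i; [rewrite -meval_specialize|rewrite /peval meval_specialize].
Qed.

Lemma fibre_mapE z : fibre_map z.1 z.2 = pt (fun i => ev z (u i)).
Proof. by congr pt; apply: funext => i; exact: meval_specialize. Qed.

Lemma family_dom_open : open family_dom.
Proof.
apply: open_local => z /family_domP[i ui]; exists [set w | ev w (u i) != 0]; split => //.
  exact: prod_basic_open (hu i).
by move=> w wi; apply/family_domP; exists i.
Qed.

Lemma ev2_comp t v Q : ev2 t v (Q \mPov u) = ev2 t (fun i => ev2 t v (u i)) Q.
Proof. exact: mmap_comp. Qed.

Lemma ev2_fibre_map z : family_dom z -> exists2 a, a != 0 & forall e Q, Q \is e.-homog ->
  ev2 (acrd z.1) (crd (fibre_map z.1 z.2)) Q = a ^+ e * ev z (Q \mPov u).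
Proof.
move=> /family_domP uz; have [a a0 E] := crd_pt uz; exists a => // e Q hQ.
by rewrite fibre_mapE E ev2_comp; exact: mmap_homogZ.
Qed.

Lemma family_morphism : is_morphism (PMap family_dom (fun z : TX => (z.1, fibre_map z.1 z.2) : TX)).
Proof.
move=> V oV.
have oW : open (family_dom `&` (fun z : TX => (z.1, fibre_map z.1 z.2) : TX) @^-1` V).
  apply: open_local => z [uz Vz].
  have [e [Q [hQ Qz QV]]] := prod_nbhs (@is_morphism_id k T) oV Vz.
  exists (family_dom `&` [set w | ev w (Q \mPov u) != 0]); split.
  - apply: openI; first exact: family_dom_open.
    exact: prod_basic_open (dhomog_subst hQ hu).
  - split => //=; have [a a0 E] := ev2_fibre_map uz; move: Qz; rewrite (E _ _ hQ).
    by rewrite mulf_eq0 negb_or => /andP[].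
  - move=> w [uw Qw]; split => //; apply: QV.
    by have [a a0 E] := ev2_fibre_map uw; rewrite (E _ _ hQ) mulf_neq0 // expf_neq0.
split => // f rf; apply: frac_prod_regular => z [uz Vz].
have [e [P [Q [hP hQ Qz H]]]] := prod_regular_frac (@is_morphism_id k T) rf Vz.
exists (e * d)%N, (P \mPov u), (Q \mPov u); split.
- exact: dhomog_subst hP hu.
- exact: dhomog_subst hQ hu.
- have [a a0 E] := ev2_fibre_map uz; move: Qz; rewrite (E _ _ hQ).
  by rewrite mulf_eq0 negb_or => /andP[].
- move=> w [uw Vw] Qw; have [a a0 E] := ev2_fibre_map uw.
  have a0' := expf_neq0 e a0.
  rewrite /= (H w.1 (fibre_map w.1 w.2)) //; rewrite (E _ _ hQ) ?(E _ _ hP).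
    by rewrite -mulf_div divff // mul1r.
  by rewrite mulf_neq0.
Qed.

Lemma family_morphism2 : is_morphism (PMap family_dom (fun z : TX => fibre_map z.1 z.2)).
Proof.
have := is_morphism_comp proj2_morphism family_morphism.
congr is_morphism; rewrite /pcomp; congr PMap.
by apply/seteqP; split => [z []|z].
Qed.

End ProductTopology.

Section SpecializationMorphism.
Variables (k : closedFieldType) (m n : nat).
Implicit Types (P Q : {mpoly {mpoly k[m]}[n.+1]}) (t : 'I_m -> k).

HB.instance Definition _ t :=
  GRing.RMorphism.copy (@specialize k m n t) (map_mpoly (meval t)).

Lemma mcoeff_specialize t P b : (specialize t P)@_b = (P@_b).@[t].
Proof. exact: mcoeff_map_mpoly. Qed.

Lemma specializeX t b : specialize t 'X_[b] = 'X_[b] :> {mpoly k[n.+1]}.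
Proof. exact: map_mpolyX. Qed.

Lemma specializeZ t (c : {mpoly k[m]}) P : specialize t (c *: P) = c.@[t] *: specialize t P.
Proof. exact: map_mpolyZ. Qed.

Lemma specialize_comp t P (h : 'I_n.+1 -> {mpoly {mpoly k[m]}[n.+1]}) :
  specialize t (P \mPov h) = specialize t P \mPov (fun i => specialize t (h i)).
Proof. exact: map_mpoly_subst. Qed.

End SpecializationMorphism.

(** * Linear systems depending on parameters *)

Section PolynomialDependence.
Variables (k : closedFieldType) (m n : nat) (K L : finType).
Variable w : K -> L -> {mpoly {mpoly k[m]}[n.+1]}.

Definition pdependent t := exists e : K -> k, (exists a, e a != 0) /\
  forall l, \sum_a e a *: specialize t (w a l) = 0.

(** Monomials of degree at least [B] have coefficient zero whatever the parameter, so a relation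
    between the polynomials amounts to finitely many scalar equations. *)
Let B := (\max_(a : K * L) msize (w a.1 a.2))%N.

Let A (a : 'I_#|K|) (j : L * 'X_{1..n.+1 < B}) : {mpoly k[m]} := (w (enum_val a) j.1)@_j.2.

Let sum_enum (F : K -> k) : \sum_(a : 'I_#|K|) F (enum_val a) = \sum_a F a.
Proof. by rewrite [RHS](reindex _ (onW_bij _ (@enum_val_bij K))). Qed.

Let coefficientwise (e : K -> k) t :
  (forall l, \sum_a e a *: specialize t (w a l) = 0) <->
  (forall j, \sum_a e (enum_val a) * (A a j).@[t] = 0).
Proof.
split=> [H j|H l].
  have E := congr1 (mcoeff j.2) (H j.1).
  rewrite mcoeff0 (raddf_sum (mcoeff j.2)) in E; rewrite -[RHS]E -[RHS]sum_enum.
  by apply: eq_bigr => a _; rewrite /= mcoeffZ mcoeff_specialize.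
apply/mpolyP => b; rewrite mcoeff0 (raddf_sum (mcoeff b)).
have [ltb|leb] := ltnP (mdeg b) B.
  rewrite -[RHS](H (l, BMultinom ltb)) -[LHS]sum_enum.
  by apply: eq_bigr => a _; rewrite /= mcoeffZ mcoeff_specialize.
rewrite big1 // => a _; rewrite /= mcoeffZ mcoeff_specialize memN_msupp_eq0 ?meval0 ?mulr0 //.
apply: msize_mdeg_ge; apply: leq_trans leb.
exact: (@leq_bigmax _ (fun a : K * L => msize (w a.1 a.2)) (a, l)).
Qed.

Let pdependentE t : pdependent t <-> dependent A t.
Proof.
split=> [[e [[a ea] He]]|[e [[a ea] He]]].
  exists (e \o enum_val); split; first by exists (enum_rank a); rewrite /= enum_rankK.
  exact/coefficientwise.
exists (e \o enum_rank); split; first by exists (enum_val a); rewrite /= enum_valK.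
by apply/coefficientwise => j; rewrite -[RHS](He j); apply: eq_bigr => b _; rewrite /= enum_valK.
Qed.

Lemma pindependent_open t0 : ~ pdependent t0 -> exists2 d : {mpoly k[m]}, d.@[t0] != 0 &
  forall t, d.@[t] != 0 -> ~ pdependent t.
Proof.
move=> N; have [|d d0 H] := @independent_open _ _ _ _ A t0; first by move/pdependentE.
by exists d; [exact: d0|move=> t /H nd /pdependentE].
Qed.

Lemma pdependent_closed S t0 :
  zclosure S t0 -> (forall t, S t -> pdependent t) -> pdependent t0.
Proof.
by move=> St0 H; apply/pdependentE; apply: dependent_closed St0 _ => t /H /pdependentE.
Qed.

Lemma pdependent_section S t0 :
  zclosure S t0 -> (forall t, S t -> pdependent t) ->
  exists S' (E : K -> {mpoly k[m]}),
    [/\ S' `<=` S, zclosure S' t0, forall t, S' t -> exists a, (E a).@[t] != 0 &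
        forall t, S' t -> forall l, \sum_a (E a).@[t] *: specialize t (w a l) = 0].
Proof.
move=> St0 H; have [|S' [E [S'S S't0 E0 EA]]] := @dependent_section _ _ _ _ A S t0 St0.
  by move=> t /H /pdependentE.
exists S', (E \o enum_rank); split => // t S't.
  by have [a Ea] := E0 _ S't; exists (enum_val a); rewrite /= enum_valK.
apply/(coefficientwise (fun a => (E (enum_rank a)).@[t])) => j.
by rewrite -[RHS](EA _ S't j); apply: eq_bigr => a _; rewrite enum_valK.
Qed.

End PolynomialDependence.

Section HomogeneousForms.
Variables (n D : nat).

(** A finite type, so that the coefficients of a form of degree [D] can be the unknowns of a linear
    system. *)
Definition monom := {b : 'X_{1..n.+1 < D.+1} | mdeg b == D}.
HB.instance Definition _ := Finite.on monom.

Definition mon (b : monom) : 'X_{1..n.+1} := val (val b).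

Lemma mon_ex (b : 'X_{1..n.+1}) : mdeg b = D -> exists c : monom, mon c = b.
Proof.
move=> db; have ltb : (mdeg b < D.+1)%N by rewrite db.
have eb : mdeg (BMultinom ltb) == D by apply/eqP.
by exists (exist _ (BMultinom ltb) eb).
Qed.

Lemma mon_inj : injective mon.
Proof. by move=> b c /val_inj /val_inj. Qed.

Section OverRing.
Variable R : comNzRingType.

Definition hform (c : monom -> R) : {mpoly R[n.+1]} := \sum_b c b *: 'X_[mon b].

Lemma form_dhomog c : hform c \is D.-homog.
Proof.
apply: rpred_sum => b _; apply: dhomogZ; rewrite dhomogX.
exact: (valP b).
Qed.

Lemma mcoeff_form c b : (hform c)@_(mon b) = c b.
Proof.
rewrite /hform (raddf_sum (mcoeff _)) (bigD1 b) //= mcoeffZ mcoeffX eqxx mulr1.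
rewrite big1 ?addr0 // => a ab; rewrite mcoeffZ mcoeffX.
by rewrite (inj_eq mon_inj) (negbTE ab) mulr0.
Qed.

Lemma dhomog_form (P : {mpoly R[n.+1]}) : P \is D.-homog ->
  P = hform (fun b => P@_(mon b)).
Proof.
move=> hP; apply/mpolyP => b; have [db|db] := eqVneq (mdeg b) D.
  by have [c <-] := mon_ex db; rewrite mcoeff_form.
rewrite (dhomog_nemf_coeff hP) // (dhomog_nemf_coeff (form_dhomog _)) //.
Qed.

Lemma form_neq0 c : (exists b, c b != 0) -> hform c != 0.
Proof.
by move=> [b cb]; apply: contraNneq cb => c0; rewrite -mcoeff_form c0 mcoeff0.
Qed.

Lemma form_comp c (h : 'I_n.+1 -> {mpoly R[n.+1]}) :
  hform c \mPov h = \sum_b c b *: ('X_[mon b] \mPov h).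
Proof.
by rewrite /hform (raddf_sum (comp_mpoly _)); apply: eq_bigr => b _; exact: comp_mpolyZ.
Qed.

End OverRing.
End HomogeneousForms.

Section DependenceOfComposites.
Variables (k : closedFieldType) (m n : nat).
Variable h : 'I_n.+1 -> {mpoly {mpoly k[m]}[n.+1]}.

Local Notation X := (fun i : 'I_n.+1 => 'X_i : {mpoly k[n.+1]}).
Local Notation hs t := (fun i => specialize t (h i)).

(** The unknowns are the coefficients of a form [P]; the index in [unit] stands for the single
    equation [P o h = 0]. *)
Definition form_comp_family (E : nat) (b : monom n E) (_ : unit) := 'X_[mon b] \mPov h.

Lemma pdependent_form_comp E t : pdependent (@form_comp_family E) t <->
  exists P, [/\ P \is E.-homog, P != 0 & P \mPov hs t = 0].
Proof.
split=> [[c [c0 Hc]]|[P [hP P0 Ph]]].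
  exists (hform c); split; [exact: form_dhomog|exact: form_neq0|].
  rewrite form_comp -[RHS](Hc tt); apply: eq_bigr => b _.
  by rewrite specialize_comp specializeX.
exists (fun b => P@_(mon b)); split.
  apply: contrapT => /forallNP N; move/eqP: P0; apply.
  rewrite (dhomog_form hP); rewrite /hform big1 // => b _.
  by have /negP/negPn/eqP -> := N b; rewrite scale0r.
move=> l; rewrite -[RHS]Ph [in RHS](dhomog_form hP) form_comp; apply: eq_bigr => b _.
by rewrite specialize_comp specializeX.
Qed.

Section Minors.
Variables (N : finType) (M : N -> {mpoly {mpoly k[m]}[n.+1]}).

(* With [M] the monomials of degree [e] composed with [h], this is the linear
   system, in the coefficients of [g], for [g o h] to be proportional to the
   identity. *)
Definition minor_family (a : 'I_n.+1 * N) (l : 'I_n.+1 * 'I_n.+1) :=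
  M a.2 * 'X_l.2 *+ (a.1 == l.1) - M a.2 * 'X_l.1 *+ (a.1 == l.2).

Lemma sum_minor_family (e : 'I_n.+1 * N -> k) t l :
  \sum_a e a *: specialize t (minor_family a l) =
  (\sum_b e (l.1, b) *: specialize t (M b)) * 'X_l.2 -
  (\sum_b e (l.2, b) *: specialize t (M b)) * 'X_l.1.
Proof.
have half l1 l2 : \sum_a e a *: (specialize t (M a.2) * 'X_l2 *+ (a.1 == l1)) =
    (\sum_b e (l1, b) *: specialize t (M b)) * 'X_l2.
  transitivity (\sum_i \sum_b e (i, b) *: (specialize t (M b) * 'X_l2 *+ (i == l1))).
    by rewrite pair_bigA; apply: eq_bigr => -[i b] _.
  rewrite (bigD1 l1) //= [X in _ + X]big1 ?addr0 => [|i /negbTE il1].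
    by rewrite mulr_suml; apply: eq_bigr => b _; rewrite eqxx mulr1n scalerAl.
  by rewrite big1 // => b _; rewrite il1 mulr0n scaler0.
rewrite -half -half -sumrB; apply: eq_bigr => a _.
rewrite /minor_family -scalerBr; congr (_ *: _).
rewrite rmorphB !rmorphMn /=; congr (_ *+ _ - _ *+ _).
  by rewrite rmorphM /= specializeX.
by rewrite rmorphM /= specializeX.
Qed.

End Minors.

Definition inverse_family (e : nat) := minor_family (fun b : monom n e => 'X_[mon b] \mPov h).

Lemma sum_inverse_family e (c : 'I_n.+1 * monom n e -> k) t l :
  \sum_a c a *: specialize t (inverse_family a l) =
  (hform (fun b => c (l.1, b)) \mPov hs t) * 'X_l.2 -
  (hform (fun b => c (l.2, b)) \mPov hs t) * 'X_l.1.
Proof.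
rewrite sum_minor_family !form_comp.
have E i : \sum_b c (i, b) *: specialize t ('X_[mon b] \mPov h) =
    \sum_b c (i, b) *: ('X_[mon b] \mPov hs t).
  by apply: eq_bigr => b _; rewrite specialize_comp specializeX.
exact: (f_equal2 (fun a b : {mpoly k[n.+1]} => a * 'X_l.2 - b * 'X_l.1) (E l.1) (E l.2)).
Qed.

Lemma pdependent_inverse e t : pdependent (@inverse_family e) t <->
  exists g, [/\ forall i, g i \is e.-homog, exists i, g i != 0 &
    proportional (fun i => g i \mPov hs t) X].
Proof.
split=> [[c [[[i b] c0] Hc]]|[g [hg [i g0] Hg]]].
  exists (fun i => hform (fun b => c (i, b))); split.
  - by move=> j; exact: form_dhomog.
  - by exists i; apply: form_neq0; exists b.
  - by move=> l1 l2; apply/eqP; rewrite -subr_eq0 -(sum_inverse_family c t (l1, l2)) Hc.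
exists (fun a => (g a.1)@_(mon a.2)); split.
  apply: contrapT => /forallNP N; move/eqP: g0; apply.
  rewrite (dhomog_form (hg i)); rewrite /hform big1 // => b _.
  by have /negP/negPn/eqP -> := N (i, b); rewrite scale0r.
move=> l; rewrite sum_inverse_family /= -!(dhomog_form (hg _)).
by apply/eqP; rewrite subr_eq0; apply/eqP/Hg.
Qed.

End DependenceOfComposites.

(** * Polynomial families of birational maps *)

Section BirationalFamily.
Variables (k : closedFieldType) (m n d e : nat) (I : set {mpoly k[m]}).

Local Notation T := (affine_fspace I).
Local Notation X := (proj_space k n).
Local Notation TX := (prod_fspace T X).

Variables (h g : 'I_n.+1 -> {mpoly {mpoly k[m]}[n.+1]}) (D : set T).
Hypothesis hh : forall i, h i \is d.-homog.
Hypothesis hg : forall i, g i \is e.-homog.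
Hypothesis denseD : forall (p : {mpoly k[m]}) (s : T), p.@[acrd s] != 0 ->
  exists2 s', D s' & p.@[acrd s'] != 0.
Hypothesis invD : forall s, D s -> inverse_polys
  (fun i => specialize (acrd s) (h i)) (fun i => specialize (acrd s) (g i)).

Local Notation hs s := (fun i => specialize (acrd s) (h i)).
Local Notation gs s := (fun i => specialize (acrd s) (g i)).

Lemma specialize_eq0_dense (P : {mpoly {mpoly k[m]}[n.+1]}) :
  (forall s, D s -> specialize (acrd s) P = 0) -> forall s : T, specialize (acrd s) P = 0.
Proof.
move=> H s; apply/mpolyP => b; rewrite mcoeff0 mcoeff_specialize.
apply/eqP; apply: contraT => /denseD[s' Ds'].
by rewrite -mcoeff_specialize H // mcoeff0 eqxx.
Qed.

Lemma proportional_dense (u : 'I_n.+1 -> {mpoly {mpoly k[m]}[n.+1]}) :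
  (forall s, D s -> proportional (fun i => specialize (acrd s) (u i))
    (fun i => 'X_i : {mpoly k[n.+1]})) ->
  forall s : T, proportional (fun i => specialize (acrd s) (u i))
    (fun i => 'X_i : {mpoly k[n.+1]}).
Proof.
move=> H s i j; apply/eqP; rewrite -subr_eq0.
have E (t : 'I_m -> k) : specialize t (u i) * 'X_j - specialize t (u j) * 'X_i =
    specialize t (u i * 'X_j - u j * 'X_i).
  rewrite rmorphB; congr (_ - _); first by rewrite rmorphM /= specializeX.
  by rewrite rmorphM /= specializeX.
rewrite E specialize_eq0_dense // => s' /H H'.
by rewrite -E H' subrr.
Qed.

Lemma left_inverse_all (s : T) : proportional (fun i => gs s i \mPov hs s)
  (fun i => 'X_i : {mpoly k[n.+1]}).
Proof.
have E (t : 'I_m -> k) : (fun i => specialize t (g i \mPov h)) =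
    (fun i => specialize t (g i) \mPov (fun j => specialize t (h j))).
  by apply: funext => i; exact: specialize_comp.
rewrite -E; apply: proportional_dense s => s' /invD[H _ _ _].
by rewrite /= E; exact: H.
Qed.

Lemma right_inverse_all (s : T) : proportional (fun i => hs s i \mPov gs s)
  (fun i => 'X_i : {mpoly k[n.+1]}).
Proof.
have E (t : 'I_m -> k) : (fun i => specialize t (h i \mPov g)) =
    (fun i => specialize t (h i) \mPov (fun j => specialize t (g j))).
  by apply: funext => i; exact: specialize_comp.
rewrite -E; apply: proportional_dense s => s' /invD[_ _ H _].
by rewrite /= E; exact: H.
Qed.

Local Notation compfam g h := (fun i => g i \mPov h).

(** By density of [D], every nonempty open subset of the product meets the fibre over a point of
    [D]; in that fibre both tuples are nonzero, and their domains are dense. *)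
Lemma dense_family (d1 d2 : nat) (u v : 'I_n.+1 -> {mpoly {mpoly k[m]}[n.+1]}) :
  (forall i, u i \is d1.-homog) -> (forall i, v i \is d2.-homog) ->
  (forall s, D s -> exists i, specialize (acrd s) (u i) != 0) ->
  (forall s, D s -> exists i, specialize (acrd s) (v i) != 0) ->
  dense (family_dom (I := I) u `&` family_dom (I := I) v).
Proof.
move=> hu hv u0 v0 O [[s1 x1] O1] oO.
have [c [Q [hQ Q1 QO]]] := prod_nbhs (@is_morphism_id k T) oO O1.
have [|s Ds] := @denseD (Q.@[fun i => (crd x1 i)%:MP]) s1; first by rewrite -ev2_swap.
rewrite -ev2_swap -meval_specialize => Qs.
have [ou du _] := poly_map_ratmap (fun i => specialize_dhomog (acrd s) (hu i)) (u0 _ Ds).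
have [ov dv _] := poly_map_ratmap (fun i => specialize_dhomog (acrd s) (hv i)) (v0 _ Ds).
have oQ := proj_basic_open (specialize_dhomog (acrd s) hQ).
have [|x [/= Qx [ux vx]]] := denseI ou du dv _ oQ; first by exists x1.
by exists (s, x); split => //; apply: QO; rewrite -meval_specialize.
Qed.

Hypothesis birh : forall s : T, birational (fibre_map h s).

Lemma family_comp_dom (s : T) x (u v : 'I_n.+1 -> {mpoly {mpoly k[m]}[n.+1]}) :
  family_dom (I := I) (compfam u v) (s, x) <->
  exists i, (specialize (acrd s) (u i) \mPov (fun j => specialize (acrd s) (v j))).@[crd x] != 0.
Proof.
have E : (fun i => specialize (acrd s) (u i \mPov v)) =
    (fun i => specialize (acrd s) (u i) \mPov (fun j => specialize (acrd s) (v j))).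
  by apply: funext => i; exact: specialize_comp.
rewrite -[family_dom _ _]/(pdom (poly_map (fun i => specialize (acrd s) (u i \mPov v))) x).
by rewrite E.
Qed.

(** The proportionalities extend from [D] to all parameters by density. The nonvanishing of [g] does
    not, but over [D] it already makes the domains dense in the product. Birationality of each
    single fibre is a separate matter, assumed in [birh]. *)
Lemma total_birational : birational
  (PMap (family_dom h) (fun z : TX => (z.1, fibre_map h z.1 z.2) : TX)).
Proof.
have hgh i : g i \mPov h \is (e * d).-homog by exact: dhomog_subst (hg i) hh.
have hhg i : h i \mPov g \is (d * e).-homog by exact: dhomog_subst (hh i) hg.
have nz (p : {mpoly k[n.+1]}) (v : 'I_n.+1 -> {mpoly k[n.+1]}) : p \mPov v != 0 -> p != 0.
  by apply: contraNneq => ->; rewrite comp_mpoly0.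
have h0 s : D s -> exists i, specialize (acrd s) (h i) != 0.
  by move=> /invD[_ _ _ [i /nz ?]]; exists i.
have g0 s : D s -> exists i, specialize (acrd s) (g i) != 0.
  by move=> /invD[_ [i /nz ?] _ _]; exists i.
have gh0 s : D s -> exists i, specialize (acrd s) (g i \mPov h) != 0.
  by move=> /invD[_ [i H] _ _]; exists i; rewrite specialize_comp.
have hg0 s : D s -> exists i, specialize (acrd s) (h i \mPov g) != 0.
  by move=> /invD[_ _ _ [i H]]; exists i; rewrite specialize_comp.
have oh := @family_dom_open k m n I d h hh; have og := @family_dom_open k m n I e g hg.
have ogh := @family_dom_open k m n I _ (compfam g h) hgh.
have ohg := @family_dom_open k m n I _ (compfam h g) hhg.
have dA := dense_family hh hgh h0 gh0; have dB := dense_family hg hhg g0 hg0.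
have mg := @family_morphism k m n I e g hg.
split.
  split; [exact: oh| |exact: family_morphism hh].
  by move=> O O0 oO; have [z [Oz [hz _]]] := dA _ O0 oO; exists z.
exists (family_dom h `&` family_dom (compfam g h)).
exists (PMap (family_dom g `&` family_dom (compfam h g))
         (fun z : TX => (z.1, fibre_map g z.1 z.2) : TX)).
split.
- by split; [exact: openI|exact: dA|move=> z []].
- split; [exact: openI|exact: dB|].
  by apply: is_morphism_sub mg; [exact: openI|move=> z []].
- move=> [s x] [hx /family_comp_dom ghx].
  have [gy fy hgy] := poly_map_cancel (fun i => specialize_dhomog (acrd s) (hh i))
    (fun i => specialize_dhomog (acrd s) (hg i)) (left_inverse_all s) hx ghx.
  split; last exact: (congr1 (pair s) fy).
  by split; [exact: gy|apply/family_comp_dom; exact: hgy].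
- move=> [s y] [gy /family_comp_dom hgy].
  have [hx fx ghx] := poly_map_cancel (fun i => specialize_dhomog (acrd s) (hg i))
    (fun i => specialize_dhomog (acrd s) (hh i)) (right_inverse_all s) gy hgy.
  split; last exact: (congr1 (pair s) fx).
  by split; [exact: hx|apply/family_comp_dom; exact: ghx].
Qed.

Definition family_map (s : affine_variety I) : Bir X := bir_class (Birat (birh s)).

Lemma represents_family_map s : represents (family_map s) (poly_map (hs s)).
Proof. exact: represents_class. Qed.

Lemma family_map_morphism : bir_morphism family_map.
Proof.
exists (family_dom h), (fun z : TX => fibre_map h z.1 z.2); split.
  split; [exact: total_birational|exact: family_morphism2 hh| |exact: birh].
  by move=> s; have [[]] := birh s.
by move=> s; exact: represents_family_map.
Qed.

End BirationalFamily.

(** * Closed sets pass the test on polynomial families *)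

Section Extension.
Variables (k : closedFieldType) (m : nat).
Implicit Types (t : 'I_m -> k) (v : 'I_m.+1 -> k).

Definition ext_coord t (z : k) : 'I_m.+1 -> k :=
  fun i => if unlift ord_max i is Some j then t j else z.

Definition res_coord v : 'I_m -> k := fun j => v (lift ord_max j).

Lemma res_ext t z : res_coord (ext_coord t z) = t.
Proof. by apply: funext => j; rewrite /res_coord /ext_coord liftK. Qed.

Lemma ext_coord_max t z : ext_coord t z ord_max = z.
Proof. by rewrite /ext_coord unlift_none. Qed.

Definition widen_mpoly : {mpoly k[m]} -> {mpoly k[m.+1]} :=
  comp_mpoly [tuple 'X_(lift ord_max j) | j < m].

HB.instance Definition _ := GRing.RMorphism.copy widen_mpoly
  (comp_mpoly [tuple 'X_(lift ord_max j) | j < m]).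

Lemma meval_widen v Q : (widen_mpoly Q).@[v] = Q.@[res_coord v].
Proof. by rewrite meval_comp; apply: meval_eq => j; rewrite mevalXU. Qed.

(** The exponent [size q] exceeds the degree of [Q] in the last variable, so this power of [d]
    clears the denominators created by substituting [1 / d]. *)
Lemma clear_inverse (Q : {mpoly k[m.+1]}) (d : {mpoly k[m]}) :
  exists N (Q' : {mpoly k[m]}), forall t, d.@[t] != 0 ->
    Q'.@[t] = d.@[t] ^+ N * Q.@[ext_coord t (d.@[t])^-1].
Proof.
pose q := split_last Q; exists (size q), (\sum_(i < size q) q`_i * d ^+ (size q - i)).
move=> t d0; rewrite meval_split_last ext_coord_max.
rewrite -/(res_coord (ext_coord t (d.@[t])^-1)) res_ext -/q.
rewrite /map_poly horner_poly (raddf_sum (meval t)) mulr_sumr; apply: eq_bigr => i _.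
rewrite /= mevalM rmorphXn /= mulrCA; congr (_ * _).
by rewrite exprVn expfB.
Qed.

End Extension.

Lemma specialize_widen (k : closedFieldType) (m n : nat) (v : 'I_m.+1 -> k)
    (P : {mpoly {mpoly k[m]}[n.+1]}) :
  specialize v (map_mpoly (@widen_mpoly k m) P) = specialize (res_coord v) P.
Proof.
apply/mpolyP => b; rewrite !mcoeff_specialize mcoeff_map_mpoly; exact: meval_widen.
Qed.

Lemma widen_family (k : closedFieldType) (m n d : nat)
    (u : 'I_n.+1 -> {mpoly {mpoly k[m]}[n.+1]}) : (forall i, u i \is d.-homog) ->
  exists2 u' : 'I_n.+1 -> {mpoly {mpoly k[m.+1]}[n.+1]}, forall i, u' i \is d.-homog &
    forall v, (fun i => specialize v (u' i)) = (fun i => specialize (res_coord v) (u i)).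
Proof.
move=> hu; exists (fun i => map_mpoly (@widen_mpoly k m) (u i)).
  by move=> i; exact: map_mpoly_dhomog.
by move=> v; apply: funext => i; exact: specialize_widen.
Qed.

Section ClosedPolyClosed.
Variables (k : closedFieldType) (n : nat).

Local Notation X := (proj_space k n).

(* The parameters [t] of a family at which the members are dominant form the
   open set [delta <> 0], made affine by a further coordinate [1 / delta].
   There, birationality amounts to solvability of a linear system in the
   coefficients of an inverse of bounded degree, and the solution can be chosen
   polynomial in [t] on a subset still containing [t0] in its closure. *)
Lemma closed_poly_closed (F : set (Bir X)) : closed F -> poly_closed F.
Proof.
move=> cF m d h t0 phi0 hh rep0 St0.
pose S := [set t | exists2 phi, F phi & represents phi (poly_map (fun i => specialize t (h i)))].
pose e := inverse_degree n d; pose E := dominance_degree d e.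
have hht t i : specialize t (h i) \is d.-homog by exact: specialize_dhomog.
(* The member at [t0] is birational, hence dominant; by openness, no nonzero form of degree [E] is
   killed by composition with the members near [t0]. *)
have nd : ~ pdependent (@form_comp_family k m n h E) t0.
  move=> /pdependent_form_comp[P [hP P0 /eqP]]; apply/negP.
  exact: represents_dominant (hht t0) rep0 hP P0.
have [dl dl0 Hdl] := pindependent_open nd.
have inv t g : dl.@[t] != 0 -> (forall i, g i \is e.-homog) -> (exists i, g i != 0) ->
    proportional (fun i => g i \mPov (fun i => specialize t (h i))) (fun i => 'X_i) ->
    inverse_polys (fun i => specialize t (h i)) g.
  move=> dt hg g0 gh; apply: (left_inverse_polys (hht t) hg g0 gh) => P hP Ph.
  apply/eqP; apply: contraT => P0; case: (Hdl _ dt).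
  by apply/pdependent_form_comp; exists P.
have bir t : dl.@[t] != 0 -> pdependent (@inverse_family k m n h e) t ->
    birational (poly_map (fun i => specialize t (h i))).
  move=> dt /pdependent_inverse[g [hg g0 gh]].
  exact: (birational_poly_map (hht t) hg (inv _ _ dt hg g0 gh)).
have [||S' [c [S'S S't0 c0 Hc]]] := @pdependent_section _ _ _ _ _ (@inverse_family k m n h e)
    (S `&` [set t | dl.@[t] != 0]) t0.
- exact: zclosure_neq0 St0 dl0.
- move=> t [[phi _ rep] _]; apply/pdependent_inverse.
  exact: represents_bounded_inverse (hht t) rep.
have dS' t : S' t -> dl.@[t] != 0 by move=> /S'S[].
pose g i : {mpoly {mpoly k[m]}[n.+1]} := hform (fun b => c (i, b)).
have hg i : g i \is e.-homog by exact: form_dhomog.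
have gE t i : specialize t (g i) = hform (fun b => (c (i, b)).@[t]).
  rewrite /g /hform (raddf_sum (specialize t)); apply: eq_bigr => b _.
  by rewrite /= specializeZ specializeX.
have invS' t : S' t -> inverse_polys (fun i => specialize t (h i)) (fun i => specialize t (g i)).
  move=> S't; apply: inv; first exact: dS'.
  - by move=> i; exact: specialize_dhomog.
  - have [[i b] ci] := c0 _ S't; exists i; rewrite gE; apply: form_neq0; by exists b.
  - move=> i j; apply/eqP; rewrite -subr_eq0 !gE.
    by rewrite -(sum_inverse_family h (fun a => (c a).@[t]) t (i, j)) Hc.
pose lft t := ext_coord t (dl.@[t])^-1.
(* The affine set of [I] is the closure of the lift of [S'] to the graph of [1 / dl]. Since [I]
   contains [dl * x_max - 1], [dl] is nonzero at all its points. *)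
pose I := [set Q : {mpoly k[m.+1]} | forall t, S' t -> Q.@[lft t] = 0].
have mkT v : (forall Q, I Q -> Q.@[v] = 0) -> exists s : affine_fspace I, acrd s = v.
  move=> H; have P : `[< forall p : {mpoly k[m.+1]}, I p -> p.@[(\row_i v i) 0] = 0 >].
    by apply/asboolP => p /H <-; apply: meval_eq => i; rewrite mxE.
  by exists (exist _ (\row_i v i) P); apply: funext => i; rewrite /acrd /= mxE.
have IT (s : affine_fspace I) Q : I Q -> Q.@[acrd s] = 0.
  by move=> IQ; have /asboolP := valP s; exact.
have clT (s : affine_fspace I) : zclosure S' (res_coord (acrd s)).
  move=> Q HQ; rewrite -meval_widen; apply: IT => t S't.
  by rewrite meval_widen res_ext HQ.
have dlT (s : affine_fspace I) : dl.@[res_coord (acrd s)] != 0.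
  have := IT s (widen_mpoly dl * 'X_ord_max - 1).
  rewrite mevalB mevalM mevalXU meval1 meval_widen => H.
  apply: contraTneq (oner_neq0 k) => d0; rewrite negbK; move: H; rewrite d0 mul0r sub0r.
  move=> H; rewrite -oppr_eq0 H // => t S't.
  rewrite mevalB mevalM mevalXU meval1 meval_widen /lft res_ext ext_coord_max.
  by rewrite divff ?subrr // dS'.
have [h' hh' h'E] := widen_family hh; have [g' hg' g'E] := widen_family hg.
pose D := [set s : affine_fspace I | exists2 t, S' t & acrd s = lft t].
have denseD p (s : affine_fspace I) : p.@[acrd s] != 0 -> exists2 s', D s' & p.@[acrd s'] != 0.
  move=> ps; apply: contrapT => N; move/eqP: ps; apply; apply: IT => t S't.
  apply: contrapT => /eqP pt; apply: N.
  have [|s' s'E] := mkT (lft t); first by move=> Q IQ; exact: IQ.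
  by exists s'; [exists t|rewrite s'E].
have invD s : D s -> inverse_polys (fun i => specialize (acrd s) (h' i))
    (fun i => specialize (acrd s) (g' i)).
  by move=> [t S't sE]; rewrite h'E g'E sE res_ext; exact: invS'.
(* As [g'] may vanish at [s], the inverse of this fibre is not taken from it: a left inverse exists
   because dependence is a closed condition, and it is two-sided because [dl] is nonzero. *)
have birh (s : affine_fspace I) : birational (fibre_map h' s).
  rewrite /fibre_map h'E; apply: bir; first exact: dlT.
  apply: pdependent_closed (clT s) _ => t S't; apply/pdependent_inverse.
  exists (fun i => specialize t (g i)); have [gh [i gh0] _ _] := invS' _ S't; split.
  - by move=> j; exact: specialize_dhomog.
  - by exists i; apply: contraNneq gh0 => ->; rewrite comp_mpoly0.
  - exact: gh.
have mphi := family_map_morphism hh' hg' denseD invD birh.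
have rphi s := represents_family_map birh s.
have closedF := (bir_closedP F).1 cF _ _ mphi.
(* Multiplied by a power of [dl], an equation of the lift of [S'] becomes a polynomial in [t]
   vanishing on [S'], hence at [t0]. *)
have [s0 s0E] : exists s : affine_fspace I, acrd s = lft t0.
  apply: mkT => Q IQ; have [N [Q' HQ']] := clear_inverse Q dl.
  have : Q'.@[t0] = 0.
    by apply: S't0 => t S't; rewrite HQ' ?dS' // -/(lft t) IQ // mulr0.
  by rewrite HQ' // => /eqP; rewrite mulf_eq0 expf_eq0 (negbTE dl0) andbF => /eqP.
(* The preimage of [F] is closed and contains the dense set [D]. *)
have Fs0 : F (family_map birh s0).
  apply: contrapT => nF; have oF : open (~` (family_map birh @^-1` F)) by rewrite openC.
  have [p [ps0 pF]] := @affine_nbhs _ _ I _ s0 oF nF.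
  have [s [t S't sE] ps] := denseD _ _ ps0; apply: (pF _ ps).
  have [[phi Fphi rep] _] := S'S _ S't.
  rewrite /preimage /=; suff -> : family_map birh s = phi by [].
  by apply: represents_inj (rphi s) _; rewrite h'E sE res_ext.
suff -> : phi0 = family_map birh s0 by [].
by apply: represents_inj rep0 _; have := rphi s0; rewrite h'E s0E res_ext.
Qed.

Lemma closed_polyP (F : set (Bir X)) : closed F <-> poly_closed F.
Proof. by split; [exact: closed_poly_closed|exact: poly_closed_closed]. Qed.

End ClosedPolyClosed.

(** * Cones and the projection from o *)

Section CofiniteImage.
Variable k : closedFieldType.
Implicit Types a b e : {poly k}.

(* Outside finitely many values of [c], the roots of [E], the polynomial
   [a - c b] has a root which is not a root of [b e]. *)
Lemma rational_image_cofinite a b e : b != 0 -> e != 0 ->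
  (forall c, a != c *: b) ->
  exists2 E : {poly k}, E != 0 & forall c, E.[c] != 0 ->
    exists s, [/\ b.[s] != 0, e.[s] != 0 & a.[s] = c * b.[s]].
Proof.
move=> b0 e0 nc; pose g := gcdp a b.
have g0 : g != 0 by rewrite gcdp_eq0 negb_and b0 orbT.
have [a' aE] : exists a', a = a' * g by exists (a %/ g); rewrite divpK ?dvdp_gcdl.
have [b' bE] : exists b', b = b' * g by exists (b %/ g); rewrite divpK ?dvdp_gcdr.
have cop : coprimep a' b'.
  have := @coprimep_div_gcd _ a b; rewrite b0 orbT => /(_ isT).
  by rewrite -/g {1}aE {1}bE !mulpK.
have b'0 : b' != 0 by apply: contraNneq b0 => b'0; rewrite bE b'0 mul0r.
have [rs rsE] := closed_field_poly_normal (b * e).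
have rsP s : (b * e).[s] = 0 -> s \in rs.
  rewrite rsE hornerZ => /eqP; rewrite mulf_eq0 lead_coef_eq0 mulf_eq0.
  rewrite (negbTE b0) (negbTE e0) /= -[_ == 0]/(root _ s) root_prod_XsubC.
  exact.
(* At most one [c] makes [a' - c b'] constant: two of them would make [a'] and [b'] constant, and
   [a] a multiple of [b]. *)
have [c0 Hc0] : exists c0, forall c, c != c0 -> (1 < size (a' - c *: b')%R)%N.
  have [[c0 Hc0]|N] := EM (exists c0, (size (a' - c0 *: b')%R <= 1)%N); last first.
    by exists 0 => c _; rewrite ltnNge; apply/negP => H; apply: N; exists c.
  exists c0 => c cc0; rewrite ltnNge; apply/negP => Hc.
  have sb : (size b' <= 1)%N.
    rewrite -(size_scale _ (_ : c - c0 != 0)) ?subr_eq0 //.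
    have -> : (c - c0) *: b' = (a' - c0 *: b') - (a' - c *: b').
      by rewrite scalerBl; move: (c *: b') (c0 *: b') => x y; ring.
    by apply: leq_trans (size_polyD _ _) _; rewrite size_polyN geq_max Hc0.
  have sa : (size a' <= 1)%N.
    rewrite -[a'](subrK (c *: b')); apply: leq_trans (size_polyD _ _) _.
    by rewrite geq_max Hc /=; apply: leq_trans (size_scale_leq _ _) sb.
  have [/eqP] := nc (a'`_0 / b'`_0); apply.
  move: b'0; rewrite aE bE (size1_polyC sa) (size1_polyC sb) polyC_eq0 => b'0.
  by rewrite !coefC /= scalerAl -mul_polyC -polyCM divfK.
(* Besides [c0], this excludes the values of [c] for which a root [r] of [b e] is a root of
   [a' - c b']. No factor is zero, as [a'] and [b'] have no common root. *)
exists ((\prod_(r <- rs) (b'.[r] *: 'X - a'.[r]%:P)) * ('X - c0%:P)).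
  rewrite mulf_neq0 ?polyXsubC_eq0 //; rewrite prodf_seq_neq0; apply/allP => r _.
  apply/negP => /eqP H.
  have b'r : b'.[r] = 0.
    have /(congr1 (fun p : {poly k} => p`_1)) := H.
    by rewrite coefB coefZ coefX coefC coef0 /= mulr1 subr0.
  have a'r : a'.[r] = 0.
    have /(congr1 (fun p : {poly k} => p`_0)) := H.
    by rewrite coefB coefZ coefX coefC coef0 /= mulr0 sub0r => /eqP; rewrite oppr_eq0 => /eqP.
  by have := coprimep_root cop; move=> /(_ r); rewrite /root a'r b'r eqxx => /(_ isT).
move=> c; rewrite hornerM mulf_eq0 negb_or hornerXsubC subr_eq0 => /andP[Ec cc0].
have /closed_rootP[s] : size (a' - c *: b') != 1%N by rewrite gtn_eqF // Hc0.
rewrite /root hornerD hornerN hornerZ subr_eq0 => /eqP a's.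
have be : (b * e).[s] != 0.
  apply: contraNneq Ec => /rsP sr; rewrite horner_prod; apply/eqP.
  rewrite (big_rem s) //= hornerD hornerN hornerZ hornerX hornerC a's [_ * c]mulrC subrr.
  by rewrite mul0r.
move: be; rewrite hornerM mulf_eq0 negb_or => /andP[bs es].
by exists s; split => //; rewrite aE bE !hornerM a's mulrA.
Qed.

End CofiniteImage.

Section Cone.
Variables (R : comNzRingType) (n : nat).
Implicit Types (p : {mpoly R[n.+1]}) (q : {mpoly R[n.+2]}).

(** Pullback along the projection from [o]: the equation of the cone with vertex [o]. *)
Definition cone p : {mpoly R[n.+2]} := p \mPov (fun j => 'X_(lift ord0 j)).

(* The restriction to the hyperplane [x_0 = b x_1]. *)
Definition section_subst (b : R) (i : 'I_n.+2) : {mpoly R[n.+1]} :=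
  if unlift ord0 i is Some j then 'X_j else b *: 'X_ord0.
Definition section (b : R) q : {mpoly R[n.+1]} := q \mPov section_subst b.

HB.instance Definition _ := GRing.RMorphism.copy cone
  (comp_mpoly [tuple 'X_(lift ord0 j) | j < n.+1]).
HB.instance Definition _ b := GRing.RMorphism.copy (section b)
  (comp_mpoly [tuple section_subst b i | i < n.+2]).

Lemma coneM : {morph cone : p p' / p * p'}. Proof. exact: rmorphM. Qed.
Lemma sectionM b : {morph section b : q q' / q * q'}. Proof. exact: rmorphM. Qed.

Lemma coneK b : cancel cone (section b).
Proof.
move=> p; rewrite /section /cone comp_tupleA -[RHS]comp_mpoly_id; congr comp_mpoly.
by apply: eq_from_tnth => i; rewrite !tnth_mktuple comp_tupleXU /section_subst liftK.
Qed.

Lemma cone_dhomog d p : p \is d.-homog -> cone p \is d.-homog.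
Proof.
move=> hp; rewrite -[X in X.-homog]muln1; apply: dhomog_subst => // i; exact: dhomogU.
Qed.

Lemma section_dhomog d b q : q \is d.-homog -> section b q \is d.-homog.
Proof.
move=> hq; rewrite -[X in X.-homog]muln1; apply: dhomog_subst => // i.
rewrite /section_subst; case: unlift => [j|]; first exact: dhomogU.
by apply: dhomogZ; exact: dhomogU.
Qed.

(** These forms represent the map [h] followed by the projection from [o]. *)
Definition tail (h : 'I_n.+2 -> {mpoly R[n.+2]}) (j : 'I_n.+1) := h (lift ord0 j).

Lemma cone_comp p (h : 'I_n.+2 -> {mpoly R[n.+2]}) : cone p \mPov h = p \mPov (tail h).
Proof.
rewrite /cone comp_tupleA; congr comp_mpoly.
by apply: eq_from_tnth => i; rewrite !tnth_mktuple comp_tupleXU.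
Qed.

Lemma comp_cone p (u : 'I_n.+1 -> {mpoly R[n.+1]}) :
  p \mPov (fun j => cone (u j)) = cone (p \mPov u).
Proof. by rewrite /cone comp_tupleA. Qed.

(** [sigma_formula] over any commutative ring, so that it also applies to families with
    parameters. *)
Definition sigma_poly (h : 'I_n.+1 -> {mpoly R[n.+1]}) (i : 'I_n.+2) : {mpoly R[n.+2]} :=
  if unlift ord0 i is Some j then 'X_(lift ord0 ord0) * cone (h j)
  else 'X_ord0 * cone (h ord0).

Lemma sigma_poly0 h : sigma_poly h ord0 = 'X_ord0 * cone (h ord0).
Proof. by rewrite /sigma_poly unlift_none. Qed.

Lemma sigma_poly_lift h j : sigma_poly h (lift ord0 j) = 'X_(lift ord0 ord0) * cone (h j).
Proof. by rewrite /sigma_poly liftK. Qed.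

Lemma sigma_poly_dhomog d h : (forall i, h i \is d.-homog) ->
  forall i, sigma_poly h i \is d.+1.-homog.
Proof.
move=> hh i; rewrite /sigma_poly; have E p : p \is d.-homog ->
   forall l : 'I_n.+2, 'X_l * cone p \is d.+1.-homog.
  by move=> hp l; exact: dhomogM (dhomogU R l) (cone_dhomog hp).
by case: unlift => [j|]; exact: E.
Qed.

(* [sigma] is multiplicative up to a common factor. *)
Lemma comp_sigma_poly e (u h : 'I_n.+1 -> {mpoly R[n.+1]}) :
  (forall i, u i \is e.-homog) -> forall i,
  sigma_poly u i \mPov sigma_poly h =
  (cone (h ord0) * 'X_(lift ord0 ord0) ^+ e) * sigma_poly (fun j => u j \mPov h) i.
Proof.
move=> hu i.
have E j : cone (u j) \mPov sigma_poly h = 'X_(lift ord0 ord0) ^+ e * cone (u j \mPov h).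
  rewrite cone_comp -comp_cone -(comp_homogZ _ _ (hu j)); congr comp_mpoly.
  by apply: eq_from_tnth => l; rewrite !tnth_mktuple /tail sigma_poly_lift.
have [j|] := unliftP ord0 i => ->.
  rewrite !sigma_poly_lift rmorphM /= comp_tupleXU sigma_poly_lift E.
  by move: (cone _) ('X_ _ ^+ e) (cone (u j \mPov h)) => a b c; ring.
rewrite !sigma_poly0 rmorphM /= comp_tupleXU sigma_poly0 E.
by move: (cone _) ('X_ _ ^+ e) (cone (u ord0 \mPov h)) => a b c; ring.
Qed.

End Cone.

Section ProportionalPolynomials.
Variables (k : closedFieldType).

Lemma rmorph_proportional (R S : comNzRingType) m (f : {rmorphism R -> S}) (u v : 'I_m -> R) :
  proportional u v -> proportional (fun i => f (u i)) (fun i => f (v i)).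
Proof. by move=> H i j; rewrite -!rmorphM H. Qed.

Lemma proportional_nth_neq0 (R : idomainType) m (u v : 'I_m -> R) i :
  proportional u v -> v i != 0 -> (exists j, u j != 0) -> u i != 0.
Proof.
move=> H vi [j uj]; apply: contraNneq (mulf_neq0 uj vi) => ui.
by rewrite H ui mul0r.
Qed.

Lemma proportional_comp n m d (a b : 'I_m -> {mpoly k[n]}) :
  (exists i, a i != 0) -> (exists i, b i != 0) -> proportional a b ->
  exists c c', [/\ c != 0, c' != 0 & forall p : {mpoly k[m]}, p \is d.-homog ->
    c * (p \mPov a) = c' * (p \mPov b)].
Proof.
move=> a0 [i bi] H; have ai := proportional_nth_neq0 H bi a0.
exists (b i ^+ d), (a i ^+ d); split; try exact: expf_neq0.
move=> p hp; rewrite -!(comp_homogZ _ _ hp); congr comp_mpoly.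
by apply: eq_from_tnth => j; rewrite !tnth_mktuple mulrC H.
Qed.

Lemma comp_proportional n m l d (a b : 'I_m -> {mpoly k[n]}) (u : 'I_l -> {mpoly k[m]}) :
  (exists i, a i != 0) -> (exists i, b i != 0) -> (forall i, u i \is d.-homog) ->
  proportional a b ->
  proportional (fun i => u i \mPov a) (fun i => u i \mPov b).
Proof.
move=> a0 b0 hu /(proportional_comp d a0 b0)[c [c' [c0 c'0 H]]] i j.
apply: (mulfI c0); rewrite !mulrA !(H _ (hu _)).
by move: (u i \mPov b) (u j \mPov b) => x y; ring.
Qed.

Lemma comp_proportional_neq0 n m d (a b : 'I_m -> {mpoly k[n]}) (p : {mpoly k[m]}) :
  (exists i, a i != 0) -> (exists i, b i != 0) -> p \is d.-homog ->
  proportional a b -> p \mPov a != 0 -> p \mPov b != 0.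
Proof.
move=> a0 b0 hp /(proportional_comp d a0 b0)[c [c' [c0 c'0 H]]].
by apply: contraNneq => pb; have /eqP := H _ hp; rewrite pb mulr0 mulf_eq0 (negbTE c0).
Qed.

Variable n : nat.

Lemma cone_neq0 (p : {mpoly k[n.+1]}) : (cone p != 0) = (p != 0).
Proof.
apply/idP/idP; first by apply: contraNneq => ->; rewrite rmorph0.
by apply: contraNneq => cp; rewrite -(coneK 0 p) cp rmorph0.
Qed.

Lemma sigma_proportional (u v : 'I_n.+1 -> {mpoly k[n.+1]}) :
  proportional u v -> proportional (sigma_poly u) (sigma_poly v).
Proof.
move=> H; have {}H i j : cone (u i) * cone (v j) = cone (u j) * cone (v i).
  by rewrite -!coneM H.
move=> i j; have [i'|] := unliftP ord0 i => ->; have [j'|] := unliftP ord0 j => ->;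
  rewrite ?sigma_poly_lift ?sigma_poly0.
- have := H i' j'; move: (cone _) (cone _) (cone _) (cone _) => a b c d E.
  by rewrite mulrACA E; ring.
- have := H i' ord0; move: (cone _) (cone _) (cone _) (cone _) => a b c d E.
  by rewrite mulrACA E; ring.
- have := H ord0 j'; move: (cone _) (cone _) (cone _) (cone _) => a b c d E.
  by rewrite mulrACA E; ring.
- by move: (cone _) (cone _) => a b; ring.
Qed.

Lemma sigma_proportional_inj (u v : 'I_n.+1 -> {mpoly k[n.+1]}) :
  proportional (sigma_poly u) (sigma_poly v) -> proportional u v.
Proof.
move=> H i j; apply: (can_inj (coneK 0)); rewrite !coneM.
have := H (lift ord0 i) (lift ord0 j); rewrite !sigma_poly_lift.
move: (cone _) (cone _) (cone _) (cone _) => a b c d E.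
have X0 := mpolyX_neq0 k (lift ord0 ord0 : 'I_n.+2).
by apply: (mulfI X0); apply: (mulfI X0); move: E; rewrite mulrACA [RHS]mulrACA -!mulrA.
Qed.

Lemma sigma_polyX : proportional (sigma_poly (fun i : 'I_n.+1 => 'X_i : {mpoly k[n.+1]}))
  (fun i => 'X_i).
Proof.
have E i : sigma_poly (fun i : 'I_n.+1 => 'X_i : {mpoly k[n.+1]}) i = 'X_(lift ord0 ord0) * 'X_i.
  have [j|] := unliftP ord0 i => ->; rewrite ?sigma_poly_lift ?sigma_poly0 /cone comp_tupleXU //.
  by rewrite mulrC.
by move=> i j; rewrite !E; ring.
Qed.

Lemma section_nonvanishing (q : {mpoly k[n.+2]}) : q != 0 -> exists b, section b q != 0.
Proof.
move=> q0; have [v] := mpoly_nonvanishing (mulf_neq0 q0 (mpolyX_neq0 k (lift ord0 ord0))).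
rewrite mevalM mevalXU mulf_eq0 negb_or => /andP[qv v1].
exists (v ord0 / v (lift ord0 ord0)); apply: contraNneq qv => H.
have /(congr1 (meval (fun j => v (lift ord0 j)))) := H.
rewrite meval0 meval_comp => <-; apply/eqP/meval_eq => i; rewrite /section_subst.
by have [j|] := unliftP ord0 i => ->; rewrite ?mevalZ mevalXU ?divfK.
Qed.

End ProportionalPolynomials.

Section Projection.
Variables (k : closedFieldType) (n : nat).
Implicit Types (h g : 'I_n.+2 -> {mpoly k[n.+2]}) (u v : 'I_n.+1 -> {mpoly k[n.+1]}).
Implicit Types (f : Bir (proj_space k n.+1)) (tau : Bir (proj_space k n)).

Local Notation X := (fun i : 'I_n.+2 => 'X_i : {mpoly k[n.+2]}).
Local Notation X' := (fun j : 'I_n.+1 => 'X_(lift ord0 j) : {mpoly k[n.+2]}).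
Local Notation proj_o := (@proj_o k n).

Lemma proj_o_dom x : pdom proj_o x <-> pdom (poly_map X') x.
Proof.
have oE : o_point k n = pt (fun i => (i == ord0)%:R).
  by rewrite /o_point /pt; congr point_of; apply/rowP => i; rewrite !mxE.
have e0 : exists i : 'I_n.+2, (i == ord0)%:R != 0 :> k.
  by exists ord0; rewrite eqxx oner_eq0.
split=> [xo|[j xj] xo]; last first.
  move: xj; rewrite /peval mevalXU -[coords x 0 _]/(crd x _) xo oE.
  by have [a a0 ->] := crd_pt e0; rewrite mulr0 eqxx.
apply: contrapT => /forallNP N; apply: xo; rewrite oE -[x]ptK.
apply/pt_eqP => //; first exact: crd_neq0.
have {}N j : crd x (lift ord0 j) = 0.
  by have := N j; rewrite /peval mevalXU => /negP/negPn/eqP.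
move=> i j; have [i'|] := unliftP ord0 i => ->; have [j'|] := unliftP ord0 j => -> //;
  by rewrite ?N ?mul0r ?mulr0 // ?[_ == _]/= ?mulr0.
Qed.

Lemma proj_oE x : proj_o x = poly_map X' x.
Proof. by rewrite poly_mapE; congr pt; apply: funext => j; rewrite mevalXU. Qed.

Lemma agree_proj_o : agree proj_o (poly_map X').
Proof.
have [oX dX _] : is_ratmap (poly_map X').
  apply: (poly_map_ratmap (d := 1)); first by move=> i; exact: dhomogU.
  by exists ord0; exact: mpolyX_neq0.
exists (pdom (poly_map X')); split => //; last by move=> x _; exact: proj_oE.
by move=> x Xx; split => //; exact/proj_o_dom.
Qed.

Lemma agree_proj_o_comp f h d : (forall i, h i \is d.-homog) ->
  represents f (poly_map h) -> agree (pcomp proj_o (bir_repr f)) (poly_map (tail h)).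
Proof.
move=> hh rep.
have -> : tail h = (fun j => X' j \mPov h).
  by apply: funext => j; rewrite /tail comp_tupleXU.
apply: agree_ext (agree_comp (biratP _) agree_proj_o rep) => x.
by apply: pcomp_poly_map => i; exact: dhomogU.
Qed.

(** [agree_comp] asks for a birational inner map, which [proj_o] is not. That the preimage of the
    open set of agreement is dense follows from surjectivity of the projection and
    irreducibility. *)
Lemma agree_comp_proj_o tau u e : (forall i, u i \is e.-homog) ->
  represents tau (poly_map u) ->
  agree (pcomp (bir_repr tau) proj_o) (poly_map (fun i => cone (u i))).
Proof.
move=> hu [W [oW dW sW E]].
have hX' i : X' i \is 1.-homog by exact: dhomogU.
have [oV _] := poly_map_morphism hX' oW.
exists (pdom (poly_map X') `&` poly_map X' @^-1` W); split => //.
- apply: proj_dense => //.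
  have [y [_ Wy]] : setT `&` W !=set0 by apply: dW openT; exists (pt (fun=> 1)).
  pose v (i : 'I_n.+2) := if unlift ord0 i is Some j then crd y j else 0.
  have v0 : exists i, v i != 0.
    by have [j yj] := crd_neq0 y; exists (lift ord0 j); rewrite /v liftK.
  have [a a0 Ea] := crd_pt v0; exists (pt v).
  have Ev : (fun j => (X' j).@[crd (pt v)]) = fun j => a * crd y j.
    by apply: funext => j; rewrite mevalXU Ea /v liftK.
  have Ep : poly_map X' (pt v) = y by rewrite poly_mapE Ev pt_scale // ptK.
  split; last by rewrite /preimage /mkset Ep.
  have [j yj] := crd_neq0 y; exists j.
  by rewrite -[peval _ _]/((fun j => (X' j).@[crd (pt v)]) j) Ev mulf_neq0.
- move=> x [Xx Wx]; have [/= tx ux] := sW _ Wx.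
  have [] := @pcomp_poly_map _ _ _ _ _ X' u x hu; first by split.
  move=> cx _; split => //; split; first exact/proj_o_dom.
  by change (pdom (bir_repr tau) (proj_o x)); rewrite proj_oE.
- move=> x [Xx Wx]; have [/= tx ux] := sW _ Wx.
  have [] := @pcomp_poly_map _ _ _ _ _ X' u x hu; first by split.
  move=> _ cE; change (bir_repr tau (proj_o x) = poly_map (fun i => cone (u i)) x).
  by apply: etrans cE; rewrite proj_oE E.
Qed.

Lemma tail_neq0 f h d : (forall i, h i \is d.-homog) -> represents f (poly_map h) ->
  forall j, tail h j != 0.
Proof.
move=> hh rep j; rewrite /tail -(comp_tupleXU h).
exact: represents_dominant hh rep (dhomogU k _) (mpolyX_neq0 k _).
Qed.

Lemma tail_dhomog h d : (forall i, h i \is d.-homog) -> forall j, tail h j \is d.-homog.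
Proof. by move=> hh j; exact: hh. Qed.

Lemma Jon_oP f h d : (forall i, h i \is d.-homog) -> represents f (poly_map h) ->
  Jon_o f <-> proportional (tail h) X'.
Proof.
move=> hh rep; have hX' i : X' i \is 1.-homog by exact: dhomogU.
have A := agree_proj_o_comp hh rep; split=> [J|P].
  apply: agree_poly_map (tail_dhomog hh) hX' _.
  exact: agree_trans (agree_sym A) (agree_trans J agree_proj_o).
apply: agree_trans A _; apply: agree_trans (agree_sym agree_proj_o).
apply: proportional_agree (tail_dhomog hh) hX' _ _ P.
  by exists ord0; exact: tail_neq0 hh rep _.
by exists ord0; exact: mpolyX_neq0.
Qed.

Lemma St_o_cone f h tau u d e : (forall i, h i \is d.-homog) -> represents f (poly_map h) ->
  (forall i, u i \is e.-homog) -> represents tau (poly_map u) ->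
  agree (pcomp proj_o (bir_repr f)) (pcomp (bir_repr tau) proj_o) <->
  proportional (tail h) (fun i => cone (u i)).
Proof.
move=> hh repf hu rept; have A := agree_proj_o_comp hh repf.
have B := agree_comp_proj_o hu rept.
have hcu i : cone (u i) \is e.-homog by exact: cone_dhomog.
split=> [S|P].
  apply: agree_poly_map (tail_dhomog hh) hcu _.
  exact: agree_trans (agree_sym A) (agree_trans S B).
apply: agree_trans A _; apply: agree_trans (agree_sym B).
apply: proportional_agree (tail_dhomog hh) hcu _ _ P.
  by exists ord0; exact: tail_neq0 hh repf _.
by have [i ui] := represents_neq0 rept; exists i; rewrite cone_neq0.
Qed.

Lemma St_oP f h d : (forall i, h i \is d.-homog) -> represents f (poly_map h) ->
  St_o f <-> exists tau e u, [/\ forall i, u i \is e.-homog, represents tau (poly_map u) &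
    proportional (tail h) (fun i => cone (u i))].
Proof.
move=> hh rep; split=> [[tau St]|[tau [e [u [hu rept P]]]]].
  have [e [u [hu rept]]] := represents_poly tau.
  by exists tau, e, u; split; [exact: hu|exact: rept|exact/(St_o_cone hh rep hu rept)].
by exists tau; apply/(St_o_cone hh rep hu rept).
Qed.

End Projection.

(** * Lines through o *)

Section Lines.
Variables (k : closedFieldType) (n : nat).

Definition ocons (s : k) (p : 'I_n.+1 -> k) (i : 'I_n.+2) : k :=
  if unlift ord0 i is Some j then p j else s.

Lemma ocons0 s p : ocons s p ord0 = s.
Proof. by rewrite /ocons unlift_none. Qed.

Lemma ocons_lift s p j : ocons s p (lift ord0 j) = p j.
Proof. by rewrite /ocons liftK. Qed.

Lemma oconsK (x : 'I_n.+2 -> k) : ocons (x ord0) (fun j => x (lift ord0 j)) = x.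
Proof. by apply: funext => i; rewrite /ocons; case: unliftP => [j|] ->. Qed.

(** Restriction to the line through [o] with last coordinates [p], parametrized by [x_0]. *)
Definition on_line (p : 'I_n.+1 -> k) (P : {mpoly k[n.+2]}) : {poly k} :=
  mmap (@polyC k) (fun i => if unlift ord0 i is Some j then (p j)%:P else 'X) P.

Lemma horner_on_line p P s : (on_line p P).[s] = P.@[ocons s p].
Proof.
rewrite -[LHS]/((horner_eval s \o mmap (@polyC k) _) P).
apply: mpoly_rmorph_eq => [c|i] /=; first by rewrite mmapC /horner_eval hornerC mevalC.
rewrite mmapX mmap1U mevalXU /ocons /horner_eval.
by case: unlift => [j|]; rewrite ?hornerC ?hornerX.
Qed.

Variables (d e : nat) (h g : 'I_n.+2 -> {mpoly k[n.+2]}) (w : 'I_n.+1 -> {mpoly k[n.+1]}).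
Hypothesis hg : forall i, g i \is e.-homog.
Hypothesis inv : inverse_polys h g.
Hypothesis hw : proportional (tail h) (fun j => cone (w j)).

Let theta := g ord0 \mPov h.
Let eta := h ord0 \mPov g.

Lemma meval_left s p i :
  (g i).@[fun i => (h i).@[ocons s p]] * s = theta.@[ocons s p] * ocons s p i.
Proof.
have [_ /(_ i)/(congr1 (meval (ocons s p))) + _ _] := inverse_polysE inv.
by rewrite !mevalM !mevalXU ocons0 meval_comp.
Qed.

Lemma meval_right x i : (h i).@[fun i => (g i).@[x]] * x ord0 = eta.@[x] * x i.
Proof.
have [_ _ _ /(_ i)/(congr1 (meval x))] := inverse_polysE inv.
by rewrite !mevalM !mevalXU meval_comp.
Qed.

(* The image of the line through [o] and the point with last coordinates [p]
   contains almost all points of the line through [o] and [x]. *)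
Lemma line_image x (p := fun j => (tail g j).@[x]) :
  x ord0 != 0 -> eta.@[x] != 0 -> x (lift ord0 ord0) != 0 -> (w ord0).@[p] != 0 ->
  (theta \mPov g).@[x] != 0 -> p ord0 != 0 ->
  exists2 E : {poly k}, E != 0 & forall c, E.[c] != 0 ->
    exists q s, [/\ q != 0, theta.@[ocons s p] != 0 & forall i,
      (h i).@[ocons s p] =
      q * ocons (c * x (lift ord0 ord0)) (fun j => x (lift ord0 j)) i].
Proof.
move=> x0 etax x1 w0 thetax p0.
pose s0 := (g ord0).@[x].
have gx : ocons s0 p = (fun i => (g i).@[x]).
  by rewrite -(oconsK (fun i => (g i).@[x])).
(* The line over [p] is mapped into the line over [w(p)]. *)
have tw s j : (tail h j).@[ocons s p] * (w ord0).@[p] = (tail h ord0).@[ocons s p] * (w j).@[p].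
  have := congr1 (meval (ocons s p)) (hw j ord0); rewrite !mevalM !meval_comp => E.
  have wE l : (w l).@[p] = (w l).@[fun i => ('X_(lift ord0 i)).@[ocons s p]].
    by apply: meval_eq => i; rewrite mevalXU ocons_lift.
  by rewrite !wE.
have tx j : (tail h j).@[ocons s0 p] * x ord0 = eta.@[x] * x (lift ord0 j).
  by rewrite gx; exact: meval_right.
have t00 : (tail h ord0).@[ocons s0 p] != 0.
  by have := mulf_neq0 etax x1; rewrite -tx; apply: contraNneq => ->; rewrite mul0r.
(* The line over [w(p)] passes through [x], because [h] sends the point [g(x)] of the line over [p]
   to [x]. *)
have wx j : (w j).@[p] * x (lift ord0 ord0) = (w ord0).@[p] * x (lift ord0 j).
  apply: (mulfI etax); rewrite !mulrA [_ * (w j).@[p]]mulrC [_ * (w ord0).@[p]]mulrC.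
  by rewrite -!mulrA -!tx !mulrA [_ * (tail h j).@[_]]mulrC tw [_ * (w j).@[p]]mulrC.
have scaled s c : (h ord0).@[ocons s p] = c * (tail h ord0).@[ocons s p] ->
    forall i, (h i).@[ocons s p] = (tail h ord0).@[ocons s p] / x (lift ord0 ord0) *
      ocons (c * x (lift ord0 ord0)) (fun j => x (lift ord0 j)) i.
  move=> hc i; have [j|] := unliftP ord0 i => ->; rewrite ?ocons0 ?ocons_lift.
    apply: (mulfI w0); apply: (mulIf x1); rewrite -[h _]/(tail h j).
    have := tw s j; have := wx j; move: (tail h j).@[_] (tail h ord0).@[_] => a b E1 E2.
    transitivity (b * ((w j).@[p] * x (lift ord0 ord0))); first by rewrite mulrA -E2; ring.
    by rewrite E1; field.
  by rewrite hc; field.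
have [|||E E0 HE] := @rational_image_cofinite k (on_line p (h ord0)) (on_line p (tail h ord0))
  (on_line p theta).
- by apply: contraNneq t00 => b0; rewrite -horner_on_line b0 horner0.
- apply: contraNneq thetax => b0.
  by rewrite meval_comp -gx -horner_on_line b0 horner0.
(* If [h_0 / h_1] were constant on the line, [h] would contract it to the point [q]. But [g(q)]
   determines the parameter [s] of any general point of the line, and there are two such parameters
   [s1] and [s2]. *)
- move=> c; apply/eqP => ac.
  pose P := on_line p (tail h ord0) * on_line p theta.
  have P0 : P != 0.
    rewrite mulf_neq0 //; first by apply: contraNneq t00 => b0; rewrite -horner_on_line b0 horner0.
    apply: contraNneq thetax => b0.
    by rewrite meval_comp -gx -horner_on_line b0 horner0.
  have [s1 Ps1] := closed_nonrootP _ P0.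
  have PX0 : P * ('X - s1%:P) != 0 by rewrite mulf_neq0 // polyXsubC_eq0.
  have [s2] := closed_nonrootP _ PX0.
  rewrite rootM negb_or root_XsubC => /andP[Ps2 s21].
  pose q := ocons (c * x (lift ord0 ord0)) (fun j => x (lift ord0 j)).
  have rel s : ~~ root P s -> p ord0 * (g ord0).@[q] = (g (lift ord0 ord0)).@[q] * s /\
      (g (lift ord0 ord0)).@[q] != 0.
    rewrite rootM negb_or /root !horner_on_line => /andP[ts ths].
    have hc : (h ord0).@[ocons s p] = c * (tail h ord0).@[ocons s p].
      by rewrite -!horner_on_line ac hornerZ.
    have l0 : (tail h ord0).@[ocons s p] / x (lift ord0 ord0) != 0.
      by rewrite mulf_neq0 // invr_eq0.
    have gE i : (g i).@[fun i => (h i).@[ocons s p]] =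
        ((tail h ord0).@[ocons s p] / x (lift ord0 ord0)) ^+ e * (g i).@[q].
      by rewrite (funext (scaled _ _ hc)) (meval_homogZ _ _ (hg i)).
    have := meval_left s p (lift ord0 ord0); rewrite ocons_lift gE.
    have thE : theta.@[ocons s p] =
       ((tail h ord0).@[ocons s p] / x (lift ord0 ord0)) ^+ e * (g ord0).@[q].
      by rewrite -gE /theta meval_comp.
    move: (expf_neq0 e l0) thE ths; move: (_ ^+ e) => l l0' -> ths E1.
    split; first by apply: (mulfI l0'); rewrite mulrA [RHS]mulrA E1; ring.
    apply: contraNneq (mulf_neq0 ths p0) => g0.
    by rewrite -E1 g0 mulr0 mul0r.
  have [E1 g1] := rel _ Ps1; have [E2 _] := rel _ Ps2.
  by move: s21; rewrite -(inj_eq (mulfI g1)) -E1 -E2 eqxx.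
exists E => // c /HE[s]; rewrite !horner_on_line => -[ts ths hc].
exists ((tail h ord0).@[ocons s p] / x (lift ord0 ord0)), s; split => //.
  by rewrite mulf_neq0 // invr_eq0.
exact: scaled.
Qed.

End Lines.

Lemma inverse_polys_sym (k : closedFieldType) (n : nat) (h g : 'I_n.+1 -> {mpoly k[n.+1]}) :
  inverse_polys h g -> inverse_polys g h.
Proof. by case. Qed.

Lemma inverse_polys_comp_neq0 (k : closedFieldType) (n : nat)
    (h g : 'I_n.+1 -> {mpoly k[n.+1]}) P c :
  inverse_polys h g -> P \is c.-homog -> P != 0 -> P \mPov h != 0.
Proof.
by move=> inv hP; apply: contraNneq => Ph; apply/eqP; exact: inverse_polys_dominant hP inv Ph.
Qed.

Lemma common_nonvanishing (k : closedFieldType) (n : nat) (p q r : {mpoly k[n]}) :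
  p != 0 -> q != 0 -> r != 0 -> exists x, [/\ p.@[x] != 0, q.@[x] != 0 & r.@[x] != 0].
Proof.
move=> p0 q0 r0; have [x] := mpoly_nonvanishing (mulf_neq0 p0 (mulf_neq0 q0 r0)).
by rewrite !mevalM !mulf_eq0 !negb_or => /and3P[? ? ?]; exists x.
Qed.

Lemma meval_minor (R : comNzRingType) (n : nat) (p q r s : {mpoly R[n]}) x :
  (p * q - r * s).@[x] = p.@[x] * q.@[x] - r.@[x] * s.@[x].
Proof. by rewrite mevalB !mevalM. Qed.

Section InverseLines.
Variables (k : closedFieldType) (n : nat).

Lemma meval_cone (p : {mpoly k[n.+1]}) x : (cone p).@[x] = p.@[fun j => x (lift ord0 j)].
Proof. by rewrite meval_comp; apply: meval_eq => j; rewrite mevalXU. Qed.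

Lemma meval_section b (q : {mpoly k[n.+2]}) v : (section b q).@[v] = q.@[ocons (b * v ord0) v].
Proof.
rewrite meval_comp; apply: meval_eq => i; rewrite /section_subst /ocons.
by case: unlift => [j|]; rewrite ?mevalZ mevalXU.
Qed.

Lemma inverse_polys_tail_neq0 (h g : 'I_n.+2 -> {mpoly k[n.+2]}) j :
  inverse_polys h g -> tail h j != 0.
Proof.
move=> inv; rewrite /tail -(comp_tupleXU h).
exact: inverse_polys_comp_neq0 inv (dhomogU k _) (mpolyX_neq0 k _).
Qed.

(* By [line_image], two general points on a line through [o] have points of one
   and the same line through [o] as images under [g]; so the last coordinates
   of [g x] may be computed at the point of that line with [x_0 = b x_1]. *)
Lemma inverse_preserves_lines d e (h g : 'I_n.+2 -> {mpoly k[n.+2]})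
    (w : 'I_n.+1 -> {mpoly k[n.+1]}) :
  (forall i, h i \is d.-homog) -> (forall i, g i \is e.-homog) ->
  (forall i, w i \is d.-homog) -> inverse_polys h g ->
  proportional (tail h) (fun j => cone (w j)) -> (exists j, w j != 0) ->
  exists b, section b (tail g ord0) != 0 /\
    proportional (tail g) (fun j => cone (section b (tail g j))).
Proof.
move=> hh hg hwd inv hw [j0 wj0]; have inv' := inverse_polys_sym inv.
have w0 : cone (w ord0) != 0.
  apply: proportional_nth_neq0 (proportional_sym hw) (inverse_polys_tail_neq0 ord0 inv) _.
  by exists j0; rewrite cone_neq0.
have [gh0 _ hg0 _] := inverse_polysE inv.
(* The factors express, in order, the nonvanishing conditions of [line_image]. *)
pose omega := 'X_ord0 * (h ord0 \mPov g) * 'X_(lift ord0 ord0) *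
  (cone (w ord0) \mPov g) * ((g ord0 \mPov h) \mPov g) * tail g ord0.
have omega0 : omega != 0.
  rewrite /omega !mulf_neq0 ?mpolyX_neq0 ?(inverse_polys_tail_neq0 _ inv') //.
    exact: inverse_polys_comp_neq0 inv' (cone_dhomog (hwd _)) w0.
  exact: inverse_polys_comp_neq0 inv' (dhomog_subst (hg ord0) hh) (gh0 _).
have image x : omega.@[x] != 0 -> exists2 E : {poly k}, E != 0 & forall c, E.[c] != 0 ->
    exists a, forall j, (tail g j).@[x] =
      a * (tail g j).@[ocons (c * x (lift ord0 ord0)) (fun j => x (lift ord0 j))].
  rewrite /omega !mevalM !mulf_eq0 !negb_or !mevalXU.
  move=> /andP[/andP[/andP[/andP[/andP[x0 ex] x1] wx] tx] gx].
  rewrite cone_comp meval_comp in wx.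
  have [E E0 HE] := line_image hg inv hw x0 ex x1 wx tx gx.
  exists E => // c /HE[q [s [q0 ths hE]]].
  exists (q ^+ e * s / (g ord0 \mPov h).@[ocons s (fun j => (tail g j).@[x])]) => j.
  have := meval_left inv s (fun j => (tail g j).@[x]) (lift ord0 j).
  rewrite ocons_lift (funext hE) (meval_homogZ _ _ (hg _)) -/(tail g j) => E1.
  apply: (mulfI ths); rewrite -E1; move: ths; move: (g ord0 \mPov h).@[_] => th th0.
  by field.
have key x y : omega.@[x] != 0 -> omega.@[y] != 0 ->
    (forall j, x (lift ord0 j) = y (lift ord0 j)) -> forall i j,
    (tail g i).@[x] * (tail g j).@[y] = (tail g j).@[x] * (tail g i).@[y].
  move=> /image[E E0 HE] /image[E' E'0 HE'] xy i j.
  (* One value [c] that is admissible for both [x] and [y] gives a point of their common line to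
     which both are compared. *)
  have [c] := closed_nonrootP _ (mulf_neq0 E0 E'0); rewrite rootM negb_or => /andP[Ec E'c].
  have [a Ha] := HE c Ec; have [a' Ha'] := HE' c E'c.
  rewrite !Ha !Ha' (funext xy) xy; ring.
have sb_tail b : section b omega != 0 -> section b (tail g ord0) != 0.
  by apply: contraNneq => g0; rewrite /omega sectionM g0 mulr0.
clearbody omega.
(* This [b] makes the general point of the hyperplane [x_0 = b x_1] satisfy the conditions in
   [omega], so that it can play the role of [y]. *)
have [b sb0] := section_nonvanishing omega0; exists b; split; first exact: sb_tail.
move=> i j; apply/eqP; rewrite -subr_eq0; apply: contraT => Q0.
have csb0 : cone (section b omega) != 0 by rewrite cone_neq0.
have [x [Qx ox oy]] := common_nonvanishing Q0 omega0 csb0.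
rewrite meval_cone meval_section in oy.
have zE l : (cone (section b (tail g l))).@[x] =
    (tail g l).@[ocons (b * x (lift ord0 ord0)) (fun j => x (lift ord0 j))].
  by rewrite meval_cone meval_section.
have K := key _ _ ox oy (fun l => esym (ocons_lift _ _ l)) i j.
case/negP: Qx; apply/eqP; apply: etrans (meval_minor _ _ _ _ _) _.
apply: etrans (f_equal2 (fun u v => (tail g i).@[x] * u - (tail g j).@[x] * v) (zE j) (zE i)) _.
by apply/eqP; rewrite subr_eq0; apply/eqP.
Qed.

(** The tuple [w o tail g] is proportional to the cone of [w o z], by the hypothesis on [g], and to
    [tail h o g], by that on [h]; the latter is proportional to [(x_1, ..., x_(n+1))]. Sections
    remove the cones. *)
Lemma inverse_polys_tail d (h g : 'I_n.+2 -> {mpoly k[n.+2]})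
    (w z : 'I_n.+1 -> {mpoly k[n.+1]}) :
  (forall i, w i \is d.-homog) -> inverse_polys h g ->
  proportional (tail h) (fun j => cone (w j)) ->
  proportional (tail g) (fun j => cone (z j)) ->
  (exists j, w j != 0) -> (exists j, z j != 0) ->
  proportional (fun i => w i \mPov z) (fun i => 'X_i) /\ exists i, w i \mPov z != 0.
Proof.
move=> hw inv hwP hzP [j0 w0] [l0 z0]; have inv' := inverse_polys_sym inv.
have [_ _ hg0 _] := inverse_polysE inv; have [_ _ hgX _] := inv.
have cz0 : exists j, cone (z j) != 0 by exists l0; rewrite cone_neq0.
have tg0 : exists j, tail g j != 0 by exists ord0; exact: inverse_polys_tail_neq0 inv'.
have wtg0 : w j0 \mPov tail g != 0.
  rewrite -cone_comp; apply: inverse_polys_comp_neq0 inv' (cone_dhomog (hw _)) _.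
  by rewrite cone_neq0.
have wcz j : w j \mPov (fun l => cone (z l)) = cone (w j \mPov z) by exact: comp_cone.
have B : proportional (fun j => tail h j \mPov g) (fun j => w j \mPov tail g).
  have := rmorph_proportional (comp_mpoly [tuple g i | i < n.+2]) hwP.
  by under [X in proportional _ X]funext do rewrite /= cone_comp.
have C : proportional (fun j => w j \mPov tail g) (fun j => cone (w j \mPov z)).
  under [X in proportional _ X]funext do rewrite -wcz.
  exact: comp_proportional tg0 cz0 hw hzP.
split; last first.
  exists j0; rewrite -cone_neq0 -wcz.
  exact: comp_proportional_neq0 tg0 cz0 (hw j0) hzP wtg0.
have A : proportional (fun j => cone (w j \mPov z)) (fun j => cone 'X_j).
  apply: (proportional_trans (v := fun j => w j \mPov tail g)); first by exists j0.
    exact: proportional_sym C.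
  apply: (proportional_trans (v := fun j => tail h j \mPov g)).
  - by exists ord0; exact: hg0.
  - exact: proportional_sym B.
  - by move=> i j; rewrite /cone !comp_tupleXU; exact: hgX.
by move=> i j; apply: (can_inj (coneK 0)); rewrite !coneM; exact: A.
Qed.

End InverseLines.

(** * The de Jonquieres subgroups and sigma *)

Section Families.
Variables (k : closedFieldType) (m n : nat).

Lemma specialize_minor t (p q r s : {mpoly {mpoly k[m]}[n.+1]}) :
  specialize t (p * q - r * s) =
  specialize t p * specialize t q - specialize t r * specialize t s.
Proof. by rewrite rmorphB /= !rmorphM. Qed.

Lemma specialize_eq0_closure S t0 (P : {mpoly {mpoly k[m]}[n.+1]}) :
  zclosure S t0 -> (forall t, S t -> specialize t P = 0) -> specialize t0 P = 0.
Proof.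
move=> St0 H; apply/mpolyP => b; rewrite mcoeff0 mcoeff_specialize.
by apply: St0 => t /H St; rewrite -mcoeff_specialize St mcoeff0.
Qed.

Lemma proportional_closure l S t0 (u v : 'I_l -> {mpoly {mpoly k[m]}[n.+1]}) :
  zclosure S t0 ->
  (forall t, S t -> proportional (fun i => specialize t (u i)) (fun i => specialize t (v i))) ->
  proportional (fun i => specialize t0 (u i)) (fun i => specialize t0 (v i)).
Proof.
move=> St0 H i j; apply/eqP; rewrite -subr_eq0 -specialize_minor; apply/eqP.
apply: specialize_eq0_closure St0 _ => t /H St; rewrite specialize_minor.
by apply/eqP; rewrite subr_eq0; apply/eqP.
Qed.

Lemma specialize_neq0_open t0 (P : {mpoly {mpoly k[m]}[n.+1]}) : specialize t0 P != 0 ->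
  exists2 Q : {mpoly k[m]}, Q.@[t0] != 0 & forall t, Q.@[t] != 0 -> specialize t P != 0.
Proof.
move=> P0; exists (P@_(mlead (specialize t0 P))).
  by rewrite -mcoeff_specialize mleadc_eq0.
by move=> t; rewrite -mcoeff_specialize; apply: contraNneq => ->; rewrite mcoeff0.
Qed.

Lemma specialize_cone t (P : {mpoly {mpoly k[m]}[n.+1]}) :
  specialize t (cone P) = cone (specialize t P).
Proof.
rewrite /specialize /cone map_mpoly_subst; congr comp_mpoly.
by apply: eq_from_tnth => i; rewrite !tnth_mktuple map_mpolyX.
Qed.

Lemma specialize_section t (b : k) (P : {mpoly {mpoly k[m]}[n.+2]}) :
  specialize t (section b%:MP P) = section b (specialize t P).
Proof.
rewrite /specialize /section map_mpoly_subst; congr comp_mpoly.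
apply: eq_from_tnth => i; rewrite !tnth_mktuple /section_subst.
by case: unlift => [j|]; rewrite ?map_mpolyZ /= ?mevalC map_mpolyX.
Qed.

Lemma specialize_sigma t (h : 'I_n.+1 -> {mpoly {mpoly k[m]}[n.+1]}) i :
  specialize t (sigma_poly h i) = sigma_poly (fun j => specialize t (h j)) i.
Proof.
have E (l : 'I_n.+2) (P : {mpoly {mpoly k[m]}[n.+1]}) :
    specialize t ('X_l * cone P) = 'X_l * cone (specialize t P).
  have -> : specialize t ('X_l * cone P) = specialize t 'X_l * specialize t (cone P).
    exact: rmorphM.
  by rewrite specializeX specialize_cone.
by rewrite /sigma_poly; case: unlift => [j|]; exact: E.
Qed.

End Families.

Section Stabiliser.
Variables (k : closedFieldType) (n : nat).
Implicit Types (h g : 'I_n.+2 -> {mpoly k[n.+2]}) (u v : 'I_n.+1 -> {mpoly k[n.+1]}).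
Implicit Types (f : Bir (proj_space k n.+1)) (tau : Bir (proj_space k n)).

Local Notation tail_section b h := (fun j => section b (tail h j)).

Lemma cone_proportional u v :
  proportional u v -> proportional (fun j => cone (u j)) (fun j => cone (v j)).
Proof. by move=> H i j; rewrite -2!coneM H. Qed.

Lemma tail_section_proportional b h u :
  proportional (tail h) (fun j => cone (u j)) -> proportional (tail_section b h) u.
Proof.
move=> P i j; have := congr1 (section b) (P i j).
by rewrite 2!sectionM 2!coneK.
Qed.

Lemma exists_section f h d : (forall i, h i \is d.-homog) -> represents f (poly_map h) ->
  exists b, section b (tail h ord0) != 0.
Proof. by move=> hh rep; apply: section_nonvanishing; exact: tail_neq0 hh rep _. Qed.

(* If [f] permutes the lines through [o], the induced map [tau] is the
   restriction of [tail h] to the hyperplane [x_0 = b x_1]. *)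
Lemma St_o_section f h d b : (forall i, h i \is d.-homog) -> represents f (poly_map h) ->
  section b (tail h ord0) != 0 ->
  St_o f <-> proportional (tail h) (fun j => cone (tail_section b h j)).
Proof.
move=> hh rep b0; have hw i : tail_section b h i \is d.-homog.
  by apply: section_dhomog; exact: hh.
have w0 : exists j, tail_section b h j != 0 by exists ord0.
split=> [/(St_oP hh rep)[tau [e [u [hu rept P]]]]|P].
  apply: (proportional_trans (v := fun j => cone (u j))) (P) _.
    by have [i ui] := represents_neq0 rept; exists i; rewrite cone_neq0.
  exact: cone_proportional (proportional_sym (tail_section_proportional b P)).
have [e [g [hg repg]]] := represents_poly f^-1%g.
have inv := represents_inverse hh hg rep repg.
have [b' [b'0 P']] := inverse_preserves_lines hh hg hw inv P w0.
have z0 : exists j, tail_section b' g j != 0 by exists ord0.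
have hz i : tail_section b' g i \is e.-homog by apply: section_dhomog; exact: hg.
have [wzX wz0] := inverse_polys_tail hw inv P P' w0 z0.
have [zwX zw0] := inverse_polys_tail hz (inverse_polys_sym inv) P' P z0 w0.
have bw : birational (poly_map (tail_section b h)).
  by apply: birational_poly_map hw hz _; split.
apply/(St_oP hh rep); exists (bir_class (Birat bw)), d, (tail_section b h).
by split; [exact: hw|exact: represents_class|exact: P].
Qed.

Lemma closed_Jon_o : closed (@Jon_o k n).
Proof.
apply/closed_polyP => m d h t0 f0 hh rep0 St0.
have hht t i : specialize t (h i) \is d.-homog by exact: specialize_dhomog.
apply/(Jon_oP (hht t0) rep0).
have E (t : 'I_m -> k) : (fun j : 'I_n.+1 => specialize t 'X_(lift ord0 j)) =
    (fun j => 'X_(lift ord0 j) : {mpoly k[n.+2]}).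
  by apply: funext => j; exact: specializeX.
rewrite -(E t0); apply: (proportional_closure (u := tail h)) St0 _ => t [f Jf rep].
by rewrite (E t); apply/(Jon_oP (hht t) rep).
Qed.

Lemma poly_closed_St_o : poly_closed (@St_o k n).
Proof.
move=> m d h t0 f0 hh rep0 St0.
have hht t i : specialize t (h i) \is d.-homog by exact: specialize_dhomog.
have [b b0] := exists_section (hht t0) rep0.
have E t : (fun j => cone (tail_section b (fun i => specialize t (h i)) j)) =
    (fun j => specialize t (cone (section b%:MP (tail h j)))).
  by apply: funext => j; rewrite specialize_cone specialize_section.
(* The value [b] chosen at [t0] stays valid where [Q] is nonzero, so one and the same polynomial
   criterion applies to all parameters near [t0]. *)
have [|Q Q0 HQ] := @specialize_neq0_open _ _ _ t0 (section b%:MP (tail h ord0)).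
  by rewrite specialize_section.
apply/(St_o_section (hht t0) rep0 b0); rewrite E.
apply: (proportional_closure (u := tail h)) (zclosure_neq0 St0 Q0) _ => t [[f Sf rep] /= Qt].
have bt : section b (tail (fun i => specialize t (h i)) ord0) != 0.
  by have := HQ _ Qt; rewrite specialize_section.
have := proj1 (St_o_section (hht t) rep bt) Sf; rewrite (E t); exact.
Qed.

Lemma closed_St_o : closed (@St_o k n).
Proof. exact/closed_polyP/poly_closed_St_o. Qed.

End Stabiliser.

Section Subgroups.
Variables (k : closedFieldType) (n : nat).
Implicit Types (h g : 'I_n.+2 -> {mpoly k[n.+2]}) (u v : 'I_n.+1 -> {mpoly k[n.+1]}).
Implicit Types (f : Bir (proj_space k n.+1)) (tau : Bir (proj_space k n)).

Local Notation X' := (fun j : 'I_n.+1 => 'X_(lift ord0 j) : {mpoly k[n.+2]}).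

Lemma proportional_comp_mpoly (R : comNzRingType) a b l (p q : 'I_l -> {mpoly R[a]})
    (z : 'I_a -> {mpoly R[b]}) :
  proportional p q -> proportional (fun j => p j \mPov z) (fun j => q j \mPov z).
Proof. by move=> H i j; rewrite -2!rmorphM H. Qed.

Lemma comp_tail h g : (fun j => X' j \mPov g) = tail g.
Proof. by apply: funext => j; exact: comp_tupleXU. Qed.

Lemma comp_cone_tail u g : (fun j => cone (u j) \mPov g) = (fun j => u j \mPov tail g).
Proof. by apply: funext => j; exact: cone_comp. Qed.

Lemma Jon_o_subgroup : is_subgroup (@Jon_o k n).
Proof.
split.
- apply/(Jon_oP _ (@represents_1 k n.+1)); first by move=> i; exact: dhomogU.
  exact: proportional_refl.
- move=> x y Jx Jy; have [d [h [hh rx]]] := represents_poly x.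
  have [e [g [hg ry]]] := represents_poly y.
  apply/(Jon_oP _ (represents_mul hg hh ry rx)).
    by move=> i; apply: dhomog_subst; [exact: hh|exact: hg].
  have Px := proj1 (Jon_oP hh rx) Jx; have Py := proj1 (Jon_oP hg ry) Jy.
  have := proportional_comp_mpoly g Px; rewrite (comp_tail h) => Pxy.
  apply: (proportional_trans (v := tail g)) Pxy Py.
  by exists ord0; exact: tail_neq0 hg ry _.
- move=> x Jx; have [d [h [hh rx]]] := represents_poly x.
  have [e [g [hg ry]]] := represents_poly x^-1%g.
  have Px := proj1 (Jon_oP hh rx) Jx; apply/(Jon_oP hg ry).
  have [_ _ hgX _] := represents_inverse hh hg rx ry.
  have [_ _ hg0 _] := inverse_polysE (represents_inverse hh hg rx ry).
  have := proportional_comp_mpoly g Px; rewrite (comp_tail h) => Pxy.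
  apply: (proportional_trans (v := fun j => tail h j \mPov g)).
  + by exists ord0; exact: hg0.
  + exact: proportional_sym Pxy.
  + by move=> i j; exact: hgX.
Qed.

Lemma St_o_subgroup : is_subgroup (@St_o k n).
Proof.
split.
- have r1 := @represents_1 k n.+1.
  apply/(St_oP _ r1); first by move=> i; exact: dhomogU.
  exists 1%g, 1%N, (fun i => 'X_i); split.
  + by move=> i; exact: dhomogU.
  + exact: represents_1.
  + move=> i j; rewrite /cone !comp_tupleXU; exact: proportional_refl.
- move=> x y Sx Sy; have [d [h [hh rx]]] := represents_poly x.
  have [e [g [hg ry]]] := represents_poly y.
  have [s [a [u [hu rs Px]]]] := proj1 (St_oP hh rx) Sx.
  have [t [b [v [hv rt Py]]]] := proj1 (St_oP hg ry) Sy.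
  apply/(St_oP _ (represents_mul hg hh ry rx)).
    by move=> i; apply: dhomog_subst; [exact: hh|exact: hg].
  exists (s * t)%g, (a * b)%N, (fun i => u i \mPov v); split.
  + by move=> i; apply: dhomog_subst; [exact: hu|exact: hv].
  + exact: represents_mul hv hu rt rs.
  + have Pxy := proportional_comp_mpoly g Px; rewrite comp_cone_tail in Pxy.
    have [i0 ui0] := represents_neq0 rs; have [j0 vj0] := represents_neq0 rt.
    apply: (proportional_trans (v := fun j => u j \mPov tail g)) Pxy _.
      exists i0; rewrite -cone_comp.
      by apply: represents_dominant hg ry (cone_dhomog (hu _)) _; rewrite cone_neq0.
    have E : (fun j => u j \mPov (fun l => cone (v l))) = (fun j => cone (u j \mPov v)).
      by apply: funext => j; exact: comp_cone.
    rewrite -E; apply: comp_proportional hu Py.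
      by exists ord0; exact: tail_neq0 hg ry _.
    by exists j0; rewrite cone_neq0.
- move=> x Sx; have [d [h [hh rx]]] := represents_poly x.
  have [e [g [hg ry]]] := represents_poly x^-1%g.
  have [s [a [u [hu rs Px]]]] := proj1 (St_oP hh rx) Sx.
  have [b [v [hv rt]]] := represents_poly s^-1%g.
  apply/(St_oP hg ry); exists s^-1%g, b, v; split; [exact: hv|exact: rt|].
  have [_ _ hgX _] := represents_inverse hh hg rx ry.
  have [_ _ hg0 _] := inverse_polysE (represents_inverse hh hg rx ry).
  have [vuX _ _ _] := represents_inverse hu hv rs rt.
  have [vu0 _ _ _] := inverse_polysE (represents_inverse hu hv rs rt).
  have [i0 ui0] := represents_neq0 rs.
  have utg0 : exists j, u j \mPov tail g != 0.
    exists i0; rewrite -cone_comp.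
    by apply: represents_dominant hg ry (cone_dhomog (hu _)) _; rewrite cone_neq0.
  (* With [s] induced by [x], this says that the projection followed by [s], preceded by the inverse
     of [x], is the projection; composing with [v], which represents the inverse of [s], then gives
     the claim. *)
  have uX : proportional (fun j => u j \mPov tail g) X'.
    have Pxy := proportional_comp_mpoly g Px; rewrite comp_cone_tail in Pxy.
    apply: (proportional_trans (v := fun j => tail h j \mPov g)) (proportional_sym Pxy) _.
      by exists ord0; exact: hg0.
    by move=> i j; exact: hgX.
  have X0 : exists j, X' j != 0 by exists ord0; exact: mpolyX_neq0.
  have A := comp_proportional utg0 X0 hv uX.
  have B := proportional_comp_mpoly (tail g) vuX.
  have E1 : (fun j => 'X_j \mPov tail g) = tail g by apply: funext => j; exact: comp_tupleXU.
  have E2 : (fun j => (v j \mPov u) \mPov tail g) =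
      (fun j => v j \mPov (fun l => u l \mPov tail g)).
    by apply: funext => j; exact: comp_tupleA.
  rewrite E1 E2 in B.
  apply: (proportional_trans (v := fun j => v j \mPov (fun l => u l \mPov tail g))).
  + exists ord0; rewrite -comp_tupleA -cone_comp.
    apply: represents_dominant hg ry (cone_dhomog (dhomog_subst (hv ord0) hu)) _.
    by rewrite cone_neq0; exact: vu0.
  + exact: proportional_sym B.
  + exact: A.
Qed.

End Subgroups.

(** * The homomorphism sigma *)

Section Sigma.
Variables (k : closedFieldType) (n : nat).
Implicit Types (h u v : 'I_n.+1 -> {mpoly k[n.+1]}).
Implicit Types (tau : Bir (proj_space k n)) (f : Bir (proj_space k n.+1)).

Lemma proportional_mull (R : comNzRingType) l (c : R) (p q : 'I_l -> R) :
  proportional p q -> proportional (fun i => c * p i) q.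
Proof. by move=> H i j; rewrite -2!mulrA H. Qed.

Lemma sigma_left_inverse u h e : (forall i, u i \is e.-homog) -> h ord0 != 0 ->
  (forall i, u i \mPov h != 0) -> proportional (fun i => u i \mPov h) (fun i => 'X_i) ->
  proportional (fun i => sigma_poly u i \mPov sigma_poly h) (fun i => 'X_i) /\
  exists i, sigma_poly u i \mPov sigma_poly h != 0.
Proof.
move=> hu h0 uh0 uhX.
have s0 : sigma_poly (fun j => u j \mPov h) ord0 != 0.
  by rewrite sigma_poly0 mulf_neq0 ?mpolyX_neq0 // cone_neq0.
have c0 : cone (h ord0) * 'X_(lift ord0 ord0) ^+ e != 0.
  by rewrite mulf_neq0 ?cone_neq0 // expf_neq0 // mpolyX_neq0.
split; last by exists ord0; rewrite (comp_sigma_poly h hu) mulf_neq0.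
rewrite (funext (comp_sigma_poly h hu)); apply: proportional_mull.
have sX0 : sigma_poly (fun i => 'X_i : {mpoly k[n.+1]}) ord0 != 0.
  by rewrite sigma_poly0 mulf_neq0 ?mpolyX_neq0 // cone_neq0; exact: mpolyX_neq0.
exact: (proportional_trans (ex_intro _ ord0 sX0) (sigma_proportional uhX) (@sigma_polyX k n)).
Qed.

Lemma inverse_polys_nz h u : inverse_polys h u -> forall i, h i != 0.
Proof.
move=> inv i; have [_ _ hu0 _] := inverse_polysE inv.
by apply: contraNneq (hu0 i) => ->; rewrite comp_mpoly0.
Qed.

Lemma sigma_inverse_polys h u d e :
  (forall i, h i \is d.-homog) -> (forall i, u i \is e.-homog) ->
  inverse_polys h u -> inverse_polys (sigma_poly h) (sigma_poly u).
Proof.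
move=> hh hu inv; have inv' := inverse_polys_sym inv.
have [uhX _ huX _] := inv; have [uh0 _ hu0 _] := inverse_polysE inv.
have [A A0] := sigma_left_inverse hu (inverse_polys_nz inv ord0) uh0 uhX.
have [B B0] := sigma_left_inverse hh (inverse_polys_nz inv' ord0) hu0 huX.
exact: And4 A A0 B B0.
Qed.

(** [sigma] turns inverse tuples into inverse tuples, so the set from which [xget] selects is
    nonempty and the default value is not taken. The selected element may come from another
    representative [h'] of [tau]; it is proportional to [h], and [sigma_poly] respects this. *)
Lemma sigma_represents tau h d : (forall i, h i \is d.-homog) ->
  represents tau (poly_map h) -> represents (sigma tau) (poly_map (sigma_poly h)).
Proof.
move=> hh rep; have [e [u [hu repu]]] := represents_poly tau^-1%g.
have inv := sigma_inverse_polys hh hu (represents_inverse hh hu rep repu).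
have b := birational_poly_map (sigma_poly_dhomog hh) (sigma_poly_dhomog hu) inv.
have : [set g | exists h : 'I_n.+1 -> {mpoly k[n.+1]},
    [/\ same_degree h, represents tau (poly_map h) &
        represents g (poly_map (sigma_formula h))]] (bir_class (Birat b)).
  by exists h; split; [exists d|exact: rep|exact: represents_class].
move=> /(xgetI 1%g); rewrite -/(sigma tau) => -[h' [[d' hh'] rep' reps]].
apply: proportional_represents (sigma_poly_dhomog hh') (sigma_poly_dhomog hh) reps _ _.
  have h0 := inverse_polys_nz (represents_inverse hh hu rep repu) ord0.
  by exists ord0; rewrite sigma_poly0 mulf_neq0 ?mpolyX_neq0 // cone_neq0.
apply: sigma_proportional; exact: represents_proportional hh' hh rep' rep.
Qed.

Lemma sigma_inj : injective (@sigma k n).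
Proof.
move=> s t E; have [d [h [hh rs]]] := represents_poly s.
have [e [u [hu rt]]] := represents_poly t.
have Rs := sigma_represents hh rs; have Rt := sigma_represents hu rt.
rewrite E in Rs.
have P := represents_proportional (sigma_poly_dhomog hh) (sigma_poly_dhomog hu) Rs Rt.
apply: represents_inj (rs) _.
apply: proportional_represents hu hh rt (represents_neq0 rs) _.
exact: proportional_sym (sigma_proportional_inj P).
Qed.

Lemma sigma_monoid_morphism : monoid.monoid_morphism (@sigma k n).
Proof.
have hX i : 'X_i \is [in k[n.+1], 1.-homog] by exact: dhomogU.
have hX2 i : 'X_i \is [in k[n.+2], 1.-homog] by exact: dhomogU.
split.
  have R := sigma_represents hX (@represents_1 k n).
  have X0 : exists i, ('X_i : {mpoly k[n.+2]}) != 0 by exists ord0; exact: mpolyX_neq0.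
  have R1 := proportional_represents (sigma_poly_dhomog hX) hX2 R X0 (@sigma_polyX k n).
  exact: represents_inj R1 (@represents_1 k n.+1).
move=> s t; have [d [h [hh rs]]] := represents_poly s.
have [e [u [hu rt]]] := represents_poly t.
have hhu i : h i \mPov u \is (d * e).-homog by exact: dhomog_subst.
have R1 := sigma_represents hhu (represents_mul hu hh rt rs).
have R2 := represents_mul (sigma_poly_dhomog hu) (sigma_poly_dhomog hh)
  (sigma_represents hu rt) (sigma_represents hh rs).
have hs2 i : sigma_poly h i \mPov sigma_poly u \is (d.+1 * e.+1).-homog.
  by apply: dhomog_subst; exact: sigma_poly_dhomog.
have P : proportional (fun i => sigma_poly h i \mPov sigma_poly u)
    (sigma_poly (fun i => h i \mPov u)).
  rewrite (funext (comp_sigma_poly u hh)); apply: proportional_mull; exact: proportional_refl.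
have R3 := proportional_represents hs2 (sigma_poly_dhomog hhu) R2 (represents_neq0 R1) P.
exact: represents_inj R1 R3.
Qed.

End Sigma.

(** * The image of sigma and images of closed sets *)

Section RangeSigma.
Variables (k : closedFieldType) (n : nat).
Implicit Types (h g : 'I_n.+2 -> {mpoly k[n.+2]}) (u v : 'I_n.+1 -> {mpoly k[n.+1]}).
Implicit Types (f : Bir (proj_space k n.+1)) (tau : Bir (proj_space k n)).

Local Notation tail_section b h := (fun j => section b (tail h j)).

Lemma represents_all_neq0 tau u d : (forall i, u i \is d.-homog) ->
  represents tau (poly_map u) -> forall i, u i != 0.
Proof.
move=> hu rep i; rewrite -(comp_tupleXU u).
exact: represents_dominant hu rep (dhomogU k i) (mpolyX_neq0 k i).
Qed.

Lemma tail_sigma_poly u :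
  proportional (tail (sigma_poly u)) (fun j => cone (u j)).
Proof.
have E : tail (sigma_poly u) = fun j => 'X_(lift ord0 ord0) * cone (u j).
  by apply: funext => j; exact: sigma_poly_lift.
rewrite E; apply: proportional_mull; exact: proportional_refl.
Qed.

Lemma sigma_tail tau h u d e : (forall i, h i \is d.-homog) -> (forall i, u i \is e.-homog) ->
  represents (sigma tau) (poly_map h) -> represents tau (poly_map u) ->
  proportional (tail h) (fun j => cone (u j)).
Proof.
move=> hh hu reps rep; have rs := sigma_represents hu rep.
have P := represents_proportional hh (sigma_poly_dhomog hu) reps rs.
apply: (proportional_trans (v := tail (sigma_poly u))) _ (tail_sigma_poly u).
  by exists ord0; exact: tail_neq0 (sigma_poly_dhomog hu) rs _.
by move=> i j; exact: P.
Qed.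

Lemma sigma_section tau h d b : (forall i, h i \is d.-homog) ->
  represents (sigma tau) (poly_map h) -> section b (tail h ord0) != 0 ->
  represents tau (poly_map (tail_section b h)).
Proof.
move=> hh reps b0; have [e [u [hu rep]]] := represents_poly tau.
have P := tail_section_proportional b (sigma_tail hh hu reps rep).
apply: proportional_represents hu _ rep _ (proportional_sym P); last by exists ord0.
by move=> i; apply: section_dhomog; exact: hh.
Qed.

(** The tail fixes all ratios except those with [h_0], and the equation makes [h_0 / h_1] equal to
    [x_0 / x_1], as it is for [sigma_poly u]. *)
Lemma proportional_sigma_poly h u : proportional (tail h) (fun j => cone (u j)) ->
  'X_(lift ord0 ord0) * h ord0 = 'X_ord0 * tail h ord0 -> proportional h (sigma_poly u).
Proof.
move=> P E.
have A j : h ord0 * ('X_(lift ord0 ord0) * cone (u j)) =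
    tail h j * ('X_ord0 * cone (u ord0)).
  have Pj := P j ord0.
  by rewrite mulrC mulrAC E -mulrA -Pj mulrCA.
move=> i j; have [i'|] := unliftP ord0 i => ->; have [j'|] := unliftP ord0 j => ->.
- rewrite 2!sigma_poly_lift [LHS]mulrCA [RHS]mulrCA; congr (_ * _); exact: P.
- by rewrite sigma_poly0 sigma_poly_lift; exact: esym (A i').
- by rewrite sigma_poly0 sigma_poly_lift; exact: A j'.
- by [].
Qed.

Lemma range_sigmaP f h d : (forall i, h i \is d.-homog) -> represents f (poly_map h) ->
  range (@sigma k n) f <->
  St_o f /\ 'X_(lift ord0 ord0) * h ord0 = 'X_ord0 * tail h ord0.
Proof.
move=> hh rep; split=> [[tau _ E]|[Sf E]].
  have [e [u [hu rept]]] := represents_poly tau.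
  rewrite -E in rep; have T := sigma_tail hh hu rep rept.
  split.
    by rewrite -E; apply/(St_oP hh rep); exists tau, e, u; split.
  have := represents_proportional hh (sigma_poly_dhomog hu) rep (sigma_represents hu rept).
  move=> /(_ ord0 (lift ord0 ord0)); rewrite sigma_poly0 sigma_poly_lift.
  rewrite -/(tail h ord0) => P.
  have c0 : cone (u ord0) != 0 by rewrite cone_neq0; exact: represents_all_neq0 hu rept _.
  by apply: (mulIf c0); rewrite [LHS]mulrAC [LHS]mulrC P mulrCA mulrA.
have [tau [e [u [hu rept P]]]] := proj1 (St_oP hh rep) Sf.
exists tau => //; have rs := sigma_represents hu rept.
have R := proportional_represents hh (sigma_poly_dhomog hu) rep (represents_neq0 rs)
  (proportional_sigma_poly P E).
exact: represents_inj rs R.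
Qed.

Lemma poly_closed_range_sigma : poly_closed (range (@sigma k n)).
Proof.
move=> m d h t0 f0 hh rep0 St0.
have hht t i : specialize t (h i) \is d.-homog by exact: specialize_dhomog.
apply/(range_sigmaP (hht t0) rep0); split.
  apply: poly_closed_St_o hh rep0 _; apply: zclosureS St0 => t [f Rf rep].
  by exists f; last exact: rep; have [] := proj1 (range_sigmaP (hht t) rep) Rf.
have E (t : 'I_m -> k) : specialize t ('X_(lift ord0 ord0) * h ord0 - 'X_ord0 * tail h ord0) =
    'X_(lift ord0 ord0) * specialize t (h ord0) - 'X_ord0 * specialize t (tail h ord0).
  by rewrite specialize_minor 2!specializeX.
apply/eqP; rewrite -subr_eq0; apply/eqP.
apply: etrans (esym (E t0)) _; apply: specialize_eq0_closure St0 _ => t [f Rf rep].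
have [_ H] := proj1 (range_sigmaP (hht t) rep) Rf.
by apply: etrans (E t) _; apply/eqP; rewrite subr_eq0; apply/eqP.
Qed.

Lemma closed_range_sigma : closed (range (@sigma k n)).
Proof. exact/closed_polyP/poly_closed_range_sigma. Qed.

(** Closedness of the range first provides a preimage of the limit [f0]. Restricting the tails to a
    hyperplane [x_0 = b x_1] that suits [t0] then gives a polynomial family of preimages, to which
    closedness of [F] applies. *)
Lemma closed_sigma_image (F : set (Bir (proj_space k n))) :
  closed F -> closed (@sigma k n @` F).
Proof.
move=> /closed_polyP pF; apply/closed_polyP => m d h t0 f0 hh rep0 St0.
have hht t i : specialize t (h i) \is d.-homog by exact: specialize_dhomog.
have [tau0 _ E0] : range (@sigma k n) f0.
  apply: poly_closed_range_sigma hh rep0 _.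
  by apply: zclosureS St0 => t [f [tau Ft E] rep]; exists f; first by exists tau.
rewrite -{}E0 in rep0 *; exists tau0 => //.
have [b b0] := exists_section (hht t0) rep0.
have [|Q Q0 HQ] := @specialize_neq0_open _ _ _ t0 (section b%:MP (tail h ord0)).
  by rewrite specialize_section.
have E t : (fun j => specialize t (section b%:MP (tail h j))) =
    tail_section b (fun i => specialize t (h i)).
  by apply: funext => j; rewrite specialize_section.
apply: (pF m d (fun j => section b%:MP (tail h j)) t0).
- by move=> i; apply: section_dhomog; exact: hh.
- by rewrite E; exact: sigma_section (hht t0) rep0 b0.
apply: zclosureS (zclosure_neq0 St0 Q0) => t [[f [tau Ft Ef] rep] /= Qt].
rewrite -{}Ef in rep; exists tau => //; rewrite E.
have bt : section b (tail (fun i => specialize t (h i)) ord0) != 0.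
  by have := HQ _ Qt; rewrite specialize_section.
exact: sigma_section (hht t) rep bt.
Qed.

Lemma closed_sigma_preimage (F : set (Bir (proj_space k n.+1))) :
  closed F -> closed (@sigma k n @^-1` F).
Proof.
move=> /closed_polyP pF; apply/closed_polyP => m d h t0 tau0 hh rep0 St0.
have hht t i : specialize t (h i) \is d.-homog by exact: specialize_dhomog.
have E t : (fun i => specialize t (sigma_poly h i)) = sigma_poly (fun j => specialize t (h j)).
  by apply: funext => i; exact: specialize_sigma.
apply: (pF m d.+1 (sigma_poly h) t0).
- exact: sigma_poly_dhomog.
- by rewrite E; exact: sigma_represents (hht t0) rep0.
apply: zclosureS St0 => t [tau Ft rep]; exists (sigma tau) => //.
by rewrite E; exact: sigma_represents (hht t) rep.
Qed.

Lemma closed_immersion_sigma : closed_immersion (@sigma k n).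
Proof.
split; [exact: sigma_inj| | |exact: closed_range_sigma].
  apply/continuousP => U oU; rewrite -closedC.
  by apply: (closed_sigma_preimage (F := ~` U)); rewrite closedC.
move=> U oU; exists (~` (@sigma k n @` ~` U)).
  by rewrite openC; apply: closed_sigma_image; rewrite closedC.
apply/seteqP; split=> [_ [tau Ut <-]|_ [[tau _ <-] N]].
  by split=> [|[tau' Ut' /sigma_inj E]]; [exists tau|apply: Ut'; rewrite E].
by exists tau => //; apply: contrapT => Ut; apply: N; exists tau.
Qed.

End RangeSigma.

End ClosedSubgroups.

Local Open Scope classical_set_scope.

Theorem theorem39 (k : closedFieldType) (n : nat) :
  [/\ forall (tau : Bir (proj_space k n)) (h : 'I_n.+1 -> {mpoly k[n.+1]}),
        same_degree h -> represents tau (poly_map h) ->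
        represents (sigma tau) (poly_map (sigma_formula h)),
      injective (@sigma k n) &
      monoid_morphism (@sigma k n)] /\
  [/\ is_subgroup (@Jon_o k n), closed (@Jon_o k n),
      is_subgroup (@St_o k n) & closed (@St_o k n)] /\
  closed (range (@sigma k n)) /\
  closed_immersion (@sigma k n).
Proof.
split; first split.
- move=> tau h [d hh]; exact: sigma_represents hh.
- exact: sigma_inj.
- exact: sigma_monoid_morphism.
split; last by split; [exact: closed_range_sigma|exact: closed_immersion_sigma].
by split; [exact: Jon_o_subgroup|exact: closed_Jon_o|exact: St_o_subgroup|exact: closed_St_o].
Qed.
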